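(* Let $q$ be a prime power, let $\Delta\subset\mathbb Z/(q^2+q+1)$ be a classical difference set containing $0$, let $J=\{0,1,\dots,q\}$, let $\delta_1,\delta_2,\delta_3:J\to\Delta$ be bijections with $\delta_\alpha(0)=0$, and let $$\Gamma=\bigl\langle\sigma_1,\sigma_2,\sigma_3\ \big|\ \sigma_1^{q^2+q+1}=\sigma_2^{q^2+q+1}=\sigma_3^{q^2+q+1}=1,\ \sigma_1^{\delta_1(j)}\sigma_2^{\delta_2(j)}\sigma_3^{\delta_3(j)}=1\ \ \forall j\in J\bigr\rangle$$ be the associated panel-regular lattice, acting on its building $X$ of type $\tilde A_2$. Then $X$ is not the building associated to $\mathrm{SL}_3(\mathbb Q_p)$ for any prime $p$.
   Context: The classical projective plane of order $q$ (over $\mathbb F_q$) admits cyclic Singer groups, i.e. cyclic groups $S=\langle\sigma\rangle$ of automorphisms of order $q^2+q+1$ acting regularly on points (and on lines). For a point $p$ and a line $l$, the associated classical difference set is $\Delta=\{\delta\in\mathbb Z/(q^2+q+1):p\text{ is incident with }\sigma^\delta(l)\}$; it contains $0$ exactly when $p$ and $l$ are incident. The group $\Gamma$ acts regularly on the panels of each type of the $\tilde A_2$-building $X$, which is the flag complex of the graph with vertex set $\Gamma/S_1\sqcup\Gamma/S_2\sqcup\Gamma/S_3$, where $S_\alpha=\langle\sigma_\alpha\rangle$, and edge set $\{(gS_1,gS_2),(gS_2,gS_3),(gS_3,gS_1):g\in\Gamma\}$. The building associated to $\mathrm{SL}_3(\mathbb Q_p)$ is its Bruhat–Tits building. *)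

(* Defs.v *)
From HB Require Import structures.
From mathcomp Require Import all_boot all_order all_algebra all_classical.

Set Implicit Arguments.
Unset Strict Implicit.
Unset Printing Implicit Defensive.

Import GRing.Theory.

Local Open Scope classical_set_scope.

(** * Groups given by generators and relators *)

(* The letter (x, false) is the generator x and (x, true) is its inverse. *)
Definition word (T : Type) := seq (T * bool).

Definition invw (T : Type) (w : word T) : word T :=
  [seq (l.1, ~~ l.2) | l <- rev w].

Inductive word_eq (T : Type) (R : set (word T)) : word T -> word T -> Prop :=
| word_eq_refl u : word_eq R u u
| word_eq_sym u v : word_eq R u v -> word_eq R v u
| word_eq_trans u v w : word_eq R u v -> word_eq R v w -> word_eq R u w
| word_eq_cat u u' v v' :
    word_eq R u u' -> word_eq R v v' -> word_eq R (u ++ v) (u' ++ v')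
| word_eq_cancel x b : word_eq R [:: (x, b); (x, ~~ b)] [::]
| word_eq_relator r : R r -> word_eq R r [::].

Section PresentedGroup.
Variables (T : choiceType) (R : set (word T)).
Implicit Types u v w : word T.

Definition word_eqb u v : bool := `[< word_eq R u v >].

Lemma word_eqb_refl : reflexive word_eqb.
Proof. by move=> u; apply/asboolP; exact: word_eq_refl. Qed.

Lemma word_eqb_sym : symmetric word_eqb.
Proof. by move=> u v; apply/asboolP/asboolP; exact: word_eq_sym. Qed.

Lemma word_eqb_trans : transitive word_eqb.
Proof.
move=> v u w /asboolP uv /asboolP vw; apply/asboolP.
exact: word_eq_trans uv vw.
Qed.

Canonical word_eqb_equiv :=
  EquivRel word_eqb word_eqb_refl word_eqb_sym word_eqb_trans.

Definition presented_group := {eq_quot word_eqb}%qT.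

HB.instance Definition _ := Choice.on presented_group.

Definition pres_class w : presented_group := (\pi_presented_group w)%qT.

Lemma pres_classP u v : pres_class u = pres_class v <-> word_eq R u v.
Proof.
split; first by move=> /eqmodP /asboolP.
by move=> uv; apply/eqmodP/asboolP.
Qed.

Lemma pres_classK g : pres_class (repr g) = g.
Proof. exact: reprK. Qed.

Lemma word_eq_repr w : word_eq R (repr (pres_class w)) w.
Proof. by apply/pres_classP; rewrite pres_classK. Qed.

Lemma word_eq_invw_l w : word_eq R (invw w ++ w) [::].
Proof.
elim: w => [|[x b] w IHw]; first exact: word_eq_refl.
rewrite /invw rev_cons map_rcons -cats1 -catA /=.
apply: word_eq_trans IHw; apply: word_eq_cat; first exact: word_eq_refl.
apply: (@word_eq_cat _ _ [:: (x, ~~ b); (x, b)] [::] w w).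
  by have := word_eq_cancel R x (~~ b); rewrite negbK.
exact: word_eq_refl.
Qed.

Lemma invwK : involutive (@invw T).
Proof.
move=> w; rewrite /invw -map_rev revK -map_comp -[RHS]map_id.
by apply: eq_map => -[x b] /=; rewrite negbK.
Qed.

Lemma word_eq_invw_r w : word_eq R (w ++ invw w) [::].
Proof. by rewrite -[X in X ++ _]invwK; exact: word_eq_invw_l. Qed.

Definition pres_one := pres_class [::].
Definition pres_inv (g : presented_group) : presented_group :=
  pres_class (invw (repr g)).
Definition pres_mul (g h : presented_group) : presented_group :=
  pres_class (repr g ++ repr h).

Lemma pres_mulA : associative pres_mul.
Proof.
move=> f g h; apply/pres_classP.
apply: (@word_eq_trans _ _ _ (repr f ++ repr g ++ repr h)).
  by apply: word_eq_cat; [exact: word_eq_refl | exact: word_eq_repr].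
rewrite catA; apply/word_eq_sym.
by apply: word_eq_cat; [exact: word_eq_repr | exact: word_eq_refl].
Qed.

Lemma pres_mul1 : left_id pres_one pres_mul.
Proof.
move=> g; rewrite -[RHS]pres_classK; apply/pres_classP.
rewrite -[X in word_eq _ _ X]cat0s.
by apply: word_eq_cat; [exact: word_eq_repr | exact: word_eq_refl].
Qed.

Lemma pres_mul1r : right_id pres_one pres_mul.
Proof.
move=> g; rewrite -[RHS]pres_classK; apply/pres_classP.
rewrite -[X in word_eq _ _ X]cats0.
by apply: word_eq_cat; [exact: word_eq_refl | exact: word_eq_repr].
Qed.

Lemma pres_mulV : left_inverse pres_one pres_inv pres_mul.
Proof.
move=> g; apply/pres_classP.
apply: word_eq_trans (word_eq_invw_l (repr g)).
by apply: word_eq_cat; [exact: word_eq_repr | exact: word_eq_refl].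
Qed.

Lemma pres_mulrV : right_inverse pres_one pres_inv pres_mul.
Proof.
move=> g; apply/pres_classP.
apply: word_eq_trans (word_eq_invw_r (repr g)).
by apply: word_eq_cat; [exact: word_eq_refl | exact: word_eq_repr].
Qed.

HB.instance Definition _ := isGroup.Build presented_group
  pres_mulA pres_mul1 pres_mul1r pres_mulV pres_mulrV.

Definition pres_gen (x : T) : presented_group := pres_class [:: (x, false)].

End PresentedGroup.

(** * Simplicial complexes *)

Record simplicial_complex := SimplicialComplex {
  vertex :> Type;
  simplex : set (set vertex);
  simplex_finite : forall A, simplex A -> finite_set A;
  simplex_nonempty : forall A, simplex A -> A !=set0;
  simplex_set1 : forall x, simplex [set x];
  simplex_subset : forall A B,
    simplex A -> B `<=` A -> B !=set0 -> simplex B }.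

Definition complex_iso (K L : simplicial_complex) : Prop :=
  exists f : K -> L, bijective f /\
    forall A : set K, simplex A <-> simplex (f @` A).

Section FlagComplex.
Variables (V : Type) (adj : V -> V -> Prop).

Definition flag : set (set V) :=
  [set A | [/\ finite_set A, A !=set0 &
    forall x y, A x -> A y -> x <> y -> adj x y]].

Lemma flag_set1 x : flag [set x].
Proof.
split; [exact: finite_set1 | by exists x |].
by move=> y z /= -> ->.
Qed.

Lemma flag_subset A B : flag A -> B `<=` A -> B !=set0 -> flag B.
Proof.
move=> [finA _ adjA] BA B0; split=> //; first exact: sub_finite_set finA.
by move=> x y /BA Ax /BA Ay; exact: adjA.
Qed.

Definition flag_complex : simplicial_complex :=
  @SimplicialComplex V flag (fun A '(And3 h _ _) => h) (fun A '(And3 _ h _) => h)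
    flag_set1 flag_subset.

End FlagComplex.

(** * Coset complexes *)

Section CosetComplex.
Variable G : groupType.
Local Open Scope group_scope.

Definition cyclic_subgroup (s : G) : set G :=
  [set h | exists k : nat, h = s ^+ k \/ h = s ^- k].

Definition left_coset (g : G) (S : set G) : set G := [set g * s | s in S].

Definition left_cosets (S : set G) : set (set G) :=
  [set left_coset g S | g in [set: G]].

Variables (I : choiceType) (S : I -> set G).

(* Tagging by the index makes this the disjoint union of the G/S_a. *)
Definition coset_vertex := {a : I & left_cosets (S a)}.

Definition coset_adj (u v : coset_vertex) : Prop :=
  tag u <> tag v /\
  exists g : G, val (tagged u) = left_coset g (S (tag u)) /\
                val (tagged v) = left_coset g (S (tag v)).

Definition coset_complex : simplicial_complex := flag_complex coset_adj.

End CosetComplex.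

(** * Singer cycles and classical difference sets *)

Section ProjectivePlane.
Variable F : finFieldType.
Local Open Scope ring_scope.

Definition pg_point := {U : {vspace 'rV[F]_3} | \dim U == 1%N}.
Definition pg_line := {W : {vspace 'rV[F]_3} | \dim W == 2%N}.

Definition incident (x : pg_point) (l : pg_line) : Prop :=
  (val x <= val l)%VS.

(* An automorphism of the plane is given by its actions f on the points and h
   on the lines; it need not be induced by a linear map. *)
Definition pg_automorphism (f : pg_point -> pg_point)
    (h : pg_line -> pg_line) : Prop :=
  [/\ bijective f, bijective h &
      forall x l, incident x l <-> incident (f x) (h l)].

(* f generates a cyclic group of order n acting regularly on T; regularity
   makes the powers f^i, i < n, pairwise distinct as soon as T is inhabited. *)
Definition regular_cycle (T : Type) (n : nat) (f : T -> T) : Prop :=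
  (forall x, iter n f x = x) /\
  forall x y, exists! i : 'I_n, iter i f x = y.

Definition singer_cycle (f : pg_point -> pg_point)
    (h : pg_line -> pg_line) : Prop :=
  let n := (#|F| ^ 2 + #|F| + 1)%N in
  [/\ pg_automorphism f h, regular_cycle n f & regular_cycle n h].

End ProjectivePlane.

Definition classical_difference_set (q : nat) (D : {set 'Z_(q ^ 2 + q + 1)})
    : Prop :=
  exists (F : finFieldType) (f : pg_point F -> pg_point F)
      (h : pg_line F -> pg_line F) (x : pg_point F) (l : pg_line F),
    [/\ #|F| = q, singer_cycle f h &
        forall d, d \in D <-> incident x (iter (val d) h l)].

(** * The lattice attached to a difference set *)

Section PanelRegularLattice.
Local Open Scope ring_scope.
Variables (q : nat) (D : {set 'Z_(q ^ 2 + q + 1)}).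
Variable delta : 'I_3 -> 'I_q.+1 -> {d | d \in D}.

Definition word_pow (T : Type) (x : T) (k : nat) : word T :=
  nseq k (x, false).

(* Exponents in Z/n are represented by 0, ..., n - 1, which is harmless since
   the generators have order dividing n = q^2 + q + 1. *)
Definition panel_relators : set (word 'I_3) :=
  [set w | (exists a : 'I_3, w = word_pow a (q ^ 2 + q + 1)) \/
           (exists j : 'I_q.+1,
              w = word_pow 0 (val (val (delta 0 j))) ++
                  word_pow 1 (val (val (delta 1 j))) ++
                  word_pow 2%:R (val (val (delta 2%:R j))))].

Definition panel_lattice : groupType := presented_group panel_relators.

Definition panel_gen (a : 'I_3) : panel_lattice := pres_gen panel_relators a.

Definition panel_building : simplicial_complex :=
  coset_complex (fun a : 'I_3 => cyclic_subgroup (panel_gen a)).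

End PanelRegularLattice.

(** * p-adic integers and numbers *)

(* Z_p is the inverse limit of the Z/p^n; the residue mod p^n is represented
   by its least natural number. The otherwise unused primality proof is a
   parameter because the integral domain structure depends on it. *)
Record padic_integer (p : nat) (p_pr : prime p) := PadicInteger {
  residue : nat -> nat;
  residueP : `[< forall n, residue n = residue n.+1 %% p ^ n >] }.

Section PadicIntegers.
Variables (p : nat) (p_pr : prime p).
Local Notation Zp := (padic_integer p_pr).

HB.instance Definition _ := [isSub for @residue p p_pr].
HB.instance Definition _ := [Choice of Zp by <:].

Lemma Zp_eq (x y : Zp) : residue x =1 residue y -> x = y.
Proof. by move=> xy; apply/val_inj/funext. Qed.

Lemma residueE (x : Zp) n : residue x n = residue x n.+1 %% p ^ n.
Proof. by case: x => x /= /asboolP. Qed.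

Lemma residue_mod (x : Zp) n : residue x n %% p ^ n = residue x n.
Proof. by rewrite residueE modn_mod. Qed.

Lemma Zp_make_subproof (f : nat -> nat)
    (H : forall n, f n.+1 = f n %[mod p ^ n]) :
  `[< forall n, f n %% p ^ n = (f n.+1 %% p ^ n.+1) %% p ^ n >].
Proof.
apply/asboolP => n.
by rewrite modn_dvdm ?H // dvdn_exp2l.
Qed.

Definition Zp_make f H : Zp := PadicInteger p_pr (@Zp_make_subproof f H).

Lemma Zp_add_subproof (x y : Zp) n :
  residue x n.+1 + residue y n.+1 = residue x n + residue y n %[mod p ^ n].
Proof. by rewrite [in RHS]residueE [residue y n in RHS]residueE modnDm. Qed.

Lemma Zp_mul_subproof (x y : Zp) n :
  residue x n.+1 * residue y n.+1 = residue x n * residue y n %[mod p ^ n].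
Proof. by rewrite [in RHS]residueE [residue y n in RHS]residueE modnMm. Qed.

Lemma residue_lt (x : Zp) n : residue x n < p ^ n.
Proof. by rewrite residueE ltn_mod expn_gt0 prime_gt0. Qed.

Lemma Zp_opp_subproof (x : Zp) n :
  p ^ n.+1 - residue x n.+1 = p ^ n - residue x n %[mod p ^ n].
Proof.
apply/eqP; rewrite -(eqn_modDr (residue x n.+1)) subnK ?(ltnW (residue_lt _ _)) //.
rewrite -[X in _ == X]modnDmr -residueE subnK ?(ltnW (residue_lt _ _)) //.
by rewrite modnn expnSr modnMr.
Qed.

Lemma Zp_cst_subproof k n : k = k %[mod p ^ n].
Proof. by []. Qed.

Definition Zp_zero : Zp := Zp_make (Zp_cst_subproof 0).
Definition Zp_one : Zp := Zp_make (Zp_cst_subproof 1).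
Definition Zp_opp (x : Zp) : Zp := Zp_make (Zp_opp_subproof x).
Definition Zp_add (x y : Zp) : Zp := Zp_make (Zp_add_subproof x y).
Definition Zp_mul (x y : Zp) : Zp := Zp_make (Zp_mul_subproof x y).

Lemma Zp_addA : associative Zp_add.
Proof. by move=> x y z; apply: Zp_eq => n /=; rewrite modnDml modnDmr addnA. Qed.

Lemma Zp_addC : commutative Zp_add.
Proof. by move=> x y; apply: Zp_eq => n /=; rewrite addnC. Qed.

Lemma Zp_add0 : left_id Zp_zero Zp_add.
Proof.
by move=> x; apply: Zp_eq => n /=; rewrite mod0n add0n residue_mod.
Qed.

Lemma Zp_addN : left_inverse Zp_zero Zp_opp Zp_add.
Proof.
move=> x; apply: Zp_eq => n /=.
by rewrite modnDml subnK ?(ltnW (residue_lt _ _)) // modnn mod0n.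
Qed.

HB.instance Definition _ :=
  GRing.isZmodule.Build Zp Zp_addA Zp_addC Zp_add0 Zp_addN.

Lemma Zp_mulA : associative Zp_mul.
Proof. by move=> x y z; apply: Zp_eq => n /=; rewrite modnMml modnMmr mulnA. Qed.

Lemma Zp_mulC : commutative Zp_mul.
Proof. by move=> x y; apply: Zp_eq => n /=; rewrite mulnC. Qed.

Lemma Zp_mul1 : left_id Zp_one Zp_mul.
Proof.
by move=> x; apply: Zp_eq => n /=; rewrite modnMml mul1n residue_mod.
Qed.

Lemma Zp_mulDl : left_distributive Zp_mul Zp_add.
Proof.
by move=> x y z; apply: Zp_eq => n /=; rewrite modnMml modnDm mulnDl.
Qed.

Lemma Zp_one_neq0 : Zp_one != Zp_zero.
Proof.
apply/eqP => /(congr1 (fun x => residue x 1)) /=.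
by rewrite expn1 mod0n modn_small // prime_gt1.
Qed.

HB.instance Definition _ :=
  GRing.Zmodule_isComNzRing.Build Zp Zp_mulA Zp_mulC Zp_mul1 Zp_mulDl Zp_one_neq0.

Definition Zp_unit (x : Zp) : bool := `[< exists y, (y * x = 1)%R >].

Definition Zp_inv (x : Zp) : Zp := xget x [set y | (y * x = 1)%R].

Lemma Zp_mulV : {in Zp_unit, left_inverse 1%R Zp_inv *%R}.
Proof. by move=> x /asboolP [y yx]; rewrite /Zp_inv; case: xgetP => [z _ //|/(_ y)]. Qed.

Lemma Zp_unitP (x y : Zp) : (y * x = 1)%R -> Zp_unit x.
Proof. by move=> yx; apply/asboolP; exists y. Qed.

Lemma Zp_inv_out : {in [predC Zp_unit], Zp_inv =1 id}.
Proof.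
move=> x /negP nx; rewrite /Zp_inv; case: xgetP => // z _ zx.
by case: nx; exact: Zp_unitP zx.
Qed.

HB.instance Definition _ :=
  GRing.ComNzRing_hasMulInverse.Build Zp Zp_mulV Zp_unitP Zp_inv_out.

Lemma residue_dvdn (x : Zp) m n : m <= n ->
  (p ^ m %| residue x n) = (residue x m == 0).
Proof.
move=> /subnK <-; elim: (n - m) => [|k IHk].
  by rewrite add0n /dvdn residue_mod.
rewrite -IHk addSn (residueE x (k + m)) /dvdn modn_dvdm //.
by rewrite dvdn_exp2l // leq_addl.
Qed.

Lemma Zp_integral (x y : Zp) : (x * y = 0 -> (x == 0) || (y == 0))%R.
Proof.
move=> xy0; have [//|/eqP x0 /=] := eqVneq x 0%R; apply/eqP/Zp_eq => m.
rewrite [RHS]mod0n; apply: contrapT => /eqP ym.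
apply: x0; apply: Zp_eq => n; rewrite [RHS]mod0n; apply: contrapT => /eqP xn.
have : p ^ (n + m) %| residue x (n + m) * residue y (n + m).
  have /(congr1 (fun z => residue z (n + m))) /= := xy0.
  by rewrite mod0n => /eqP.
have xg : 0 < residue x (n + m).
  rewrite lt0n; apply: contra xn => /eqP e.
  by rewrite -(@residue_dvdn x n (n + m)) ?leq_addr // e dvdn0.
have yg : 0 < residue y (n + m).
  rewrite lt0n; apply: contra ym => /eqP e.
  by rewrite -(@residue_dvdn y m (n + m)) ?leq_addl // e dvdn0.
rewrite pfactor_dvdn ?muln_gt0 ?xg ?yg // lognM //.
move: xn ym; rewrite -(@residue_dvdn x n (n + m)) ?leq_addr //.
rewrite -(@residue_dvdn y m (n + m)) ?leq_addl // !pfactor_dvdn // -!ltnNge.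
by move=> lx ly; rewrite leqNgt -addSn (leq_add lx (ltnW ly)).
Qed.

HB.instance Definition _ := GRing.ComUnitRing_isIntegral.Build Zp Zp_integral.

End PadicIntegers.

Definition padic_number (p : nat) (p_pr : prime p) : fieldType :=
  {fraction padic_integer p_pr}.

(** * The Bruhat-Tits building of SL_n(Q_p) *)

Section BruhatTits.
Local Open Scope ring_scope.
Variables (p : nat) (p_pr : prime p) (n : nat).
Local Notation Zp := (padic_integer p_pr).
Local Notation Qp := (padic_number p_pr).

Definition scale_set (c : Qp) (L : set 'rV[Qp]_n) : set 'rV[Qp]_n :=
  [set c *: v | v in L].

(* A lattice is the Z_p-span of a basis of Q_p^n, here the rows of B. *)
Definition is_lattice (L : set 'rV[Qp]_n) : Prop :=
  exists2 B : 'M[Qp]_n, B \in unitmx &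
    L = [set map_mx (@tofrac Zp) a *m B | a in [set: 'rV[Zp]_n]].

Definition homothety_class (L : set 'rV[Qp]_n) : set (set 'rV[Qp]_n) :=
  [set scale_set c L | c in [set c : Qp | c != 0]].

Definition lattice_classes : set (set (set 'rV[Qp]_n)) :=
  [set homothety_class L | L in is_lattice].

Definition lattice_adj (x y : lattice_classes) : Prop :=
  exists L M : set 'rV[Qp]_n,
    [/\ val x L, val y M, scale_set p%:R L `<` M & M `<` L].

Definition SL_building : simplicial_complex := flag_complex lattice_adj.

End BruhatTits.

(* Main.v *)
From HB Require Import structures.
Require Import Defs.
From mathcomp Require Import all_boot all_order all_algebra all_classical.
From mathcomp Require Import finfield ring zify.

(** An isomorphism would identify the cosets of the three cyclic subgroups of Gamma with the homothety
classes of lattices in Q_p^3, and left multiplication by Gamma with permutations of these classes that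
preserve adjacency. The contradiction comes from the behaviour of these permutations near a chamber.

Orientation. An edge of the Bruhat-Tits building has a direction: one of the two classes contains the
other with index p. Two sublattices of index p of a lattice have a common sublattice of index p
in both, hence the direction of the edges between two types of cosets does not change across a panel
[coherent], and Gamma preserves relative index [mv_action].

Regularity. In the link of a vertex, a projective plane over F_p, the cyclic group that fixes the
vertex is transitive on points and on lines. Together with the perfect difference set contained in the
relations, a counting argument shows that it is regular on points and that the order q of the
classical plane is p [reg_sets, fam_card].

Local linearity. A permutation of lattice classes that preserves relative index and fixes the class of
Z_p^3 agrees, on the lattices containing p^n Z_p^3, with a matrix of GL_3(Z_p): this is the fundamental
theorem of projective geometry over Z/p^n, a ring without automorphisms [ball_linear]. At the vertices
of a chamber one obtains matrices U_j, V_j, W_j for the elements sigma^delta(j) of the three cyclic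
groups, or for their inverses. Those of one group commute, their powers of exponent p^2 + p + 1 are
scalar modulo p^3, and their (2,0) entries are divisible by p in a basis adapted to the chamber. The
relations of Gamma say that the product of U_j, V_j and W_j, taken in three coordinate systems that
differ by the rotation e0 -> e1 -> e2 -> p e0, is scalar modulo p^3 [linear_prod].

Carries. For every t in F_p there is a j such that U_j is congruent to U_1 + t modulo p up to a scalar,
where U_1 is one of the U_j. As the powers of exponent p^3 of these matrices are the matrices themselves
up to scalars, they are determined modulo p^2 by their reductions, as Teichmueller representatives
are. So the second digits of their (2,0) entries differ by an explicit polynomial in t of degree p - 1,
whose coefficient of degree p - 1 is the (2,0) entry of U_1^(p^2) modulo p [teich_entry]. On the other
hand the product relations make this difference linear in t [carry_linear]. For p > 2, this entry
therefore vanishes [carry_vanishes]. For p = 2 it vanishes for at least one of the three groups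
[carry_even].

Multipliers. The vanishing means that p^2 d is in the difference set along with d. Since every element
of the difference set can play the role of 0 [triangle_rebase], this is impossible in Z/(p^2 + p + 1)
[triangle_false]. *)

Set Implicit Arguments.
Unset Strict Implicit.
Unset Printing Implicit Defensive.
Import GRing.Theory.
Local Open Scope ring_scope.

(** * The p-adic integers as a discrete valuation ring *)

Section PadicFacts.
Variables (p : nat) (p_pr : prime p).
Local Notation R := (padic_integer p_pr).
Local Notation K := (padic_number p_pr).

Lemma residue_nat k n : residue (k%:R : R) n = (k %% p ^ n)%N.
Proof.
elim: k => [|k IHk] /=; first by [].
by rewrite mulrSr /= IHk modnDm addn1.
Qed.

Lemma residueD (x y : R) n : residue (x + y) n = ((residue x n + residue y n) %% p ^ n)%N.
Proof. by []. Qed.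
Lemma residueM (x y : R) n : residue (x * y) n = ((residue x n * residue y n) %% p ^ n)%N.
Proof. by []. Qed.

Lemma natp_neq0 : (p%:R : R) != 0.
Proof.
apply/eqP => /(congr1 (fun x => residue x 2)).
rewrite residue_nat /= mod0n modn_small; last by rewrite -{1}(expn1 p) ltn_exp2l ?prime_gt1.
by move=> p0; move: p_pr; rewrite p0.
Qed.

Definition red (x : R) : 'F_p := (residue x 1)%:R.

Lemma natF_mod k : ((k %% p)%N%:R : 'F_p) = k%:R.
Proof. by apply/val_inj; rewrite /= !val_Fp_nat // modn_mod. Qed.

Fact red_additive : zmod_morphism red.
Proof.
move=> x y; apply: (addIr (red y)); rewrite subrK /red -natrD -natF_mod.
by rewrite -[X in (_ %% X)%N]expn1 -residueD subrK.
Qed.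
Fact red_multiplicative : monoid_morphism red.
Proof.
split=> [|x y]; first by rewrite /red (residue_nat 1) expn1 natF_mod.
by rewrite /red residueM expn1 natF_mod natrM.
Qed.
HB.instance Definition _ := GRing.isZmodMorphism.Build R 'F_p red red_additive.
HB.instance Definition _ := GRing.isMonoidMorphism.Build R 'F_p red red_multiplicative.

Lemma red_eq0 (x : R) : red x = 0 <-> exists y, x = p%:R * y.
Proof.
split=> [|[y ->]]; last by rewrite rmorphM rmorph_nat pchar_Fp_0 // mul0r.
move/eqP; rewrite /red -(dvdn_pcharf (pchar_Fp p_pr)) => px.
have dvdx n : (p %| residue x n.+1)%N.
  elim: n => // n IHn; move: IHn; rewrite (residueE x n.+1) /dvdn modn_dvdm //.
  by rewrite expnS dvdn_mulr.
have H n : (residue x n.+2 %/ p = residue x n.+1 %/ p %[mod p ^ n])%N.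
  by rewrite (residueE x n.+1) !modn_divl -expnSr modn_mod.
exists (Zp_make p_pr H); apply: Zp_eq => n; rewrite residueM residue_nat /= modnMml.
by rewrite modnMmr mulnC divnK // -residueE.
Qed.

(** The inverses modulo p^n given by the extended Euclidean algorithm are compatible. *)
Lemma red_neq0_unit (x : R) : red x != 0 -> x \is a GRing.unit.
Proof.
rewrite /red -(dvdn_pcharf (pchar_Fp p_pr)) => px.
have cop n : coprime (residue x n) (p ^ n).
  case: n => [|n]; first by rewrite expn0 coprimen1.
  rewrite coprimeXr // coprime_sym prime_coprime //; apply: contra px.
  elim: n => // n IHn dn; apply: IHn; rewrite residueE /dvdn modn_dvdm //.
  by rewrite expnS dvdn_mulr.
pose f n := (egcdn (residue x n) (p ^ n)).1.
have fP n : (f n * residue x n = 1 %[mod p ^ n])%N.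
  rewrite /f; case: (posnP (residue x n)) => [x0|xgt].
    have := cop n; rewrite x0 /coprime gcd0n => /eqP ->.
    by rewrite !modn1.
  case: egcdnP => //= km kn -> _; rewrite (eqP (cop n)).
  by rewrite modnMDl.
have H n : (f n.+1 = f n %[mod p ^ n])%N.
  have e : (f n.+1 * residue x n = 1 %[mod p ^ n])%N.
    rewrite residueE modnMmr.
    have /(congr1 (modn^~ (p ^ n)%N)) := fP n.+1.
    by rewrite !modn_dvdm // dvdn_exp2l.
  have := congr1 (fun z => (z * f n) %% p ^ n)%N e.
  rewrite /= !modnMml mul1n -mulnA [(residue x n * _)%N]mulnC => <-.
  by rewrite -modnMmr fP modnMmr muln1.
apply/asboolP; exists (Zp_make p_pr H); apply: Zp_eq => n.
by rewrite residueM /= modnMml fP.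
Qed.

Lemma unitR (x : R) : (x \is a GRing.unit) = (red x != 0).
Proof.
apply/idP/idP => [ux|]; last exact: red_neq0_unit.
by have := rmorph_unit red ux; rewrite unitfE.
Qed.

Lemma p_dvd_n (x : R) n : residue x n = 0%N -> exists y, x = p%:R ^+ n * y.
Proof.
elim: n x => [|n IHn] x xn; first by exists x; rewrite mul1r.
have [y xy] : exists y, x = p%:R * y.
  apply/red_eq0; rewrite /red.
  have /eqP -> // : residue x 1 == 0%N.
  by rewrite -(@residue_dvdn p p_pr x 1 n.+1) // xn dvdn0.
have [z yz] : exists z, y = p%:R ^+ n * z.
  apply: IHn; move: xn; rewrite xy residueM residue_nat modnMml => /eqP.
  rewrite -/(dvdn _ _) expnS dvdn_pmul2l ?prime_gt0 // => d.
  by apply/eqP; rewrite -(@residue_dvdn p p_pr y n n.+1).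
by exists z; rewrite xy yz mulrA exprS.
Qed.

Lemma valP_R (x : R) : x != 0 -> exists k u, u \is a GRing.unit /\ x = p%:R ^+ k * u.
Proof.
move=> x0; have [n xn] : exists n, residue x n != 0%N.
  apply: contrapT => H; case/eqP: x0; apply: Zp_eq => n; rewrite /= mod0n.
  by apply: contrapT => /eqP xn; apply: H; exists n.
elim: n x x0 xn => [|n IHn] x x0 xn.
  by have := residue_lt x 0; rewrite expn0 ltnS leqn0 (negPf xn).
have [/red_eq0 [y xy]|r0] := eqVneq (red x) 0; last first.
  by exists 0%N, x; rewrite mul1r unitR.
have y0 : y != 0 by apply: contra x0; rewrite xy => /eqP ->; rewrite mulr0.
have [|k [u [uu yu]]] := IHn y y0.
  apply: contra xn => /eqP yn; have [z yz] := p_dvd_n yn.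
  by rewrite xy yz mulrA -exprS -natrX residueM residue_nat modnn mul0n mod0n.
by exists k.+1, u; rewrite xy yu mulrA exprS.
Qed.

Lemma fracE (c : K) : exists x y : R, y != 0 /\ c = tofrac x / tofrac y.
Proof.
exists (frac (repr c)).1, (frac (repr c)).2; split; first exact: denom_ratioP.
rewrite -[LHS](mulfK (x := tofrac (frac (repr c)).2)) ?tofrac_eq0 ?denom_ratioP //.
congr (_ / _); rewrite -{1}[c]reprK; unlock tofrac; rewrite -[LHS]FracField.pi_mul.
apply/eqmodP; rewrite /= FracField.equivfE /FracField.mulf /=.
rewrite !numden_Ratio ?(mulf_neq0, oner_neq0, denom_ratioP) //.
by rewrite !mulr1 mulrC.
Qed.

End PadicFacts.

(** A discrete valuation ring with uniformiser p and residue field F_p, together with its field of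
fractions. *)
Record dvr (p : nat) := Dvr {
  dvr_ring :> idomainType;
  dvr_field : fieldType;
  dvr_red : {rmorphism dvr_ring -> 'F_p};
  dvr_frac : {rmorphism dvr_ring -> dvr_field};
  dvr_prime : prime p;
  dvr_p_neq0 : (p%:R : dvr_ring) != 0;
  dvr_unit : forall x, (x \is a GRing.unit) = (dvr_red x != 0);
  dvr_red_eq0 : forall x, dvr_red x = 0 -> exists y, x = p%:R * y;
  dvr_val : forall x : dvr_ring, x != 0 ->
    exists k u, u \is a GRing.unit /\ x = p%:R ^+ k * u;
  dvr_frac_inj : injective dvr_frac;
  dvr_fracE : forall c, exists x y : dvr_ring, y != 0 /\ c = dvr_frac x / dvr_frac y }.

Definition padic_dvr (p : nat) (p_pr : prime p) : dvr p.
Proof.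
refine (@Dvr p (padic_integer p_pr) (padic_number p_pr) (@red p p_pr) (@tofrac (padic_integer p_pr))
  p_pr (natp_neq0 p_pr) (@unitR p p_pr) _ (@valP_R p p_pr) _ (@fracE p p_pr)).
- by move=> x /red_eq0.
- by move=> x y /eqP; rewrite tofrac_eq => /eqP.
Defined.

Section DvrTheory.
Variables (p : nat) (R : dvr p).
Local Notation K := (dvr_field R).
Local Notation pi := (p%:R : R).
Local Notation red := (@dvr_red p R).
Local Notation fr := (@dvr_frac p R).

Lemma pi_neq0 : pi != 0. Proof. exact: dvr_p_neq0. Qed.

Lemma piX_neq0 n : pi ^+ n != 0. Proof. exact: expf_neq0 (pi_neq0). Qed.

Lemma red_pi : red pi = 0.
Proof. by rewrite rmorph_nat pchar_Fp_0 // (dvr_prime R). Qed.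

Lemma redP x : red x = 0 <-> exists y, x = pi * y.
Proof. by split=> [/dvr_red_eq0 //|[y ->]]; rewrite rmorphM /= red_pi mul0r. Qed.

Lemma red_nat_surj (c : 'F_p) : exists k, red k%:R = c.
Proof. by exists (val c); rewrite rmorph_nat natr_Zp. Qed.

(** The natural numbers are dense, because the residue field is the prime field. *)
Lemma dvr_nat_approx (x : R) n : exists k y, x = k%:R + pi ^+ n * y.
Proof.
elim: n => [|n [k [y e]]]; first by exists 0%N, x; rewrite add0r mul1r.
have [l lP] := red_nat_surj (red y).
have [z zP] : exists z, y - l%:R = pi * z by apply/redP; rewrite rmorphB /= lP subrr.
exists (k + p ^ n * l)%N, z; rewrite natrD natrM natrX e -addrA; congr (_ + _).
by rewrite exprSr -mulrA -zP -mulrDr [l%:R + _]addrC subrK.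
Qed.

Lemma fr_eq0 x : (fr x == 0) = (x == 0).
Proof. by rewrite -(rmorph0 fr) (inj_eq (@dvr_frac_inj p R)). Qed.

Lemma unit_pX k l (u v : R) : u \is a GRing.unit -> v \is a GRing.unit ->
  pi ^+ k * u = pi ^+ l * v -> k = l.
Proof.
wlog kl : k l u v / (k <= l)%N.
  move=> H uu uv e; case/orP: (leq_total k l) => kl; first exact: H kl uu uv e.
  by apply/esym; exact: H kl uv uu (esym e).
move=> uu uv; rewrite -(subnKC kl) exprD -mulrA => /(mulfI (piX_neq0 k)) uE.
move: uu; rewrite uE unitrM uv andbT; case: (l - k)%N => [|m]; first by rewrite addn0.
by rewrite dvr_unit rmorphXn /= red_pi exprS mul0r eqxx.
Qed.

Lemma valP_K (c : K) : c != 0 -> exists k l u, u \is a GRing.unit /\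
  c * fr (pi ^+ k) = fr (pi ^+ l * u).
Proof.
have [x [y [y0 ->]]] := dvr_fracE c.
rewrite mulf_eq0 invr_eq0 !fr_eq0 negb_or => /andP[x0 _].
have [k [u [uu xu]]] := dvr_val x0; have [l [v [uv yv]]] := dvr_val y0.
exists l, k, (u / v); split; first by rewrite unitrM uu unitrV.
have -> : pi ^+ l = y / v by rewrite yv mulrK.
have -> : pi ^+ k * (u / v) = x / v by rewrite mulrA -xu.
by rewrite !rmorphM /= mulrA divfK // fr_eq0.
Qed.

End DvrTheory.

(** * Three-by-three matrices *)

Definition o0 : 'I_3 := @Ordinal 3 0 isT.
Definition o1 : 'I_3 := @Ordinal 3 1 isT.
Definition o2 : 'I_3 := @Ordinal 3 2 isT.

Lemma all3 (P : 'I_3 -> Prop) : P o0 -> P o1 -> P o2 -> forall i, P i.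
Proof.
move=> P0 P1 P2 [[|[|[|//]]] lti].
- by rewrite (_ : Ordinal lti = o0) //; apply/val_inj.
- by rewrite (_ : Ordinal lti = o1) //; apply/val_inj.
- by rewrite (_ : Ordinal lti = o2) //; apply/val_inj.
Qed.

Lemma sum3 (V : nmodType) (F : 'I_3 -> V) : \sum_i F i = F o0 + F o1 + F o2.
Proof.
rewrite !big_ord_recl big_ord0 addr0 addrA.
by congr (F _ + F _ + F _); apply/val_inj.
Qed.

Definition mx3 (T : Type) (a b c d e f g h i : T) : 'M[T]_3 :=
  \matrix_(k, l) nth a (nth [::] [:: [:: a; b; c]; [:: d; e; f]; [:: g; h; i]] k) l.

Definition rows3 (T : Type) (u v w : 'rV[T]_3) : 'M[T]_3 :=
  \matrix_(k, l) (nth u [:: u; v; w] k) ord0 l.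

Lemma det2 (S : comNzRingType) (M : 'M[S]_2) : \det M =
  M ord0 ord0 * M ord_max ord_max - M ord0 ord_max * M ord_max ord0.
Proof.
rewrite (expand_det_row _ ord0) !big_ord_recl big_ord0 /cofactor !det_mx11 !mxE addr0.
have e1 : lift ord0 (ord0 : 'I_1) = ord_max :> 'I_2 by apply/val_inj.
have e2 : lift ord_max (ord0 : 'I_1) = ord0 :> 'I_2 by apply/val_inj.
have e0 : (0 : 'I_1) = ord0 by [].
by rewrite !e0 !e1 !e2 /= expr0 expr1 mul1r mulN1r mulrN.
Qed.

Lemma det3 (S : comNzRingType) (M : 'M[S]_3) : \det M =
  M o0 o0 * (M o1 o1 * M o2 o2 - M o1 o2 * M o2 o1)
  - M o0 o1 * (M o1 o0 * M o2 o2 - M o1 o2 * M o2 o0)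
  + M o0 o2 * (M o1 o0 * M o2 o1 - M o1 o1 * M o2 o0).
Proof.
rewrite (expand_det_row _ o0) sum3 /cofactor !det2 !mxE.
have e00 : lift o0 (ord0 : 'I_2) = o1 by apply/val_inj.
have e01 : lift o0 (ord_max : 'I_2) = o2 by apply/val_inj.
have e10 : lift o1 (ord0 : 'I_2) = o0 by apply/val_inj.
have e11 : lift o1 (ord_max : 'I_2) = o2 by apply/val_inj.
have e20 : lift o2 (ord0 : 'I_2) = o0 by apply/val_inj.
have e21 : lift o2 (ord_max : 'I_2) = o1 by apply/val_inj.
rewrite e00 e01 e10 e11 e20 e21 /= expr0 expr1 -signr_odd /= expr0.
by rewrite !mul1r mulN1r mulrN.
Qed.

Lemma mulmx3 (S : pzSemiRingType) (M N : 'M[S]_3) i j :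
  (M *m N) i j = M i o0 * N o0 j + M i o1 * N o1 j + M i o2 * N o2 j.
Proof. by rewrite mxE sum3. Qed.

Lemma vmul3 (S : pzSemiRingType) (v : 'rV[S]_3) (N : 'M[S]_3) i j :
  (v *m N) i j = v i o0 * N o0 j + v i o1 * N o1 j + v i o2 * N o2 j.
Proof. by rewrite mxE sum3. Qed.

Lemma matrix3P (T : Type) m (M N : 'M[T]_(m, 3)) :
  (forall i, M i o0 = N i o0) -> (forall i, M i o1 = N i o1) ->
  (forall i, M i o2 = N i o2) -> M = N.
Proof. by move=> h0 h1 h2; apply/matrixP => i j; move: j i; exact: (@all3 (fun j => forall i, M i j = N i j)). Qed.

Lemma row3P (T : Type) (M N : 'M[T]_3) :
  row o0 M = row o0 N -> row o1 M = row o1 N -> row o2 M = row o2 N -> M = N.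
Proof. by move=> h0 h1 h2; apply/row_matrixP; exact: (@all3 (fun i => row i M = row i N)). Qed.

Lemma row_rows0 (T : Type) (u v w : 'rV[T]_3) : row o0 (rows3 u v w) = u.
Proof. by apply/rowP => j; rewrite !mxE. Qed.
Lemma row_rows1 (T : Type) (u v w : 'rV[T]_3) : row o1 (rows3 u v w) = v.
Proof. by apply/rowP => j; rewrite !mxE. Qed.
Lemma row_rows2 (T : Type) (u v w : 'rV[T]_3) : row o2 (rows3 u v w) = w.
Proof. by apply/rowP => j; rewrite !mxE. Qed.

Definition prim (S : comUnitRingType) (v : 'rV[S]_3) : Prop := exists i, v ord0 i \is a GRing.unit.

Definition e_ (S : pzSemiRingType) (i : 'I_3) : 'rV[S]_3 := delta_mx ord0 i.

(** A primitive vector is completed to a basis by two of the three unit vectors. *)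
Definition ext (S : comUnitRingType) (v : 'rV[S]_3) : 'M[S]_3 :=
  if v ord0 o0 \is a GRing.unit then rows3 v (e_ S o1) (e_ S o2)
  else if v ord0 o1 \is a GRing.unit then rows3 v (e_ S o0) (e_ S o2)
  else rows3 v (e_ S o0) (e_ S o1).

Lemma row_ext (S : comUnitRingType) (v : 'rV[S]_3) : row o0 (ext v) = v.
Proof. by rewrite /ext; case: ifP => _; [|case: ifP => _]; rewrite row_rows0. Qed.

Lemma ext_unit (S : comUnitRingType) (v : 'rV[S]_3) : prim v -> ext v \in unitmx.
Proof.
move=> [i]; rewrite unitmxE /ext; move: i.
apply: all3 => ui; (case: ifP => u0; [|case: ifP => u1]);
  rewrite det3 !mxE /= ?(mulr0, mul0r, mulr1, mul1r, subr0, sub0r, addr0, add0r, oppr0, unitrN) //.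
- by rewrite ui in u0.
- by rewrite ui in u1.
Qed.

Definition diag3 (S : pzSemiRingType) (a b c : S) : 'M[S]_3 :=
  \matrix_(i, j) (if i == j then nth a [:: a; b; c] i else 0).

Lemma diag3_row (S : pzSemiRingType) (a b c : S) (M : 'M[S]_3) i j :
  (diag3 a b c *m M) i j = nth a [:: a; b; c] i * M i j.
Proof.
rewrite mulmx3 !mxE; move: i; apply: (@all3 _); by rewrite /= ?(mul0r, addr0, add0r).
Qed.

Lemma diag3_col (S : comPzSemiRingType) (a b c : S) (M : 'M[S]_3) i j :
  (M *m diag3 a b c) i j = nth a [:: a; b; c] j * M i j.
Proof.
rewrite mulmx3 !mxE; move: j.
by apply: (@all3 _); rewrite /= ?(mulr0, addr0, add0r) mulrC.
Qed.

Lemma det_diag3 (S : comNzRingType) (a b c : S) : \det (diag3 a b c) = a * b * c.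
Proof. by rewrite det3 !mxE /=; ring. Qed.

(** * Relative position of lattices *)

Section Lattices.
Variables (p : nat) (R : dvr p).
Local Notation K := (dvr_field R).
Local Notation pi := (p%:R : R).
Local Notation red := (@dvr_red p R).
Local Notation fr := (@dvr_frac p R).
Local Notation io := (map_mx fr).

(** The rows of N span a sublattice of index p^m in R^3. *)
Definition dv m (N : 'M[R]_3) : Prop :=
  exists2 u : R, u \is a GRing.unit & \det N = pi ^+ m * u.

Lemma io_inj n m : injective (io : 'M[R]_(n, m) -> 'M[K]_(n, m)).
Proof.
move=> M N /matrixP MN; apply/matrixP => i j; have := MN i j.
by rewrite !mxE => /dvr_frac_inj.
Qed.

Lemma dv_mul m k M N : dv m M -> dv k N -> dv (m + k) (M *m N).
Proof.
move=> [u uu Mu] [v uv Nv]; exists (u * v); first by rewrite unitrM uu uv.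
by rewrite det_mulmx Mu Nv exprD; ring.
Qed.

Lemma dv0 N : dv 0 N <-> N \in unitmx.
Proof.
rewrite unitmxE; split=> [[u uu ->]|uN]; first by rewrite mul1r.
by exists (\det N); rewrite ?mul1r.
Qed.

Lemma dv_inj m k N : dv m N -> dv k N -> m = k.
Proof. by move=> [u uu e1] [v uv e2]; apply: (unit_pX uu uv); rewrite -e1 -e2. Qed.

Lemma dv_neq0 m N : dv m N -> \det N != 0.
Proof.
move=> [u uu ->]; rewrite mulf_neq0 ?piX_neq0 //.
by apply: contraL uu => /eqP ->; rewrite unitr0.
Qed.

Lemma dv_io m N : dv m N -> io N \in unitmx.
Proof. by move/dv_neq0; rewrite unitmxE det_map_mx unitfE fr_eq0. Qed.

Lemma det0_dv N : \det N != 0 -> exists m, dv m N.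
Proof. by move/dvr_val => [m [u [uu e]]]; exists m, u. Qed.

Lemma dv_diag a b c : dv (a + b + c) (diag3 (pi ^+ a) (pi ^+ b) (pi ^+ c)).
Proof. by exists 1; rewrite ?unitr1 // det_diag3 mulr1 !exprD. Qed.

Lemma dv_sub m k M N : dv (m + k) (M *m N) -> dv k N -> dv m M.
Proof.
move=> [u uu MN] [v uv Nv]; exists (u / v); first by rewrite unitrM uu unitrV.
move: MN; rewrite det_mulmx Nv exprD => e.
have pk0 := piX_neq0 R k.
apply: (mulfI pk0); apply: (mulIr uv).
transitivity (pi ^+ m * pi ^+ k * (u / v * v)); last by ring.
by rewrite divrK // -e; ring.
Qed.

(** An invertible matrix over K stands for the lattice spanned by its rows. Up to homothety, B' spans a
sublattice of index p^m in the lattice of B. In particular Q 0 is equality of homothety classes, and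
the edges of the building are the pairs related by Q 1 in one direction or the other. *)
Definition Q m (B B' : 'M[K]_3) : Prop :=
  exists c : K, exists N : 'M[R]_3, [/\ c != 0, dv m N & c *: B' = io N *m B].

Lemma Q_comp m k A B C : Q m A B -> Q k B C -> Q (m + k) A C.
Proof.
move=> [c [M [c0 vM eB]]] [d [N [d0 vN eC]]].
exists (c * d), (N *m M); split; rewrite ?mulf_neq0 //; first by rewrite addnC; exact: dv_mul.
by rewrite map_mxM -mulmxA -eB -scalemxAr -scalerA eC.
Qed.

Lemma Q0_trans A B C : Q 0 A B -> Q 0 B C -> Q 0 A C.
Proof. exact: (@Q_comp 0 0). Qed.

Lemma Q_refl A : Q 0 A A.
Proof. by exists 1, 1%:M; split; rewrite ?oner_neq0 // ?dv0 ?unitmx1 // map_mx1 mul1mx scale1r. Qed.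

Lemma Q_sym A B : Q 0 A B -> Q 0 B A.
Proof.
move=> [c [N [c0 /dv0 uN e]]]; exists c^-1, (invmx N); split; rewrite ?invr_eq0 //.
  by apply/dv0; rewrite unitmx_inv.
have -> : B = c^-1 *: (c *: B) by rewrite scalerA mulVf // scale1r.
by rewrite e -scalemxAr mulmxA -map_mxM mulVmx // map_mx1 mul1mx.
Qed.

Lemma Q0_l m A A' B : Q 0 A A' -> Q m A B <-> Q m A' B.
Proof. by move=> AA'; split; [apply: (@Q_comp 0 m); exact: Q_sym|apply: (@Q_comp 0 m)]. Qed.
Lemma Q0_r m A B B' : Q 0 B B' -> Q m A B <-> Q m A B'.
Proof.
by move=> BB'; split=> H; rewrite -[m]addn0; apply: Q_comp H _; [|exact: Q_sym].
Qed.

Lemma Q_mulr m A B g : Q m A B -> Q m (A *m g) (B *m g).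
Proof. by move=> [c [N [c0 vN e]]]; exists c, N; split=> //; rewrite mulmxA -e scalemxAl. Qed.

Lemma Q_mulrE m A B g : g \in unitmx -> Q m (A *m g) (B *m g) <-> Q m A B.
Proof. by move=> ug; split=> [/(Q_mulr (invmx g))|]; [rewrite !mulmxK | exact: Q_mulr]. Qed.

Lemma Q_scale (c : K) B : c != 0 -> Q 0 B (c *: B).
Proof.
move=> c0; exists c^-1, 1%:M; split; rewrite ?invr_eq0 //; first by apply/dv0; rewrite unitmx1.
by rewrite scalerA mulVf // scale1r map_mx1 mul1mx.
Qed.

Lemma Q_io m N B : dv m N -> Q m B (io N *m B).
Proof. by move=> vN; exists 1, N; split; rewrite ?oner_neq0 // scale1r. Qed.

(** Between integral matrices, the valuations of the determinants leave no room for a homothety. *)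
Lemma Q_exact m a A B : dv a A -> dv (a + m) B -> Q m (io A) (io B) -> exists N, B = N *m A.
Proof.
move=> [u uu Au] [v uv Bv] [c [N [c0 [w uw Nw] e]]].
have [k [l [x [ux cx]]]] := valP_K c0.
have e1 : io (pi ^+ l * x *: B) = io (pi ^+ k *: (N *m A)).
  by rewrite !map_mxZ -cx mulrC -scalerA e map_mxM.
have {}e1 := io_inj e1; have := congr1 determinant e1.
rewrite !detZ det_mulmx Bv Nw Au => e2.
have : pi ^+ (l * 3 + (a + m)) * (x ^+ 3 * v) = pi ^+ (k * 3 + (m + a)) * (w * u).
  transitivity ((pi ^+ l * x) ^+ 3 * (pi ^+ (a + m) * v)).
    by rewrite !exprD exprM; ring.
  by rewrite e2 !exprD exprM; ring.
have ul : x ^+ 3 * v \is a GRing.unit by rewrite unitrM unitrX.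
have ur : w * u \is a GRing.unit by rewrite unitrM uw.
move/(unit_pX ul ur) => kl.
have {}kl : l = k.
  by move/eqP: kl; rewrite [(m + a)%N]addnC eqn_add2r eqn_pmul2r // => /eqP.
exists (x^-1 *: N); rewrite -scalemxAl.
have pk0 := piX_neq0 R k.
have e3 : x *: B = N *m A.
  apply/matrixP => i j; have /matrixP/(_ i j) := e1.
  by rewrite kl -scalerA mxE [in RHS]mxE => /(mulfI pk0).
by rewrite -e3 scalerA mulVr // scale1r.
Qed.

Lemma red_lift m n (M : 'M['F_p]_(m, n)) : exists N : 'M[R]_(m, n), map_mx red N = M.
Proof.
exists (map_mx (fun x : 'F_p => (val x)%:R) M); apply/matrixP => i j.
by rewrite !mxE rmorph_nat natr_Zp.
Qed.

Lemma red_col0 (N : 'M[R]_3) : (forall i, red (N i o0) = 0) -> exists M, N = M *m diag3 pi 1 1.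
Proof.
move=> N0; have [f fP] : exists f : 'I_3 -> R, forall i, N i o0 = pi * f i.
  have [y0 e0] := (redP _).1 (N0 o0); have [y1 e1] := (redP _).1 (N0 o1).
  have [y2 e2] := (redP _).1 (N0 o2).
  by exists (fun i => nth y0 [:: y0; y1; y2] i); apply: all3.
exists (\matrix_(i, j) if j == o0 then f i else N i j).
by apply: matrix3P => i; rewrite diag3_col !mxE /= ?fP ?mul1r.
Qed.

(** For k in GL_3(R), these are the sublattices of index p in R^3. *)
Definition Ln (k : 'M[R]_3) : 'M[R]_3 := diag3 pi 1 1 *m k.

Lemma dv_Ln k : k \in unitmx -> dv 1 (Ln k).
Proof.
move=> uk; apply: (@dv_mul 1 0); last exact/dv0.
by exists 1; rewrite ?unitr1 // det_diag3 !mulr1.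
Qed.

(** Every proper sublattice lies in one of index p: in a basis that starts with a vector of the kernel
modulo p, the first coordinate of every element is divisible by p. *)
Lemma sing_factor (N : 'M[R]_3) : red (\det N) = 0 ->
  exists M k, k \in unitmx /\ N = M *m Ln k.
Proof.
move=> dN; have /eqP/det0P [v v0 vN] : \det (map_mx red N)^T = 0.
  by rewrite det_tr det_map_mx.
have [c cv] := red_lift v.
have pc : prim c.
  have [i vi] : exists i, v ord0 i != 0.
    apply: contrapT => H; case/eqP: v0; apply/rowP => i; rewrite mxE.
    by apply: contrapT => /eqP vi; apply: H; exists i.
  by exists i; rewrite dvr_unit; move: vi; rewrite -cv mxE.
have uE := ext_unit pc; set k := (ext c)^T.
have uk : k \in unitmx by rewrite unitmx_tr.
have [M eM] : exists M, N *m k = M *m diag3 pi 1 1.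
  apply: red_col0 => i.
  have -> : (N *m k) i o0 = (c *m N^T) ord0 i.
    rewrite -(row_ext c) -row_mul [RHS]mxE -[in RHS](trmxK (ext c)) -trmx_mul.
    by rewrite [RHS]mxE.
  by have /rowP/(_ i) := vN; rewrite -cv map_trmx -map_mxM !mxE.
exists M, (invmx k); split; first by rewrite unitmx_inv.
by rewrite /Ln mulmxA -eM mulmxK.
Qed.

(** Relative index p^m is therefore determined by chains of relative index p. *)
Lemma Q_split m A C : A \in unitmx -> Q m.+1 A C ->
  exists B, [/\ B \in unitmx, Q 1 A B & Q m B C].
Proof.
move=> uA [c [N [c0 vN e]]].
have [|M [k [uk NE]]] := @sing_factor N.
  by case: vN => u uu ->; rewrite rmorphM rmorphXn /= red_pi exprS !mul0r.
set E := Ln k in NE; have vE : dv 1 E := dv_Ln uk.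
exists (io E *m A); split.
- by rewrite unitmx_mul uA (dv_io vE).
- exact: Q_io.
- exists c, M; split=> //; last by rewrite mulmxA -map_mxM -NE.
  by apply: dv_sub vE; rewrite addn1 -NE.
Qed.

End Lattices.

(** * Sublattices of a free module of rank three *)

Section Sub.
Variables (p : nat) (R : dvr p).
Local Notation pi := (p%:R : R).
Local Notation red := (@dvr_red p R).
Local Notation fr := (@dvr_frac p R).
Local Notation io := (map_mx fr).

(** The rows of A lie in the lattice of N. *)
Definition sub m (A : 'M[R]_(m, 3)) (N : 'M[R]_3) := exists M, A = M *m N.

Lemma sub_trans m (A : 'M[R]_(m, 3)) B C : sub A B -> sub B C -> sub A C.
Proof. by move=> [M ->] [N ->]; exists (M *m N); rewrite mulmxA. Qed.

Lemma sub_self N : sub N N. Proof. by exists 1%:M; rewrite mul1mx. Qed.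

Lemma sub_add m (A B : 'M[R]_(m, 3)) N : sub A N -> sub B N -> sub (A + B) N.
Proof. by move=> [a ->] [b ->]; exists (a + b); rewrite mulmxDl. Qed.

Lemma sub_scale m c (A : 'M[R]_(m, 3)) N : sub A N -> sub (c *: A) N.
Proof. by move=> [a ->]; exists (c *: a); rewrite scalemxAl. Qed.

Lemma sub_mul m k (B : 'M[R]_(k, m)) (A : 'M[R]_(m, 3)) N : sub A N -> sub (B *m A) N.
Proof. by move=> [a ->]; exists (B *m a); rewrite mulmxA. Qed.

Lemma sub_row i (A : 'M[R]_3) N : sub A N -> sub (row i A) N.
Proof. by rewrite rowE; exact: sub_mul. Qed.

Lemma sub_rows (A N : 'M[R]_3) : (forall i, sub (row i A) N) -> sub A N.
Proof.
move=> H; have [a0 e0] := H o0; have [a1 e1] := H o1; have [a2 e2] := H o2.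
exists (rows3 a0 a1 a2); apply: row3P; rewrite row_mul.
- by rewrite row_rows0.
- by rewrite row_rows1.
- by rewrite row_rows2.
Qed.

Lemma sub_row3 (u v w : 'rV[R]_3) N : sub u N -> sub v N -> sub w N -> sub (rows3 u v w) N.
Proof.
move=> uN vN wN; apply: sub_rows.
apply: (@all3 (fun i => sub (row i (rows3 u v w)) N)).
- by rewrite row_rows0.
- by rewrite row_rows1.
- by rewrite row_rows2.
Qed.

Lemma sub_dv m k A N : sub A N -> dv m A -> dv k N -> exists2 d, m = (d + k)%N &
  exists2 M, dv d M & A = M *m N.
Proof.
move=> [M e] vA vN; have := dv_neq0 vA; rewrite e det_mulmx mulf_eq0 negb_or => /andP[M0 _].
have [d vM] := det0_dv M0; exists d; last by exists M.
by apply: dv_inj vA _; rewrite e; exact: dv_mul.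
Qed.

Lemma sub_eq m A N : sub A N -> dv m A -> dv m N -> exists2 M, M \in unitmx & A = M *m N.
Proof.
move=> AN vA vN; have [d md [M vM e]] := sub_dv AN vA vN; exists M => //.
have d0 : d = 0%N by apply/eqP; rewrite -(eqn_add2r m) -md.
by apply/dv0; rewrite -d0.
Qed.

Lemma sub_eqQ m A N : sub A N -> dv m A -> dv m N -> Q 0 (io A) (io N).
Proof.
move=> AN vA vN; have [M uM ->] := sub_eq AN vA vN; rewrite map_mxM.
by apply: Q_sym; apply: Q_io; apply/dv0.
Qed.

Lemma sub_eqC m A N : sub A N -> dv m A -> dv m N -> sub N A.
Proof.
move=> AN vA vN; have [M uM ->] := sub_eq AN vA vN.
by exists (invmx M); rewrite mulmxA mulVmx // mul1mx.
Qed.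

Lemma pX_sub m n k (A : 'M[R]_(k, 3)) N : dv m N -> (m <= n)%N -> sub (pi ^+ n *: A) N.
Proof.
move=> [u uu Nu] mn; exists ((pi ^+ (n - m) / u) *: (A *m \adj N)).
rewrite -scalemxAl -mulmxA mul_adj_mx Nu mul_mx_scalar scalerA; congr (_ *: _).
transitivity (pi ^+ (n - m) * pi ^+ m * (u / u)); last by ring.
by rewrite divrr // mulr1 -exprD subnK.
Qed.

Lemma not_sub1 m E : dv m.+1 E -> ~ sub 1%:M E.
Proof.
move=> vE E1; have [d e _] := sub_dv E1 ((dv0 _).2 (unitmx1 _ _)) vE.
by rewrite addnS in e.
Qed.

Lemma prim_row (A : 'M[R]_3) i : A \in unitmx -> prim (row i A).
Proof.
move=> uA; apply: contrapT => H; move: uA; rewrite unitmxE.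
rewrite (expand_det_row _ i) dvr_unit rmorph_sum big1 ?eqxx // => j _.
rewrite rmorphM (_ : red (A i j) = 0) ?mul0r //; apply/eqP.
by apply: contrapT => /negP Aij; apply: H; exists j; rewrite dvr_unit mxE.
Qed.

Lemma nprim (v : 'rV[R]_3) : ~ prim v -> forall i, red (v ord0 i) = 0.
Proof.
move=> H i; apply/eqP; apply: contrapT => /negP vi; apply: H.
by exists i; rewrite dvr_unit.
Qed.

Lemma prim_e i : prim (e_ R i).
Proof. by exists i; rewrite mxE !eqxx unitr1. Qed.

Lemma sub_pP (N : 'M[R]_3) : (forall i, ~ prim (row i N)) -> sub N pi%:M.
Proof.
move=> H.
have /choice [f fP] : forall ij : 'I_3 * 'I_3, exists y, N ij.1 ij.2 = pi * y.
  by move=> [i j]; apply/redP; have := nprim (H i) j; rewrite mxE.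
exists (\matrix_(i, j) f (i, j)); apply/matrixP => i j.
by rewrite mul_mx_scalar !mxE (fP (i, j)).
Qed.

(** The lattice R v + p^n R^3. For v primitive these are the points of the projective plane over R/p^n. *)
Definition Pt n (v : 'rV[R]_3) : 'M[R]_3 := diag3 1 (pi ^+ n) (pi ^+ n) *m ext v.

Lemma dv_Pt n v : prim v -> dv (n + n) (Pt n v).
Proof.
move=> pv; rewrite -[(n + n)%N]addn0; apply: dv_mul; last by apply/dv0; exact: ext_unit.
exact: (dv_diag _ 0).
Qed.

Lemma diag3_sub (a b c d : R) (M : 'M[R]_3) :
  (exists a', d = a' * a) -> (exists b', d = b' * b) -> (exists c', d = c' * c) ->
  forall k (w : 'M[R]_(k, 3)), M \in unitmx -> sub (d *: w) (diag3 a b c *m M).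
Proof.
move=> [a' ea] [b' eb] [c' ec] k w uM.
exists (w *m invmx M *m diag3 a' b' c'); rewrite !mulmxA -[_ *m _ *m diag3 a b c]mulmxA.
have -> : diag3 a' b' c' *m diag3 a b c = d%:M.
  apply/matrixP => i j; rewrite diag3_row !mxE; move: i j.
  apply: (@all3 _); apply: (@all3 _); by rewrite /= ?mulr0 // -?ea -?eb -?ec.
by rewrite mul_mx_scalar -scalemxAl mulmxKV.
Qed.

Lemma Pt_v n v : sub v (Pt n v).
Proof.
exists (e_ R o0); rewrite /Pt mulmxA -rowE -[LHS](row_ext v).
apply/rowP => j; rewrite !vmul3 !mxE /=.
by rewrite ?(mul0r, addr0, mul1r).
Qed.

Lemma Pt_pn n v k (w : 'M[R]_(k, 3)) : prim v -> sub (pi ^+ n *: w) (Pt n v).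
Proof.
move=> pv; apply: diag3_sub; last exact: ext_unit.
- by exists (pi ^+ n); rewrite mulr1.
- by exists 1; rewrite mul1r.
- by exists 1; rewrite mul1r.
Qed.

Lemma Pt_sub n v N : sub v N -> sub (pi ^+ n)%:M N -> sub (Pt n v) N.
Proof.
move=> vN pN; have pw k (w : 'M[R]_(k, 3)) : sub (pi ^+ n *: w) N.
  by rewrite -mul_mx_scalar; exact: sub_mul.
apply: sub_rows; apply: (@all3 (fun i => sub (row i (Pt n v)) N)).
- rewrite (_ : row _ _ = v) // -[RHS](row_ext v); apply/rowP => j.
  by rewrite mxE diag3_row mul1r mxE.
- rewrite (_ : row _ _ = pi ^+ n *: row o1 (ext v)) //; apply/rowP => j.
  by rewrite mxE diag3_row !mxE.
- rewrite (_ : row _ _ = pi ^+ n *: row o2 (ext v)) //; apply/rowP => j.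
  by rewrite mxE diag3_row !mxE.
Qed.

Lemma sub_Pt n v w : prim v -> sub w (Pt n v) -> exists a y, w = a *: v + pi ^+ n *: y.
Proof.
move=> pv [b ->]; exists (b ord0 o0), (b ord0 o1 *: row o1 (ext v) + b ord0 o2 *: row o2 (ext v)).
rewrite -{2}(row_ext v); apply/rowP => j; rewrite /Pt mulmxA !vmul3 !mxE /=.
by ring.
Qed.

Lemma Pt_eq n v w : prim v -> prim w -> sub w (Pt n v) -> Q 0 (io (Pt n w)) (io (Pt n v)).
Proof.
move=> pv pw wv; apply: (sub_eqQ (m := (n + n)%N)); try exact: dv_Pt.
by apply: Pt_sub wv _; rewrite -(mulr1 (pi ^+ n)) -scale_scalar_mx; exact: Pt_pn.
Qed.

Lemma Pt_scale n c v y : prim v -> c \is a GRing.unit -> prim (c *: v + pi ^+ n *: y) ->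
  Q 0 (io (Pt n (c *: v + pi ^+ n *: y))) (io (Pt n v)).
Proof.
move=> pv uc pw; apply: Pt_eq => //; apply: sub_add; last exact: Pt_pn.
by apply: sub_scale; exact: Pt_v.
Qed.

(** Index and inclusions single out the points among all lattices, so that any map which preserves
these two notions permutes the points. *)
Lemma Pt_char n N : dv (n + n) N -> sub (pi ^+ n)%:M N -> ~ sub N pi%:M ->
  exists2 v, prim v & Q 0 (io (Pt n v)) (io N).
Proof.
move=> vN pN nN; have [i pi_] : exists i, prim (row i N).
  by apply: contrapT => H; apply: nN; apply: sub_pP => i pi_; apply: H; exists i.
exists (row i N) => //; apply: (sub_eqQ (m := (n + n)%N)) => //; last exact: dv_Pt.
by apply: Pt_sub => //; apply: sub_row; exact: sub_self.
Qed.

Lemma prim_mul v (h : 'M[R]_3) : prim v -> h \in unitmx -> prim (v *m h).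
Proof.
move=> pv uh; rewrite -[X in X *m _](row_ext v) -row_mul; apply: prim_row.
by rewrite unitmx_mul uh ext_unit.
Qed.

Lemma Pt_mul n v (h : 'M[R]_3) : prim v -> h \in unitmx ->
  Q 0 (io (Pt n v) *m io h) (io (Pt n (v *m h))).
Proof.
move=> pv uh; rewrite -map_mxM; apply: Q_sym; apply: (sub_eqQ (m := (n + n)%N)).
- apply: Pt_sub; first by have [a e] := Pt_v n v; exists a; rewrite {1}e mulmxA.
  have [a e] := Pt_pn n (invmx h) pv; exists a; rewrite mulmxA -e -scalemxAl mulVmx //.
  by rewrite scalemx1.
- exact: dv_Pt (prim_mul _ _).
- by rewrite -[(n + n)%N]addn0; apply: dv_mul (dv_Pt _ _) _ => //; apply/dv0.
Qed.
End Sub.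

(** * Automorphisms that fix a vertex are linear on balls *)

Section Qmap.
Variables (p : nat) (R : dvr p).
Local Notation K := (dvr_field R).
Local Notation pi := (p%:R : R).
Local Notation fr := (@dvr_frac p R).
Local Notation io := (map_mx fr).

(** A permutation of the homothety classes that preserves relative index; it need not be induced by
a linear map. *)
Definition qmap (F : 'M[K]_3 -> 'M[K]_3) : Prop :=
  [/\ forall B, B \in unitmx -> F B \in unitmx,
      forall m B B', B \in unitmx -> B' \in unitmx -> Q m B B' <-> Q m (F B) (F B') &
      forall B', B' \in unitmx -> exists2 B, B \in unitmx & Q 0 (F B) B'].

Lemma qmap_mul F g h : qmap F -> g \in unitmx -> h \in unitmx -> qmap (fun B => F (B *m g) *m h).
Proof.
move=> [F1 F2 F3] ug uh; split=> [B uB|m B B' uB uB'|B' uB'].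
- by rewrite unitmx_mul uh andbT F1 // unitmx_mul uB.
- by rewrite Q_mulrE // -F2 ?unitmx_mul ?uB ?uB' // Q_mulrE.
- have [|B uB q] := F3 (B' *m invmx h); first by rewrite unitmx_mul unitmx_inv uB'.
  exists (B *m invmx g); first by rewrite unitmx_mul unitmx_inv uB.
  by rewrite mulmxKV // -[B'](mulmxKV uh); exact: Q_mulr.
Qed.

Lemma pi_dv n : dv (n * 3) ((pi ^+ n)%:M : 'M[R]_3).
Proof. by exists 1; rewrite ?unitr1 // det_scalar mulr1 exprM. Qed.

Lemma Q_io1 (h : 'M[R]_3) B : h \in unitmx -> Q 0 B (io h *m B).
Proof. by move=> uh; apply: Q_io; apply/dv0. Qed.

Section Fix1.
Variable F : 'M[K]_3 -> 'M[K]_3.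
Hypothesis qF : qmap F.
Hypothesis F1 : Q 0 1%:M (F 1%:M).

(** F sends the class of N to the class of N'. Among the representatives of the image, N' is normalised
by its index, which makes inclusions between images meaningful. *)
Definition img m N N' := [/\ dv m N, dv m N' & Q 0 (F (io N)) (io N')].

Lemma F_to m B B' : B \in unitmx -> B' \in unitmx -> Q m B B' -> Q m (F B) (F B').
Proof. by move=> uB uB'; case: qF => _ H _; case: (H m B B' uB uB'). Qed.
Lemma F_from m B B' : B \in unitmx -> B' \in unitmx -> Q m (F B) (F B') -> Q m B B'.
Proof. by move=> uB uB'; case: qF => _ H _; case: (H m B B' uB uB'). Qed.
Let F_unit B : B \in unitmx -> F B \in unitmx.
Proof. by case: qF => H _ _; exact: H. Qed.

Lemma Q1_int m B : Q m 1%:M B -> exists2 N, dv m N & Q 0 B (io N).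
Proof.
move=> [c [N [c0 vN e]]]; exists N => //; rewrite mulmx1 in e; rewrite -e.
exact: Q_scale.
Qed.

Lemma img_exists m N : dv m N -> exists N', img m N N'.
Proof.
move=> vN; have uN := dv_io vN.
have : Q m (F 1%:M) (F (io N)).
  apply: F_to; rewrite ?unitmx1 //.
  by have := Q_io 1%:M vN; rewrite mulmx1.
by move/(Q0_l _ _ F1) => /Q1_int [N' vN' e]; exists N'.
Qed.

Lemma img_surj m N' : dv m N' -> exists N, img m N N'.
Proof.
move=> vN'; have [_ _ H] := qF; have [B uB e] := H _ (dv_io vN').
have : Q m 1%:M B.
  apply: F_from; rewrite ?unitmx1 //; apply/(Q0_l _ _ F1); apply/(Q0_r _ _ e).
  by have := Q_io 1%:M vN'; rewrite mulmx1.
move=> /Q1_int [N vN eB]; exists N; split=> //; apply: (@Q0_trans _ _ _ (F B)) => //.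
by apply: F_to => //; [exact: dv_io vN | exact: Q_sym].
Qed.

Lemma img_eq m N N' N'' : img m N N' -> Q 0 (io N') (io N'') -> dv m N'' -> img m N N''.
Proof. by move=> [vN vN' q] q' vN''; split=> //; apply/(Q0_r _ _ q'). Qed.

Lemma img_sub m1 m2 N1 N1' N2 N2' : img m1 N1 N1' -> img m2 N2 N2' ->
  sub N2 N1 <-> sub N2' N1'.
Proof.
move=> [v1 v1' q1] [v2 v2' q2]; split.
- move=> s; have [d m2E [M vM e]] := sub_dv s v2 v1.
  rewrite m2E addnC in v2'; apply: (Q_exact v1' v2').
  apply/(Q0_r _ _ q2); apply/(Q0_l _ _ q1); apply: F_to; rewrite ?(dv_io v1) ?(dv_io v2) //.
  by rewrite e map_mxM; exact: Q_io.
- move=> s; have [d m2E [M vM e]] := sub_dv s v2' v1'.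
  rewrite m2E addnC in v2; apply: (Q_exact v1 v2).
  apply: F_from; rewrite ?(dv_io v1) ?(dv_io v2) //; apply/(Q0_r _ _ q2); apply/(Q0_l _ _ q1).
  by rewrite e map_mxM; exact: Q_io.
Qed.

Lemma img_pX n : img (n * 3) (pi ^+ n)%:M (pi ^+ n)%:M.
Proof.
split; try exact: pi_dv.
have e : Q 0 1%:M (io (pi ^+ n)%:M).
  rewrite map_scalar_mx -[X in Q _ _ X]scalemx1; apply: Q_scale.
  by rewrite fr_eq0 piX_neq0.
have H : Q 0 (F (io (pi ^+ n)%:M)) (F 1%:M).
  by apply: F_to; rewrite ?unitmx1 ?(dv_io (pi_dv n)) //; exact: Q_sym.
by apply: Q0_trans H _; apply: Q0_trans (Q_sym F1) e.
Qed.

Lemma img_prim m N N' : img m N N' -> ~ sub N pi%:M -> ~ sub N' pi%:M.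
Proof. by move=> iN; rewrite (img_sub (img_pX 1) iN) expr1. Qed.

Lemma img_pn m n N N' : img m N N' -> sub (pi ^+ n)%:M N -> sub (pi ^+ n)%:M N'.
Proof. by move=> iN; rewrite (img_sub iN (img_pX n)). Qed.

Definition imgp n v v' := img (n + n) (Pt n v) (Pt n v').

Lemma Pt_pn1 n v : prim v -> sub (pi ^+ n)%:M (Pt n v).
Proof. by move=> pv; rewrite -scalemx1; exact: Pt_pn. Qed.

Lemma prim_sub_p (v : 'rV[R]_3) N : prim v -> sub v N -> ~ sub N pi%:M.
Proof.
move=> [i ui] vN /(sub_trans vN) [a e]; move: ui.
by rewrite e mul_mx_scalar mxE dvr_unit rmorphM /= red_pi mul0r eqxx.
Qed.

Lemma imgp_exists n v : prim v -> exists2 v', prim v' & imgp n v v'.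
Proof.
move=> pv; have [N' iN] := img_exists (dv_Pt n pv); have [_ vN' _] := iN.
have [||v' pv' q] := Pt_char vN'.
- by apply: img_pn iN _; exact: Pt_pn1.
- by apply: img_prim iN _; apply: prim_sub_p pv _; exact: Pt_v.
by exists v' => //; apply: (img_eq iN); [exact: Q_sym | exact: dv_Pt].
Qed.

(** Three points are independent modulo p when no lattice of index p contains all of them, and this
property is preserved. *)
Lemma imgp_indep n u0 u1 u2 v0 v1 v2 : (0 < n)%N ->
  prim u0 -> prim u1 -> prim u2 -> prim v0 -> prim v1 -> prim v2 ->
  imgp n u0 v0 -> imgp n u1 v1 -> imgp n u2 v2 ->
  rows3 u0 u1 u2 \in unitmx -> rows3 v0 v1 v2 \in unitmx.
Proof.
move=> n0 pu0 pu1 pu2 pv0 pv1 pv2 i0 i1 i2 uU; rewrite unitmxE dvr_unit; apply/negP => /eqP dV.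
have [M [k [uk eV]]] := sing_factor dV; set E := Ln k in eV; have vE : dv 1 E := dv_Ln uk.
have [E0 iE] := img_surj vE; have [vE0 _ _] := iE.
have VE : sub (rows3 v0 v1 v2) E by exists M.
have pE : sub (pi ^+ n)%:M E by rewrite -scalemx1; apply: pX_sub vE _.
have H u v : prim u -> imgp n u v -> sub v E -> sub u E0.
  move=> pu iu vE'; apply: sub_trans (Pt_v n u) _.
  by rewrite (img_sub iE iu); exact: Pt_sub.
apply: (not_sub1 vE0); apply: (@sub_trans _ _ _ _ (rows3 u0 u1 u2)).
  by exists (invmx (rows3 u0 u1 u2)); rewrite mulVmx.
apply: sub_row3; [apply: H i0 _ | apply: H i1 _ | apply: H i2 _] => //.
- by rewrite -(row_rows0 v0 v1 v2); exact: sub_row.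
- by rewrite -(row_rows1 v0 v1 v2); exact: sub_row.
- by rewrite -(row_rows2 v0 v1 v2); exact: sub_row.
Qed.

Definition fixp n v := prim v /\ imgp n v v.

Lemma fixp_scale n c v y : fixp n v -> c \is a GRing.unit -> prim (c *: v + pi ^+ n *: y) ->
  fixp n (c *: v + pi ^+ n *: y).
Proof.
move=> [pv [_ _ q]] uc pw; split=> //; split; try exact: dv_Pt.
have e := Pt_scale pv uc pw.
apply: Q0_trans _ (Q0_trans q (Q_sym e)).
by apply: F_to; rewrite ?(dv_io (dv_Pt _ _)).
Qed.

Lemma line_dv n (M : 'M[R]_3) : M \in unitmx -> dv n (diag3 1 1 (pi ^+ n) *m M).
Proof.
move=> uM; rewrite -[n in dv n _]addn0; apply: dv_mul; last exact/dv0.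
exact: (dv_diag _ 0 0).
Qed.

Lemma line_pn n (M : 'M[R]_3) k (w : 'M[R]_(k, 3)) : M \in unitmx ->
  sub (pi ^+ n *: w) (diag3 1 1 (pi ^+ n) *m M).
Proof.
move=> uM; apply: diag3_sub => //.
- by exists (pi ^+ n); rewrite mulr1.
- by exists (pi ^+ n); rewrite mulr1.
- by exists 1; rewrite mul1r.
Qed.

Lemma line_row n (u v w : 'rV[R]_3) :
  sub u (diag3 1 1 (pi ^+ n) *m rows3 u v w) /\ sub v (diag3 1 1 (pi ^+ n) *m rows3 u v w).
Proof.
split; [exists (e_ R o0) | exists (e_ R o1)]; rewrite mulmxA -rowE; apply/rowP => j;
  by rewrite !vmul3 !mxE /= ?(mul0r, addr0, add0r, mul1r).
Qed.

(** The line through two fixed points is fixed, since its image contains both points and has the same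
index; hence it contains the image of each of its points. *)
Lemma line_fix n u w x y beta : fixp n u -> fixp n y -> u = w - beta *: y ->
  rows3 w y x \in unitmx ->
  forall w', prim w -> imgp n w w' -> sub w' (diag3 1 1 (pi ^+ n) *m rows3 w y x).
Proof.
move=> [pu iu] [py iy] eu uM w' pw iw; set L := _ *m _.
have vL : dv n L := line_dv n uM.
have [L' iL] := img_exists vL; have [_ vL' _] := iL.
have [wL yL] := line_row n w y x; rewrite -/L in wL yL.
have pL : sub (pi ^+ n)%:M L by rewrite -scalemx1; exact: line_pn.
have uL : sub u L by rewrite eu -scaleNr; apply: sub_add => //; exact: sub_scale.
have pL' := img_pn iL pL.
have yL' : sub y L' by apply: sub_trans (Pt_v n y) _; rewrite -(img_sub iL iy); exact: Pt_sub.
have uL' : sub u L' by apply: sub_trans (Pt_v n u) _; rewrite -(img_sub iL iu); exact: Pt_sub.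
have wL' : sub w L'.
  have -> : w = u + beta *: y by rewrite eu subrK.
  by apply: sub_add => //; exact: sub_scale.
have LL' : sub L L'.
  have pw' k (z : 'M[R]_(k, 3)) : sub (pi ^+ n *: z) L'.
    by rewrite -mul_mx_scalar; exact: sub_mul.
  apply: sub_rows; apply: (@all3 (fun i => sub (row i L) L')).
  - by rewrite (_ : row _ _ = w) //; apply/rowP => j; rewrite mxE diag3_row mul1r !mxE.
  - by rewrite (_ : row _ _ = y) //; apply/rowP => j; rewrite mxE diag3_row mul1r !mxE.
  - by rewrite (_ : row _ _ = pi ^+ n *: x) //; apply/rowP => j; rewrite mxE diag3_row !mxE.
apply: sub_trans (sub_eqC LL' vL vL'); apply: sub_trans (Pt_v n w') _.
by rewrite -(img_sub iL iw); exact: Pt_sub.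
Qed.

(** The point w lies on two lines that join fixed points, and these lines meet only in w modulo p^n. *)
Lemma fixp_meet n u1 y1 u2 y2 w b1 b2 : fixp n u1 -> fixp n y1 -> fixp n u2 -> fixp n y2 ->
  u1 = w - b1 *: y1 -> u2 = w - b2 *: y2 -> rows3 w y1 y2 \in unitmx -> fixp n w.
Proof.
move=> fu1 fy1 fu2 fy2 e1 e2 uM; have pw : prim w by rewrite -(row_rows0 w y1 y2); exact: prim_row.
have uM' : rows3 w y2 y1 \in unitmx.
  move: uM; rewrite !unitmxE (_ : \det (rows3 w y2 y1) = - \det (rows3 w y1 y2)) ?unitrN //.
  by rewrite !det3 !mxE /=; ring.
have [w' pw' iw] := imgp_exists n pw; split=> //.
have [a ea] := line_fix fu1 fy1 e1 uM pw iw.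
have [b eb] := line_fix fu2 fy2 e2 uM' pw iw.
have ew (d : 'rV[R]_3) x y z : d *m (diag3 1 1 (pi ^+ n) *m rows3 x y z) =
    d ord0 o0 *: x + d ord0 o1 *: y + (pi ^+ n * d ord0 o2) *: z.
  by apply/rowP => j; rewrite mulmxA !vmul3 !mxE /=; ring.
have e : (\row_j nth 0 [:: a ord0 o0; a ord0 o1; pi ^+ n * a ord0 o2] j : 'rV[R]_3) =
         \row_j nth 0 [:: b ord0 o0; pi ^+ n * b ord0 o2; b ord0 o1] j.
  apply: (can_inj (mulmxK uM)); transitivity w'.
    by rewrite ea ew; apply/rowP => j; rewrite vmul3 !mxE.
  by rewrite eb ew; apply/rowP => j; rewrite vmul3 !mxE /= addrAC.
have /rowP/(_ o1) := e; rewrite !mxE /= => ea1.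
have eww : w' = a ord0 o0 *: w + pi ^+ n *: (b ord0 o2 *: y1 + a ord0 o2 *: y2).
  by rewrite ea ew ea1 scalerDr !scalerA addrA.
apply: (img_eq iw); last exact: dv_Pt.
apply: Pt_eq => //; rewrite eww; apply: sub_add; last exact: Pt_pn.
by apply: sub_scale; exact: Pt_v.
Qed.

Lemma row3_prim (u v w : 'rV[R]_3) : rows3 u v w \in unitmx -> prim u.
Proof. by move=> uM; rewrite -(row_rows0 u v w); exact: prim_row. Qed.

Lemma det_rows3_swap (u v w : 'rV[R]_3) : \det (rows3 u w v) = - \det (rows3 u v w).
Proof. by rewrite !det3 !mxE /=; ring. Qed.

Lemma unitmx_detN (M N : 'M[R]_3) : \det M = - \det N -> N \in unitmx -> M \in unitmx.
Proof. by move=> e; rewrite !unitmxE e unitrN. Qed.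
Lemma unitmx_det (M N : 'M[R]_3) : \det M = \det N -> N \in unitmx -> M \in unitmx.
Proof. by move=> e; rewrite !unitmxE e. Qed.

Section Frame.
Variables (n : nat) (f0 f1 f2 : 'rV[R]_3).
Hypotheses (uf : rows3 f0 f1 f2 \in unitmx) (h0 : fixp n f0) (h1 : fixp n f1)
  (h2 : fixp n f2) (hs : fixp n (f0 + f1 + f2)).

Lemma fixp_sum12 : fixp n (f1 + f2).
Proof.
apply: (fixp_meet h1 h2 hs h0 (b1 := 1) (b2 := -1)).
- by rewrite scale1r addrK.
- by rewrite scaleN1r opprK [RHS]addrC addrA.
apply: unitmx_det uf; by rewrite !det3 !mxE /=; ring.
Qed.

Lemma fixp_sum02 : fixp n (f0 + f2).
Proof.
apply: (fixp_meet h0 h2 hs h1 (b1 := 1) (b2 := -1)).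
- by rewrite scale1r addrK.
- by rewrite scaleN1r opprK [RHS]addrAC.
apply: unitmx_detN uf; by rewrite !det3 !mxE /=; ring.
Qed.

(** Von Staudt's addition of 1 on the line through f0 and f1: the line through f0 + k f1 and f1 + f2 meets
the line through f0 + f2 and f1 in f0 + (k + 1) f1 + f2, which is then projected from f2. *)
Lemma fixp_nat k : fixp n (f0 + k%:R *: f1).
Proof.
elim: k => [|k IHk]; first by rewrite scale0r addr0.
have hq : fixp n (f0 + k.+1%:R *: f1 + f2).
  apply: (fixp_meet IHk fixp_sum12 fixp_sum02 h1 (b1 := 1) (b2 := k.+1%:R)).
  - by rewrite -natr1; apply/rowP => j; rewrite !mxE; ring.
  - by rewrite [f0 + _ + f2]addrAC addrK.
  apply: unitmx_detN uf; by rewrite !det3 !mxE /=; ring.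
apply: (fixp_meet hq h2 h0 h1 (b1 := -1) (b2 := k.+1%:R)).
- by rewrite scaleN1r opprK.
- by rewrite addrK.
apply: unitmx_detN uf; by rewrite !det3 !mxE /=; ring.
Qed.

(** The natural numbers exhaust R modulo p^n. This is why no ring automorphism enters, as it would in
the fundamental theorem of projective geometry over a general ring. *)
Lemma fixp_axis a : fixp n (f0 + a *: f1).
Proof.
have [k [y ->]] := dvr_nat_approx a n.
have e : f0 + (k%:R + pi ^+ n * y) *: f1 = 1 *: (f0 + k%:R *: f1) + pi ^+ n *: (y *: f1).
  by rewrite scale1r scalerDl scalerA addrA.
rewrite e; apply: fixp_scale; rewrite ?unitr1 //; first exact: fixp_nat.
rewrite -e; apply: (@row3_prim _ f1 f2).
apply: unitmx_det uf; by rewrite !det3 !mxE /=; ring.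
Qed.
End Frame.

Lemma fixp_affine n f0 f1 f2 a b : rows3 f0 f1 f2 \in unitmx -> fixp n f0 -> fixp n f1 ->
  fixp n f2 -> fixp n (f0 + f1 + f2) -> fixp n (f0 + a *: f1 + b *: f2).
Proof.
move=> uf h0 h1 h2 hs.
have uf' : rows3 f0 f2 f1 \in unitmx by rewrite unitmxE det_rows3_swap unitrN -unitmxE.
have hs' : fixp n (f0 + f2 + f1) by rewrite addrAC.
apply: (fixp_meet (fixp_axis uf h0 h1 h2 hs a) h2 (fixp_axis uf' h0 h2 h1 hs' b) h1
  (b1 := b) (b2 := a)).
- by rewrite addrK.
- by rewrite [f0 + _ + b *: f2]addrAC addrK.
apply: unitmx_detN uf; by rewrite !det3 !mxE /=; ring.
Qed.

Lemma fixp_all n : fixp n (e_ R o0) -> fixp n (e_ R o1) -> fixp n (e_ R o2) ->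
  fixp n (e_ R o0 + e_ R o1 + e_ R o2) -> forall v, prim v -> fixp n v.
Proof.
move=> h0 h1 h2 hs v pv.
have P (f0 f1 f2 : 'rV[R]_3) c a b : rows3 f0 f1 f2 \in unitmx -> fixp n f0 -> fixp n f1 ->
    fixp n f2 -> fixp n (f0 + f1 + f2) -> c \is a GRing.unit ->
    v = c *: (f0 + (a / c) *: f1 + (b / c) *: f2) -> fixp n v.
  move=> uf k0 k1 k2 ks uc e.
  have := fixp_scale (y := 0) (fixp_affine (a / c) (b / c) uf k0 k1 k2 ks) uc.
  by rewrite scaler0 addr0 -e => /(_ pv).
have E : v = v ord0 o0 *: e_ R o0 + v ord0 o1 *: e_ R o1 + v ord0 o2 *: e_ R o2.
  apply/rowP; apply: (@all3 _); rewrite !mxE /= ?(mulr0, mulr1, addr0, add0r) //.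
have S (c a b : R) (f0 f1 f2 : 'rV[R]_3) : c \is a GRing.unit ->
    c *: (f0 + (a / c) *: f1 + (b / c) *: f2) = c *: f0 + a *: f1 + b *: f2.
  by move=> uc; rewrite !scalerDr !scalerA ![c * _]mulrC !divrK.
have U (i j k : 'I_3) : \det (rows3 (e_ R i) (e_ R j) (e_ R k)) \is a GRing.unit ->
  rows3 (e_ R i) (e_ R j) (e_ R k) \in unitmx by rewrite unitmxE.
case: (pv) => i; move: i; apply: (@all3 _) => ui.
- apply: (P (e_ R o0) (e_ R o1) (e_ R o2) _ (v ord0 o1) (v ord0 o2) _ h0 h1 h2 hs ui).
    by apply: U; rewrite det3 !mxE /= ?(mulr0, mul0r, mulr1, subr0, addr0) unitr1.
  by rewrite S.
- apply: (P (e_ R o1) (e_ R o0) (e_ R o2) _ (v ord0 o0) (v ord0 o2) _ h1 h0 h2 _ ui).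
  + by apply: U; rewrite det3 !mxE /= ?(mulr0, mul0r, mulr1, subr0, addr0, sub0r) unitrN1.
  + by rewrite [e_ R o1 + _]addrC.
  + by rewrite S // [v ord0 o1 *: _ + _]addrC.
- apply: (P (e_ R o2) (e_ R o0) (e_ R o1) _ (v ord0 o0) (v ord0 o1) _ h2 h0 h1 _ ui).
  + by apply: U; rewrite det3 !mxE /= ?(mulr0, mul0r, mulr1, subr0, addr0, sub0r, add0r, oppr0) ?unitr1.
  + by rewrite -addrA addrC.
  + by rewrite S // {1}E -[RHS]addrA [RHS]addrC.
Qed.

(** A lattice of R^3 that is not contained in p R^3 is spanned by its primitive vectors, and each of
these defines a fixed point. The other lattices are reduced to this case by a homothety. *)
Lemma fix_lattices n : (forall v, prim v -> fixp n v) ->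
  forall m N, dv m N -> sub (pi ^+ n)%:M N -> Q 0 (F (io N)) (io N).
Proof.
move=> H m; elim/ltn_ind: m => m IHm N vN pN.
have [[M eN]|nN] := pselect (sub N pi%:M).
  have vp : dv 3 (pi%:M : 'M[R]_3) by have := pi_dv 1; rewrite expr1.
  have [d md [M' vM' eN']] := sub_dv (ex_intro _ M eN) vN vp.
  have eN2 : N = pi *: M' by rewrite eN' mul_mx_scalar.
  have e : Q 0 (io M') (io N).
    by rewrite eN2 map_mxZ; apply: Q_scale; rewrite fr_eq0 pi_neq0.
  have q : Q 0 (F (io M')) (io M').
    apply: (IHm d) => //; first by rewrite md addn3 ltnS (leq_trans (leqnSn d)).
    case: pN => L ->; exists (pi *: L).
    by rewrite eN2 -scalemxAl scalemxAr.
  apply: Q0_trans _ (Q0_trans q e).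
  by apply: F_to; [exact: dv_io vN | exact: dv_io vM' | exact: Q_sym].
have [i pri] : exists i, prim (row i N).
  by apply: contrapT => K; apply: nN; apply: sub_pP => i pri; apply: K; exists i.
have [N' iN] := img_exists vN; have [_ vN' q] := iN.
have pN' := img_pn iN pN.
have inN' w : prim w -> sub w N -> sub w N'.
  move=> pw wN; apply: sub_trans (Pt_v n w) _; have [_ iw] := H w pw.
  by rewrite -(img_sub iN iw); exact: Pt_sub.
have NN : sub N N by exact: sub_self.
have NN' : sub N N'.
  apply: sub_rows => j; have [pj|npj] := pselect (prim (row j N)).
    by apply: inN' => //; exact: sub_row.
  have [k uk] := pri.
  have ps : prim (row j N + row i N).
    exists k; rewrite dvr_unit mxE rmorphD /= (nprim npj) add0r -dvr_unit //.
  rewrite -[row j N](addrK (row i N)); apply: sub_add.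
    by apply: inN' => //; apply: sub_add; exact: sub_row.
  by rewrite -scaleN1r; apply: sub_scale; apply: inN' => //; exact: sub_row.
by apply: Q0_trans q _; apply: Q_sym; exact: sub_eqQ NN' vN vN'.
Qed.
End Fix1.

(** The fundamental theorem of projective geometry over R/p^n. The image of the standard frame is again
a frame, so that composing F with an element of GL_3(R) makes it fix the standard frame; then it
fixes all points, hence all lattices that contain p^n R^3. *)
Lemma ball_linear F n : qmap F -> Q 0 1%:M (F 1%:M) -> (0 < n)%N ->
  exists2 g : 'M[R]_3, g \in unitmx &
    forall m N, dv m N -> sub (pi ^+ n)%:M N -> Q 0 (F (io N)) (io (N *m g)).
Proof.
move=> qF F1 n0.
have I v : prim v -> exists2 v', prim v' & imgp F n v v' by exact: imgp_exists.
have [v0 p0 i0] := I _ (prim_e R o0); have [v1 p1 i1] := I _ (prim_e R o1).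
have [v2 p2 i2] := I _ (prim_e R o2).
pose s := e_ R o0 + e_ R o1 + e_ R o2.
have ps : prim s by exists o0; rewrite !mxE /= !addr0 unitr1.
have [w pw iw] := I s ps.
pose U := rows3 v0 v1 v2.
have uE (u0 u1 u2 : 'rV[R]_3) : \det (rows3 u0 u1 u2) = 1 -> rows3 u0 u1 u2 \in unitmx.
  by move=> e; rewrite unitmxE e unitr1.
have simp := (mulr0, mul0r, mulr1, mul1r, subr0, addr0, add0r, sub0r, oppr0).
have uU : U \in unitmx.
  apply: (imgp_indep qF F1 n0 (prim_e R o0) (prim_e R o1) (prim_e R o2) p0 p1 p2 i0 i1 i2).
  by apply: uE; rewrite det3 !mxE /= ?simp.
pose c := w *m invmx U.
have ew : w = c *m U by rewrite mulmxKV.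
clearbody c.
have uc0 : c ord0 o0 \is a GRing.unit.
  have := imgp_indep qF F1 n0 ps (prim_e R o1) (prim_e R o2) pw p1 p2 iw i1 i2.
  move=> H; have {H} : rows3 w v1 v2 \in unitmx.
    by apply: H; apply: uE; rewrite det3 !mxE /= ?simp.
  rewrite unitmxE (_ : \det _ = c ord0 o0 * \det U); first by rewrite unitrM => /andP[].
  by rewrite /U !det3 !mxE /= ew !vmul3 /U !mxE /=; ring.
have uc1 : c ord0 o1 \is a GRing.unit.
  have := imgp_indep qF F1 n0 (prim_e R o0) ps (prim_e R o2) p0 pw p2 i0 iw i2.
  move=> H; have {H} : rows3 v0 w v2 \in unitmx.
    by apply: H; apply: uE; rewrite det3 !mxE /= ?simp.
  rewrite unitmxE (_ : \det _ = c ord0 o1 * \det U); first by rewrite unitrM => /andP[].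
  by rewrite /U !det3 !mxE /= ew !vmul3 /U !mxE /=; ring.
have uc2 : c ord0 o2 \is a GRing.unit.
  have := imgp_indep qF F1 n0 (prim_e R o0) (prim_e R o1) ps p0 p1 pw i0 i1 iw.
  move=> H; have {H} : rows3 v0 v1 w \in unitmx.
    by apply: H; apply: uE; rewrite det3 !mxE /= ?simp.
  rewrite unitmxE (_ : \det _ = c ord0 o2 * \det U); first by rewrite unitrM => /andP[].
  by rewrite /U !det3 !mxE /= ew !vmul3 /U !mxE /=; ring.
pose g := diag3 (c ord0 o0) (c ord0 o1) (c ord0 o2) *m U.
have ug : g \in unitmx.
  by rewrite unitmxE det_mulmx det_diag3 !unitrM uc0 uc1 uc2 -unitmxE.
have eg i : e_ R i *m g = c ord0 i *: row i U.
  by rewrite -rowE; apply/rowP => j; rewrite mxE diag3_row !mxE; move: i; apply: (@all3 _).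
have uig : io (invmx g) \in unitmx by apply: (dv_io (m := 0)); apply/dv0; rewrite unitmx_inv.
pose F' B := F (B *m 1%:M) *m io (invmx g).
have qF' : qmap F' by apply: qmap_mul; rewrite ?unitmx1.
have F'1 : Q 0 1%:M (F' 1%:M).
  have q1 : Q 0 1%:M (io (invmx g)).
    by rewrite -[io (invmx g)]mulmx1; apply: Q_io1; rewrite unitmx_inv.
  rewrite /F' mulmx1; apply: Q0_trans q1 _.
  by have := Q_mulr (io (invmx g)) F1; rewrite mul1mx.
have uig' : invmx g \in unitmx by rewrite unitmx_inv.
have fixF' u v z : prim u -> prim v -> prim z -> imgp F n u v -> v *m invmx g = z ->
    Q 0 (io (Pt n z)) (io (Pt n u)) -> fixp F' n u.
  move=> pu pv pz [_ _ q] ez qz; split=> //; split; try exact: dv_Pt.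
  rewrite /F' mulmx1; apply: Q0_trans (Q_mulr _ q) _.
  by apply: Q0_trans (Pt_mul n pv uig') _; rewrite ez.
have vg i : c ord0 i \is a GRing.unit -> row i U *m invmx g = (c ord0 i)^-1 *: e_ R i.
  move=> uc; apply: (can_inj (mulmxK ug)).
  by rewrite mulmxKV // -scalemxAl eg scalerA mulVr // scale1r.
have pe i : c ord0 i \is a GRing.unit -> prim ((c ord0 i)^-1 *: e_ R i).
  by move=> uc; exists i; rewrite !mxE !eqxx mulr1 unitrV.
have qe i : c ord0 i \is a GRing.unit ->
    Q 0 (io (Pt n ((c ord0 i)^-1 *: e_ R i))) (io (Pt n (e_ R i))).
  move=> uc; apply: Pt_eq (prim_e R i) (pe i uc) _.
  by apply: sub_scale; exact: Pt_v.
have f0 : fixp F' n (e_ R o0).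
  apply: (fixF' _ _ _ (prim_e R o0) p0 (pe _ uc0) i0) (qe _ uc0).
  by rewrite -(vg _ uc0) row_rows0.
have f1 : fixp F' n (e_ R o1).
  apply: (fixF' _ _ _ (prim_e R o1) p1 (pe _ uc1) i1) (qe _ uc1).
  by rewrite -(vg _ uc1) row_rows1.
have f2 : fixp F' n (e_ R o2).
  apply: (fixF' _ _ _ (prim_e R o2) p2 (pe _ uc2) i2) (qe _ uc2).
  by rewrite -(vg _ uc2) row_rows2.
have fs : fixp F' n s.
  apply: (fixF' _ _ _ ps pw ps iw) (Q_refl _).
  apply: (can_inj (mulmxK ug)); rewrite mulmxKV // !mulmxDl !eg ew.
  by apply/rowP => j; rewrite vmul3 !mxE.
have FA := fix_lattices qF' F'1 (fixp_all qF' F'1 f0 f1 f2 fs).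
exists g => // m N vN pN; have q := FA m N vN pN.
have := Q_mulr (io g) q; rewrite /F' mulmx1 -mulmxA -map_mxM mulVmx // map_mx1 mulmx1.
by rewrite -map_mxM.
Qed.

End Qmap.

Section Scalar.
Variables (p : nat) (R : dvr p).
Local Notation K := (dvr_field R).
Local Notation pi := (p%:R : R).
Local Notation red := (@dvr_red p R).
Local Notation fr := (@dvr_frac p R).
Local Notation io := (map_mx fr).

(** Every primitive vector is an eigenvector of H modulo p^n, after a homothety. Comparing the
eigenvalues of the unit vectors with that of their sum shows that they are all equal. *)
Lemma ball_scalar n (H : 'M[K]_3) : (0 < n)%N ->
  (forall m N, dv m N -> sub (pi ^+ n)%:M N -> Q 0 (io N *m H) (io N)) ->
  exists c a (E : 'M[R]_3), [/\ c != 0, a \is a GRing.unit & c *: H = io (a%:M + pi ^+ n *: E)].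
Proof.
move=> n0 hH.
have v1 : dv 0 (1%:M : 'M[R]_3) by apply/dv0; rewrite unitmx1.
have q1 : Q 0 1%:M H.
  have := hH 0%N 1%:M v1; rewrite map_mx1 mul1mx => q; apply: Q_sym; apply: q.
  by exists (pi ^+ n)%:M; rewrite mulmx1.
have [c [h [c0 /dv0 uh eh]]] := q1; rewrite mulmx1 in eh.
have pt v : prim v -> exists a y, v *m h = a *: v + pi ^+ n *: y.
  move=> pv; have pvh := prim_mul pv uh.
  have q : Q 0 (io (Pt n v)) (io (Pt n (v *m h))).
    apply: Q0_trans (Pt_mul n pv uh); rewrite -eh -scalemxAr.
    by apply: Q0_trans _ (Q_scale _ c0); apply: Q_sym; apply: hH (dv_Pt n pv) (Pt_pn1 n pv).
  have [|N e] := Q_exact (dv_Pt n pv) _ q; first by rewrite addn0; exact: dv_Pt.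
  apply: sub_Pt => //; apply: sub_trans (Pt_v n _) _; rewrite e; exists N; by [].
have P i := pt _ (prim_e R i).
have [a0 [y0 E0]] := P o0; have [a1 [y1 E1]] := P o1; have [a2 [y2 E2]] := P o2.
have ps : prim (e_ R o0 + e_ R o1 + e_ R o2) by exists o0; rewrite !mxE /= !addr0 unitr1.
have [a [y Es]] := pt _ ps.
have ent i j : h i j = (e_ R i *m h) ord0 j by rewrite -rowE mxE.
have Ea : [/\ a0 = a + pi ^+ n * (y ord0 o0 - (y0 + y1 + y2) ord0 o0),
    a1 = a + pi ^+ n * (y ord0 o1 - (y0 + y1 + y2) ord0 o1) &
    a2 = a + pi ^+ n * (y ord0 o2 - (y0 + y1 + y2) ord0 o2)].
  move: Es; rewrite !mulmxDl E0 E1 E2 => Es.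
  have S j : (a0 *: e_ R o0 + a1 *: e_ R o1 + a2 *: e_ R o2) ord0 j =
     (a *: (e_ R o0 + e_ R o1 + e_ R o2) + pi ^+ n *: (y - (y0 + y1 + y2))) ord0 j.
    rewrite scalerBr addrA -Es; rewrite !mxE; ring.
  by split; [have := S o0 | have := S o1 | have := S o2];
    rewrite !mxE /= ?(mulr0, mulr1, addr0, add0r).
case: Ea => ea0 ea1 ea2.
pose E := rows3 ((y ord0 o0 - (y0 + y1 + y2) ord0 o0) *: e_ R o0 + y0)
  ((y ord0 o1 - (y0 + y1 + y2) ord0 o1) *: e_ R o1 + y1)
  ((y ord0 o2 - (y0 + y1 + y2) ord0 o2) *: e_ R o2 + y2).
have hE : h = a%:M + pi ^+ n *: E.
  apply/matrixP => i j; rewrite ent; move: i; apply: (@all3 _).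
  - by rewrite E0 ea0 !mxE /= eq_sym; case: (j == o0); rewrite ?mulr1n ?mulr0n; ring.
  - by rewrite E1 ea1 !mxE /= eq_sym; case: (j == o1); rewrite ?mulr1n ?mulr0n; ring.
  - by rewrite E2 ea2 !mxE /= eq_sym; case: (j == o2); rewrite ?mulr1n ?mulr0n; ring.
exists c, a, E; split=> //; last by rewrite eh hE.
have : \det (map_mx red h) != 0 by rewrite det_map_mx /= -dvr_unit -unitmxE.
rewrite hE (_ : map_mx red _ = (red a)%:M).
  by rewrite det_scalar expf_eq0 /= dvr_unit.
apply/matrixP => i j; rewrite !mxE rmorphD rmorphM rmorphXn /= red_pi expr0n gtn_eqF // mul0r addr0.
by rewrite rmorphMn.
Qed.
End Scalar.

(** * Teichmueller expansions of matrices *)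

(** The inner binomial coefficients are divisible by p. Their quotients by p are kept, since they are
what remains modulo p^2. *)
Lemma exprD_prime (S : pzRingType) (p : nat) (x y : S) : prime p -> GRing.comm x y ->
  (x + y) ^+ p = x ^+ p + y ^+ p +
    p%:R * \sum_(1 <= i < p) (('C(p, i) %/ p)%:R * (x ^+ (p - i) * y ^+ i)).
Proof.
move=> p_pr cxy; rewrite (exprDn_comm _ cxy) -(big_mkord xpredT (fun i => x ^+ (p - i) * y ^+ i *+ 'C(p, i))).
have p0 := prime_gt0 p_pr.
rewrite big_nat_recr //= big_ltn // subn0 subnn !expr0 mulr1 mul1r bin0 binn !mulr1n.
rewrite addrAC; congr (_ + _); rewrite mulr_sumr; apply: eq_big_nat => i /andP[i0 ip].
have pC : (p %| 'C(p, i))%N by rewrite prime_dvd_bin // i0.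
by rewrite -[in LHS](divnK pC) mulrA -natrM mulnC mulr_natl.
Qed.

Section Teich.
Variables (p : nat) (R : dvr p).
Local Notation pi := (p%:R : R).
Local Notation red := (@dvr_red p R).
Local Notation M3 := 'M[R]_3.
Let p_pr : prime p := dvr_prime R.

(** Congruence modulo p^k. *)
Definition cg k (A B : M3) := exists E, A = B + pi ^+ k *: E.

Lemma cg_refl k A : cg k A A.
Proof. by exists 0; rewrite scaler0 addr0. Qed.
Lemma cg_sym k A B : cg k A B -> cg k B A.
Proof. by move=> [E ->]; exists (- E); rewrite scalerN addrK. Qed.
Lemma cg_trans k A B C : cg k A B -> cg k B C -> cg k A C.
Proof. by move=> [E ->] [F ->]; exists (F + E); rewrite scalerDr addrA. Qed.
Lemma cg_add k A B C D : cg k A B -> cg k C D -> cg k (A + C) (B + D).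
Proof. by move=> [E ->] [F ->]; exists (E + F); rewrite scalerDr addrACA. Qed.
Lemma cg_mul k A B C D : cg k A B -> cg k C D -> cg k (A * C) (B * D).
Proof.
move=> [E ->] [F ->]; exists (B * F + E * D + pi ^+ k *: (E * F)).
by rewrite mulrDl !mulrDr -!scalerAl -!scalerAr !scalerDr -!addrA.
Qed.
Lemma cg_exp k A B n : cg k A B -> cg k (A ^+ n) (B ^+ n).
Proof.
by move=> H; elim: n => [|n IHn]; [exact: cg_refl | rewrite !exprS; exact: cg_mul].
Qed.
Lemma cg_weak k l A B : (l <= k)%N -> cg k A B -> cg l A B.
Proof.
by move=> lk [E ->]; exists (pi ^+ (k - l) *: E); rewrite scalerA -exprD subnKC.
Qed.
Lemma cg_sum k I (r : seq I) (F G : I -> M3) :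
  (forall i, cg k (F i) (G i)) -> cg k (\sum_(i <- r) F i) (\sum_(i <- r) G i).
Proof.
move=> H; elim: r => [|i r IHr]; first by rewrite !big_nil; exact: cg_refl.
by rewrite !big_cons; exact: cg_add.
Qed.

(** As for numbers, a p-th power gains one power of p, provided that the matrices commute. *)
Lemma cg_expp k A B : (0 < k)%N -> GRing.comm A B -> cg k A B -> cg k.+1 (A ^+ p) (B ^+ p).
Proof.
move=> k0 cAB AB; have [E eE] := AB.
have AB1 : cg 1 A B := cg_weak k0 AB.
have [F eF] : cg 1 (\sum_(i < p) A ^+ (p.-1 - i) * B ^+ i) (\sum_(i < p) B ^+ p.-1).
  apply: (@cg_trans _ _ (\sum_(i < p) B ^+ (p.-1 - i) * B ^+ i)).
    by apply: cg_sum => i; apply: cg_mul (cg_refl _ _); exact: cg_exp.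
  rewrite (eq_bigr (fun=> B ^+ p.-1)) => [|i _]; first exact: cg_refl.
  by rewrite -exprD subnK // -ltnS prednK ?prime_gt0.
exists (E * (B ^+ p.-1 + F)); rewrite -[LHS](subrK (B ^+ p)) addrC; congr (_ + _).
rewrite (subrXX_comm _ cAB) eF eE [B + _]addrC addrK sumr_const card_ord expr1.
rewrite -scaler_nat -scalerDr -scalerAl -scalerAr scalerA.
by rewrite exprSr.
Qed.

Lemma red_fermat (x : R) : red x != 0 -> red (x ^+ p.-1) = 1.
Proof.
move=> x0; rewrite rmorphXn /=; apply: (mulfI x0).
rewrite -exprS prednK ?prime_gt0 // mulr1.
by have := expf_card (red x); rewrite card_Fp.
Qed.

Lemma red_expp2 (x : R) : red (x ^+ (p ^ 2)) = red x.
Proof.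
have F (y : 'F_p) : y ^+ p = y by have := expf_card y; rewrite card_Fp.
by rewrite rmorphXn expnS expn1 exprM !F.
Qed.

Section TeichExpansion.
Variables (A X : M3) (t : R) (mu nu : R).
Hypotheses (cAX : GRing.comm A X)
  (muA : cg 2 (A ^+ (p ^ 2 + p + 1)) mu%:M) (nuX : cg 2 (X ^+ (p ^ 2 + p + 1)) nu%:M)
  (mu0 : red mu != 0) (nu0 : red nu != 0) (XA : cg 1 X (A + t%:M)).

(** As p^3 = (p^2 + p + 1) (p - 1) + 1, a matrix whose power of exponent p^2 + p + 1 is scalar is, up to a
scalar, its own power of exponent p^3. *)
Lemma cg_expp3 Y c : cg 2 (Y ^+ (p ^ 2 + p + 1)) c%:M -> cg 2 (Y ^+ (p ^ 3)) (c ^+ p.-1 *: Y).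
Proof.
move=> H; have -> : (p ^ 3 = (p ^ 2 + p + 1) * p.-1 + 1)%N.
  rewrite -[p in LHS]prednK ?prime_gt0 // -[p in RHS]prednK ?prime_gt0 //= !expnS expn0.
  by ring.
rewrite exprD expr1 exprM; apply: cg_trans (cg_mul (cg_exp p.-1 H) (cg_refl _ Y)) _.
rewrite -[c%:M]scalemx1 exprZn expr1n -scalerAl mul1r; exact: cg_refl.
Qed.

(** The inner terms of (A^(p^2) + t^(p^2))^p, divided by p. *)
Definition carry : M3 := \sum_(1 <= i < p)
  (('C(p, i) %/ p)%:R * ((A ^+ (p ^ 2)) ^+ (p - i) * (t ^+ (p ^ 2))%:M ^+ i)).

(** X is congruent to A + t modulo p, hence X^(p^3) to (A + t)^(p^3) modulo p^2, and both X and A are their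
own powers of exponent p^3 up to scalars. *)
Lemma teich_cg :
  cg 2 (nu ^+ p.-1 *: X) (mu ^+ p.-1 *: A + (t ^+ (p ^ 2) ^+ p)%:M + pi *: carry).
Proof.
have cA2 : GRing.comm (A + t%:M) X.
  by apply: commr_sym; apply: commrD; [exact: commr_sym | exact: comm_mx_scalar].
have cXX (x y : M3) a b : GRing.comm x y -> GRing.comm (x ^+ a) (y ^+ b).
  by move=> cxy; apply: commrX; apply/commr_sym; apply: commrX; exact: commr_sym.
have sX (B : M3) s : GRing.comm B s%:M by exact: comm_mx_scalar.
apply: cg_trans (cg_sym (cg_expp3 nuX)) _.
have e3 : (p ^ 3 = p ^ 2 * p)%N by rewrite -expnSr.
rewrite e3 exprM.
have step1 : cg 2 ((X ^+ (p ^ 2)) ^+ p) (((A + t%:M) ^+ (p ^ 2)) ^+ p).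
  apply: cg_expp => //; first by apply: cXX; exact: commr_sym.
  exact: cg_exp.
apply: cg_trans step1 _.
have frob B s : cg 1 ((B + s%:M) ^+ p) (B ^+ p + (s ^+ p)%:M).
  rewrite (exprD_prime p_pr (sX B s)) -(rmorphXn (@scalar_mx R 3)) /=.
  exists (\sum_(1 <= i < p) (('C(p, i) %/ p)%:R * (B ^+ (p - i) * s%:M ^+ i))).
  by rewrite mulr_natl -scaler_nat expr1.
have step2 : cg 1 ((A + t%:M) ^+ (p ^ 2)) (A ^+ (p ^ 2) + (t ^+ (p ^ 2))%:M).
  rewrite expnS expn1 !exprM; apply: cg_trans (cg_exp p (frob A t)) _; exact: frob.
apply: (@cg_trans _ _ ((A ^+ (p ^ 2) + (t ^+ (p ^ 2))%:M) ^+ p)).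
  apply: cg_expp => //; apply: commrD; last exact: sX.
  apply: cXX; apply/commr_sym; apply: commrD; [exact: commr_refl | exact: sX].
rewrite (exprD_prime p_pr (sX _ _)) -/carry.
rewrite mulr_natl -scaler_nat; apply: cg_add (cg_refl _ _).
apply: cg_add; first by rewrite -exprM -e3; exact: cg_expp3.
by rewrite [((t ^+ _) ^+ p)%:M](rmorphXn (@scalar_mx R 3)); exact: cg_refl.
Qed.

(** The scalars of teich_cg are powers of exponent p - 1, which are 1 modulo p, and t^(p^2) = t modulo p. *)
Lemma teich_entry (a x : R) : A o2 o0 = pi * a -> X o2 o0 = pi * x ->
  red x = red a + \sum_(1 <= i < p)
    ('C(p, i) %/ p)%:R * ((map_mx red A) ^+ (p ^ 2 * (p - i))) o2 o0 * red t ^+ i.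
Proof.
move=> ea ex; have [E /matrixP/(_ o2 o0)] := teich_cg.
rewrite !mxE ea ex mulr0n addr0 => e.
have {}e : nu ^+ p.-1 * x = mu ^+ p.-1 * a + carry o2 o0 + pi * E o2 o0.
  apply: (mulfI (pi_neq0 R)); rewrite mulrCA e; ring.
have := congr1 red e; rewrite !rmorphD !rmorphM /= red_pi mul0r addr0.
rewrite !red_fermat // !mul1r => ->; congr (_ + _).
have redM (M : M3) : red (M o2 o0) = map_mx red M o2 o0 by rewrite mxE.
rewrite redM /carry rmorph_sum /= summxE; apply: eq_bigr => i _.
have tp : red t ^+ (p ^ 2) = red t by rewrite -rmorphXn /= red_expp2.
rewrite rmorphM rmorph_nat rmorphM !rmorphXn /= map_scalar_mx -!(rmorphXn (@scalar_mx 'F_p 3)) /= tp.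
rewrite -exprM mulr_natl -scaler_nat mxE -[_ * _%:M]/(_ *m _) mul_mx_scalar mxE.
by rewrite [in RHS]mulrAC -mulrA.
Qed.
End TeichExpansion.
End Teich.

(** * Carries and the product relation *)

Section FieldIdentities.
Variable F : fieldType.

(** Here a, b, c are the reductions of three matrices and g, h, t the scalars by which three others
differ from them; a and x without indices are the second digits of the entries in position (2,0). The
equations e1, e3, e5 hold for the first three matrices and e2, e4, e6 for the others. Those
obtained from e1 to e4 express g and h in terms of t, and the quadratic terms in t cancel in e6. *)
Lemma carry_linear (a00 a10 a21 a22 a b01 b11 b21 b22 c00 c10 c11 c12 c21 c22 t g h x : F) :
  b22 * c10 + b21 * c00 = 0 -> (b22 + g) * c10 + b21 * (c00 + h) = 0 ->
  c22 * a10 + c21 * a00 = 0 -> (c22 + h) * a10 + c21 * (a00 + t) = 0 ->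
  b21 * (c11 * a00 + c12 * a10) + c10 * (a21 * b01 + a22 * b11 + a * b21) = 0 ->
  b21 * ((c11 + h) * (a00 + t) + c12 * a10) +
    c10 * (a21 * b01 + (a22 + t) * (b11 + g) + x * b21) = 0 ->
  (x - a) * (c10 * b21 * a10) = t * (b21 * c21 * (a00 - a22) - a10 * (b21 * c11 + c10 * b11)).
Proof.
move=> e1 e2 e3 e4 e5 e6.
have hE : h * a10 = - (c21 * t).
  apply/eqP; rewrite -subr_eq0 opprK; apply/eqP.
  by rewrite -[RHS](subrr 0) -{1}e4 -e3; ring.
have gE : g * c10 = - (h * b21).
  apply/eqP; rewrite -subr_eq0 opprK; apply/eqP.
  by rewrite -[RHS](subrr 0) -{1}e2 -e1; ring.
have E : (x - a) * (c10 * b21) = - b21 * (h * a00 + c11 * t + h * t) - c10 * (a22 * g + t * b11 + t * g).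
  apply/eqP; rewrite -subr_eq0; apply/eqP.
  by rewrite -[RHS](subrr 0) -{1}e6 -e5; ring.
transitivity ((x - a) * (c10 * b21) * a10); first by ring.
rewrite E; transitivity (- b21 * ((h * a10) * a00 + a10 * c11 * t + (h * a10) * t)
  - a10 * (a22 * (g * c10) + c10 * t * b11 + t * (g * c10))); first by ring.
rewrite gE; transitivity (- b21 * ((h * a10) * a00 + a10 * c11 * t)
  + (a22 * b21 * (h * a10)) - a10 * c10 * t * b11); first by ring.
by rewrite hE; ring.
Qed.

End FieldIdentities.

Section Products.
Variables (p : nat) (R : dvr p).
Local Notation pi := (p%:R : R).
Local Notation red := (@dvr_red p R).
Local Notation M3 := 'M[R]_3.
Let p_pr : prime p := dvr_prime R.

Lemma red_mx0 (M : M3) : map_mx red M = 0 -> exists E, M = pi *: E.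
Proof.
move=> H; have [|E eE] := @sub_pP _ _ M; last first.
  by exists E; rewrite eE mul_mx_scalar.
move=> i [j]; rewrite dvr_unit mxE; have /matrixP/(_ i j) := H.
by rewrite !mxE => ->; rewrite eqxx.
Qed.

(** Modulo p, a matrix that commutes with A is determined by its last row, because the last unit vector
and its images under A and A^2 span. The scalars s and t are chosen to match the last rows. *)
Lemma normalize (A X : M3) : GRing.comm A X -> red (A o2 o0) = 0 -> red (X o2 o0) = 0 ->
  red (A o1 o0) != 0 -> red (A o2 o1) != 0 -> red (X o2 o1) != 0 ->
  exists s t, s \is a GRing.unit /\ cg 1 (s *: X) (A + t%:M).
Proof.
move=> cAX a20 x20 a10 a21 x21.
have us : A o2 o1 / X o2 o1 \is a GRing.unit by rewrite unitrM unitrV !dvr_unit a21.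
exists (A o2 o1 / X o2 o1), (A o2 o1 / X o2 o1 * X o2 o2 - A o2 o2); split=> //.
set s := A o2 o1 / X o2 o1; set t := _ - _.
pose D := s *: X - (A + t%:M).
have cD : A *m D = D *m A.
  rewrite /D mulmxBr mulmxBl mulmxDr mulmxDl -scalemxAr -scalemxAl mul_mx_scalar mul_scalar_mx.
  by rewrite (cAX : A *m X = X *m A).
have [E eE] : exists E, D = pi *: E; last first.
  by exists E; rewrite expr1 -eE /D [RHS]addrC subrK.
apply: red_mx0; apply/matrixP => i j; rewrite mxE [RHS]mxE.
have d2 k : red (D o2 k) = 0.
  move: k; apply: (@all3 _); rewrite /D !mxE.
  - by rewrite rmorphB rmorphD rmorphM /= x20 a20 mulr0 mulr0n rmorph0 addr0 subr0.
  - by rewrite /s mulr0n addr0 divrK ?dvr_unit // subrr rmorph0.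
  - by rewrite /= mulr1n /t [A o2 o2 + _]addrC subrK subrr rmorph0.
have rc k l : red (A k o0) * red (D o0 l) + red (A k o1) * red (D o1 l) + red (A k o2) * red (D o2 l)
   = red (D k o0) * red (A o0 l) + red (D k o1) * red (A o1 l) + red (D k o2) * red (A o2 l).
  by rewrite -!rmorphM -!rmorphD -!mulmx3 cD.
have d1 k : red (D o1 k) = 0.
  have := rc o2 k; rewrite a20 !d2 !mul0r mulr0 !addr0 add0r => /eqP.
  by rewrite mulf_eq0 (negPf a21) => /eqP.
have d0 k : red (D o0 k) = 0.
  have := rc o1 k; rewrite !d1 !d2 !mul0r !mulr0 !addr0 => /eqP.
  by rewrite mulf_eq0 (negPf a10) => /eqP.
by move: i; apply: (@all3 (fun i => red (D i j) = 0)).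
Qed.

(** The square of the map e0 -> e1 -> e2 -> p e0. Multiplying by it passes from coordinates adapted to
one vertex of a chamber to those adapted to the next vertex. *)
Definition rotm2 : M3 := mx3 0 0 1 pi 0 0 0 pi 0.

Lemma mul_rot2 (U : M3) i : [/\ (U *m rotm2) i o0 = pi * U i o1, (U *m rotm2) i o1 = pi * U i o2
  & (U *m rotm2) i o2 = U i o0].
Proof. by split; rewrite mulmx3 !mxE /=; ring. Qed.

Lemma mul_rot2_0 (U : M3) i : (U *m rotm2) i o0 = pi * U i o1.
Proof. by case: (mul_rot2 U i). Qed.
Lemma mul_rot2_1 (U : M3) i : (U *m rotm2) i o1 = pi * U i o2.
Proof. by case: (mul_rot2 U i). Qed.
Lemma mul_rot2_2 (U : M3) i : (U *m rotm2) i o2 = U i o0.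
Proof. by case: (mul_rot2 U i). Qed.

(** The composition of three maps, each given by its matrix in the coordinates of a different vertex of
the chamber. *)
Definition rotprod (U V W : M3) := (U *m rotm2) *m (V *m rotm2) *m (W *m rotm2).

Lemma rotprodE U V W i j : rotprod U V W i j =
  \sum_k (\sum_l (U *m rotm2) i l * (V *m rotm2) l k) * (W *m rotm2) k j.
Proof. by rewrite mxE; apply: eq_bigr => k _; rewrite mxE. Qed.

(** The entries of rotprod off the diagonal that are used are divisible by p^2 for trivial reasons. If the
product is scalar modulo p^3, their quotients by p^2 vanish modulo p. *)
Lemma cg3_off M l i j x y : cg 3 M l%:M -> i != j -> M i j = pi ^+ 2 * x + pi ^+ 3 * y -> red x = 0.
Proof.
move=> [E /matrixP/(_ i j)]; rewrite !mxE => e /negPf ij; rewrite e ij mulr0n add0r => e2.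
apply/redP; exists (E i j - y); apply: (mulfI (piX_neq0 R 2)).
transitivity (pi ^+ 2 * x + pi ^+ 3 * y - pi ^+ 3 * y); first by ring.
by rewrite -e2; ring.
Qed.

Lemma rot_rel2 U V W l v w : cg 3 (rotprod V W U) l%:M ->
  V o2 o0 = pi * v -> W o2 o0 = pi * w ->
  red (U o2 o1) * (red (V o2 o2) * red (W o1 o0) + red (V o2 o1) * red (W o0 o0)) = 0.
Proof.
move=> c ev ew; rewrite -!(rmorphM, rmorphD) /=.
apply: (cg3_off (i := o2) (j := o0) (y := V o2 o1 * (W o0 o1 * U o0 o1 + W o0 o2 * U o1 o1)
  + V o2 o2 * (W o1 o1 * U o0 o1 + W o1 o2 * U o1 o1)
  + v * (W o2 o1 * U o0 o1 + W o2 o2 * U o1 o1 + w * U o2 o1)) c) => //.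
by rewrite rotprodE !sum3 !mul_rot2_0 !mul_rot2_1 !mul_rot2_2 ev ew; ring.
Qed.

Lemma rot_rel1 U V W l u : cg 3 (rotprod W U V) l%:M -> U o2 o0 = pi * u ->
  red (V o2 o1) * (red (W o1 o1) * red (U o0 o0) + red (W o1 o2) * red (U o1 o0)) +
  red (W o1 o0) * (red (U o2 o1) * red (V o0 o1) + red (U o2 o2) * red (V o1 o1) +
    red u * red (V o2 o1)) = 0.
Proof.
move=> c eu; rewrite -!(rmorphM, rmorphD) /=.
apply: (cg3_off (i := o1) (j := o0) (y := W o1 o1 * (U o0 o1 * V o0 o1 + U o0 o2 * V o1 o1)
  + W o1 o2 * (U o1 o1 * V o0 o1 + U o1 o2 * V o1 o1)) c) => //.
by rewrite rotprodE !sum3 !mul_rot2_0 !mul_rot2_1 !mul_rot2_2 eu; ring.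
Qed.
End Products.

Section Families.
Variables (p : nat) (R : dvr p) (J : eqType) (jb : J).
Local Notation pi := (p%:R : R).
Local Notation red := (@dvr_red p R).
Local Notation M3 := 'M[R]_3.
Let p_pr : prime p := dvr_prime R.

(** The properties of the matrices U j of the elements r^(d j): they move the base point along the base
line, commute, have order dividing p^2 + p + 1 up to scalars, and move both the base point and the base
line unless j is the base index. *)
Definition opfam (U : J -> M3) : Prop :=
  [/\ forall j, red (U j o2 o0) = 0,
      forall j k, GRing.comm (U j) (U k),
      forall j, exists2 mu, red mu != 0 & cg 2 (U j ^+ (p ^ 2 + p + 1)) mu%:M &
      forall j, j != jb -> red (U j o1 o0) != 0 /\ red (U j o2 o1) != 0].

(** The quotient of the entries in positions (2,2) and (2,1) is the parameter, on the base line, of the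
image of the base point. It takes all values. *)
Definition opsurj (U : J -> M3) : Prop :=
  forall j1, j1 != jb -> forall t, exists2 j, j != jb &
    red (U j o2 o2) * red (U j1 o2 o1) = red (U j o2 o1) * (red (U j1 o2 o2) + t).

Definition scalar3 (M : M3) := exists l, cg 3 M l%:M.

Definition rotfam (U V W : J -> M3) : Prop := forall j,
  [/\ scalar3 (rotprod (U j) (V j) (W j)), scalar3 (rotprod (V j) (W j) (U j)) &
      scalar3 (rotprod (W j) (U j) (V j))].

Lemma rotprod_scale a b c U V W :
  rotprod (a *: U) (b *: V) (c *: W) = (a * b * c) *: rotprod U V W :> M3.
Proof.
rewrite /rotprod -!scalemxAl -!scalemxAr -!scalemxAl !scalerA; congr (_ *: _).
by ring.
Qed.

Lemma scalar3_scale a (M : M3) : scalar3 M -> scalar3 (a *: M).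
Proof.
move=> [l [E ->]]; exists (a * l), (a *: E).
by rewrite scalerDr -scale_scalar_mx !scalerA [a * _]mulrC.
Qed.

Lemma cg1_red (X A : M3) t i j : cg 1 X (A + t%:M) -> red (X i j) = red (A i j) + red t *+ (i == j).
Proof.
move=> [E ->]; rewrite expr1 !mxE !rmorphD rmorphM /= red_pi mul0r addr0.
by rewrite rmorphMn.
Qed.

Lemma opfam_p U j : opfam U -> exists u, U j o2 o0 = pi * u.
Proof. by move=> [H _ _ _]; apply/redP. Qed.

Section Formula.
Variables (U V W : J -> M3).
Hypotheses (opU : opfam U) (opV : opfam V) (opW : opfam W) (UVW : rotfam U V W)
  (sU : opsurj U).

(** By opsurj there is a j for which U j is a multiple of U j1 + t modulo p. The sum is the difference of
the second digits of their (2,0) entries, by the Teichmueller expansion. The right-hand side is the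
value of this difference that results from the product relations for j and for j1. *)
Lemma carry_formula j1 t : j1 != jb ->
  let A := map_mx red (U j1) in let B := map_mx red (V j1) in let C := map_mx red (W j1) in
  (\sum_(1 <= i < p) ('C(p, i) %/ p)%:R * (A ^+ (p ^ 2 * (p - i))) o2 o0 * t ^+ i)
    * (C o1 o0 * B o2 o1 * A o1 o0) =
  t * (B o2 o1 * C o2 o1 * (A o0 o0 - A o2 o2)
        - A o1 o0 * (B o2 o1 * C o1 o1 + C o1 o0 * B o1 o1)).
Proof.
move=> j1b /=; have [j jjb ej] := sU j1b t.
have [U20 cU rU nU] := opU; have [V20 cV rV nV] := opV; have [W20 cW rW nW] := opW.
have [a10 a21] := nU _ j1b; have [x10 x21] := nU _ jjb.
have [b10 b21] := nV _ j1b; have [y10 y21] := nV _ jjb.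
have [c10 c21] := nW _ j1b; have [z10 z21] := nW _ jjb.
have [s1 [t1 [us1 n1]]] := normalize (cU j1 j) (U20 j1) (U20 j) a10 a21 x21.
have [s2 [t2 [us2 n2]]] := normalize (cV j1 j) (V20 j1) (V20 j) b10 b21 y21.
have [s3 [t3 [us3 n3]]] := normalize (cW j1 j) (W20 j1) (W20 j) c10 c21 z21.
have et : red t1 = t.
  have e1 := cg1_red o2 o1 n1; have e2 := cg1_red o2 o2 n1.
  rewrite mulr0n addr0 mxE rmorphM /= in e1; rewrite mulr1n mxE rmorphM /= in e2.
  apply: (addrI (red (U j1 o2 o2))); rewrite -e2; apply: (mulIf a21).
  by rewrite -[LHS]mulrA ej mulrA e1 mulrC.
have [mu mu0 emu] := rU j1; have [nu nu0 enu] := rU j.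
have [a ea] := opfam_p j1 opU; have [x ex] := opfam_p j opU.
have esx : (s1 *: U j) o2 o0 = pi * (s1 * x) by rewrite mxE ex; ring.
have cX : GRing.comm (U j1) (s1 *: U j).
  by rewrite /GRing.comm -scalerAl -scalerAr cU.
have nX : cg 2 ((s1 *: U j) ^+ (p ^ 2 + p + 1)) (s1 ^+ (p ^ 2 + p + 1) * nu)%:M.
  have [E eE] := enu; exists (s1 ^+ (p ^ 2 + p + 1) *: E).
  by rewrite exprZn eE scalerDr -scale_scalar_mx !scalerA [_ * pi ^+ 2]mulrC.
have nX0 : red (s1 ^+ (p ^ 2 + p + 1) * nu) != 0.
  by rewrite rmorphM rmorphXn /= mulf_neq0 // expf_neq0 // -dvr_unit.
have T := teich_entry cX emu nX mu0 nX0 n1 ea esx.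
have {}T : red (s1 * x) - red a = \sum_(1 <= i < p)
    ('C(p, i) %/ p)%:R * (map_mx red (U j1) ^+ (p ^ 2 * (p - i))) o2 o0 * t ^+ i.
  by rewrite T addrC addKr et.
rewrite -T !mxE.
have [p1 p2 p3] := UVW j1; have [q1 q2 q3] := UVW j.
have sc (k1 k2 k3 : R) (X Y Z : M3) : scalar3 (rotprod X Y Z) ->
   scalar3 (rotprod (k1 *: X) (k2 *: Y) (k3 *: Z)).
  by rewrite rotprod_scale; exact: scalar3_scale.
have {}q1 := sc s1 s2 s3 _ _ _ q1; have {}q2 := sc s2 s3 s1 _ _ _ q2.
have {}q3 := sc s3 s1 s2 _ _ _ q3.
have [v ev] := opfam_p j1 opV; have [w ew] := opfam_p j1 opW.
have [v' ev'] := opfam_p j opV; have [w' ew'] := opfam_p j opW.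
have esv : (s2 *: V j) o2 o0 = pi * (s2 * v') by rewrite mxE ev'; ring.
have esw : (s3 *: W j) o2 o0 = pi * (s3 * w') by rewrite mxE ew'; ring.
have [l1 c1] := p1; have [l2 c2] := p2; have [l3 c3] := p3.
have [m1 d1] := q1; have [m2 d2] := q2; have [m3 d3] := q3.
have A2 := rot_rel2 c2 ev ew; have X2 := rot_rel2 d2 esv esw.
have A2' := rot_rel2 c3 ew ea; have X2' := rot_rel2 d3 esw esx.
have A1 := rot_rel1 c3 ea; have X1 := rot_rel1 d3 esx.
rewrite !(cg1_red _ _ n1, cg1_red _ _ n2, cg1_red _ _ n3) /= ?mulr0n ?mulr1n ?addr0 in X2 X2' X1.
rewrite et in X2' X1.
have cancel (k z : 'F_p) : k != 0 -> k * z = 0 -> z = 0.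
  by move=> k0 /eqP; rewrite mulf_eq0 (negPf k0) => /eqP.
exact: (carry_linear (cancel _ _ a21 A2) (cancel _ _ a21 X2) (cancel _ _ b21 A2')
  (cancel _ _ b21 X2') A1 X1).
Qed.
End Formula.

(** Both sides of carry_formula are polynomials in t of degree less than p that agree on F_p, so they have
the same coefficients. On the right the coefficient of t^(p-1) is zero when p > 2. *)
Lemma carry_vanishes U V W j1 : (2 < p)%N -> opfam U -> opfam V -> opfam W -> rotfam U V W ->
  opsurj U -> j1 != jb -> (map_mx red (U j1) ^+ (p ^ 2)) o2 o0 = 0.
Proof.
move=> p2 opU opV opW UVW sU j1b.
have H t := carry_formula opU opV opW UVW sU t j1b; rewrite /= in H.
have [_ _ _ nU] := opU; have [_ _ _ nV] := opV; have [_ _ _ nW] := opW.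
have [a10 a21] := nU _ j1b; have [b10 b21] := nV _ j1b; have [c10 c21] := nW _ j1b.
set A := map_mx red (U j1) in H *; set k := (_ * _ * A o1 o0) in H; set m := (_ - _ * (_ + _)) in H.
have k0 : k != 0 by rewrite /k !mxE !mulf_neq0.
(* the difference of the two sides of carry_formula, divided by k *)
pose Q : {poly 'F_p} := \poly_(i < p) (if i == 0%N then 0 else
   ('C(p, i) %/ p)%:R * (A ^+ (p ^ 2 * (p - i))) o2 o0 - (m / k) *+ (i == 1%N)).
have p0 := prime_gt0 p_pr.
have Q0 : Q = 0.
  apply: (@roots_geq_poly_eq0 _ _ (enum 'F_p)).
  - apply/allP => t _; rewrite rootE horner_poly -(big_mkord xpredT (fun i => (if i == 0%N then 0 else
   ('C(p, i) %/ p)%:R * (A ^+ (p ^ 2 * (p - i))) o2 o0 - (m / k) *+ (i == 1%N)) * t ^+ i)).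
    rewrite big_ltn //= mul0r add0r.
    have -> : \sum_(1 <= i < p) (if i == 0%N then 0 else
       ('C(p, i) %/ p)%:R * (A ^+ (p ^ 2 * (p - i))) o2 o0 - (m / k) *+ (i == 1%N)) * t ^+ i
     = \sum_(1 <= i < p) ('C(p, i) %/ p)%:R * (A ^+ (p ^ 2 * (p - i))) o2 o0 * t ^+ i - m / k * t.
      rewrite [in RHS]big_ltn ?prime_gt1 // [in LHS]big_ltn ?prime_gt1 //= mulr1n expr1.
      rewrite (eq_big_nat _ _ (F2 := fun i => ('C(p, i) %/ p)%:R * (A ^+ (p ^ 2 * (p - i))) o2 o0 * t ^+ i)).
        by rewrite mulrBl -!addrA [- _ + _]addrC.
      by move=> [|[|i]] //= _; rewrite mulr0n subr0.
    apply/eqP; apply: (mulIf k0); rewrite mulrBl mul0r H mulrAC divfK //.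
    by rewrite mulrC subrr.
  - exact: enum_uniq.
  - by rewrite -cardE card_Fp // size_poly.
have := congr1 (fun q : {poly 'F_p} => q`_p.-1) Q0.
rewrite coef0 coef_poly prednK // leqnn.
have -> : (p.-1 == 0)%N = false by apply: negbTE; rewrite -lt0n -ltnS prednK // prime_gt1.
have -> : (p.-1 == 1)%N = false by apply: negbTE; rewrite -(eqn_add2r 1) !addn1 prednK // gtn_eqF.
rewrite mulr0n subr0 (_ : 'C(p, p.-1) = p); last by rewrite -{1}[p]prednK // binSn prednK.
by rewrite divnn p0 mul1r (_ : p - p.-1 = 1)%N ?muln1 // -{1}[p]prednK // subSnn.
Qed.

Lemma rotfam_rot U V W : rotfam U V W -> rotfam V W U.
Proof. by move=> H j; have [? ? ?] := H j; split. Qed.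

Lemma diag_rel U V W j1 : opfam U -> opfam V -> opfam W -> rotfam U V W -> j1 != jb ->
  red (V j1 o2 o2) * red (W j1 o1 o0) + red (V j1 o2 o1) * red (W j1 o0 o0) = 0.
Proof.
move=> opU opV opW UVW j1b; have [_ [l c] _] := UVW j1.
have [v ev] := opfam_p j1 opV; have [w ew] := opfam_p j1 opW.
have [_ _ _ nU] := opU; have [_ a21] := nU _ j1b.
by have /eqP := rot_rel2 c ev ew; rewrite mulf_eq0 (negPf a21) => /eqP.
Qed.

Lemma F2_neq0 (x : 'F_2) : x != 0 -> x = 1.
Proof. by case: x => [[|[|//]] i] // _; apply/val_inj. Qed.

(** All nonzero residues are 1, so if none of the three entries vanishes, the three rotated instances of
carry_formula for t = 1 have left-hand sides 1. Their right-hand sides add up to 0. *)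
Lemma carry_even U V W j1 : p = 2 -> opfam U -> opfam V -> opfam W -> rotfam U V W ->
  opsurj U -> opsurj V -> opsurj W -> j1 != jb ->
  (map_mx red (U j1) ^+ (p ^ 2)) o2 o0 != 0 -> (map_mx red (V j1) ^+ (p ^ 2)) o2 o0 != 0 ->
  (map_mx red (W j1) ^+ (p ^ 2)) o2 o0 != 0 -> False.
Proof.
move=> p2 opU opV opW UVW sU sV sW j1b U4 V4 W4.
have VWU := rotfam_rot UVW; have WUV := rotfam_rot VWU.
have fU := carry_formula opU opV opW UVW sU 1 j1b.
have fV := carry_formula opV opW opU VWU sV 1 j1b.
have fW := carry_formula opW opU opV WUV sW 1 j1b.
rewrite /= in fU fV fW.
have dU := diag_rel opU opV opW UVW j1b.
have dV := diag_rel opV opW opU VWU j1b.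
have dW := diag_rel opW opU opV WUV j1b.
have [_ _ _ nU] := opU; have [_ _ _ nV] := opV; have [_ _ _ nW] := opW.
have [a10 a21] := nU _ j1b; have [b10 b21] := nV _ j1b; have [c10 c21] := nW _ j1b.
have F2 (x : 'F_p) : x != 0 -> x = 1 by move: x; rewrite p2; exact: F2_neq0.
have two : 2 = 0 :> 'F_p by rewrite -(pchar_Fp_0 p_pr); congr (_%:R); rewrite p2.
have one : \sum_(1 <= i < p) ('C(p, i) %/ p)%:R = 1 :> 'F_p.
  by rewrite [X in \sum_(_ <= _ < X) _]p2 big_nat1 bin1 divnn prime_gt0.
have sum1 (M : 'M['F_p]_3) : (M ^+ (p ^ 2)) o2 o0 != 0 ->
    \sum_(1 <= i < p) ('C(p, i) %/ p)%:R * (M ^+ (p ^ 2 * (p - i))) o2 o0 * 1 ^+ i = 1.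
  move=> M4; rewrite [X in \sum_(_ <= _ < X) _]p2 big_nat1 bin1 divnn prime_gt0 // expr1 mulr1 mul1r.
  by have -> : (p - 1 = 1)%N; [rewrite p2 | rewrite muln1; exact: F2].
move: fU fV fW; rewrite (sum1 _ U4) (sum1 _ V4) (sum1 _ W4) !mxE.
move: dU dV dW; rewrite (F2 _ a10) (F2 _ a21) (F2 _ b10) (F2 _ b21) (F2 _ c10) (F2 _ c21).
rewrite !mulr1 !mul1r => d1 d2 d3 f1 f2 f3.
have e1 : red (V j1 o2 o2) = - red (W j1 o0 o0) by apply/eqP; rewrite -addr_eq0 d1.
have e2 : red (W j1 o2 o2) = - red (U j1 o0 o0) by apply/eqP; rewrite -addr_eq0 d2.
have e3 : red (U j1 o2 o2) = - red (V j1 o0 o0) by apply/eqP; rewrite -addr_eq0 d3.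
rewrite e3 in f1; rewrite e1 in f2; rewrite e2 in f3.
have /eqP := oner_neq0 'F_p; apply.
transitivity (1 + 1 + 1 - 2 :> 'F_p); first by ring.
have S := f_equal2 +%R (f_equal2 +%R f1 f2) f3.
by rewrite S -[RHS](mulr0 (red (U j1 o0 o0) + red (V j1 o0 o0) + red (W j1 o0 o0)
  - red (U j1 o1 o1) - red (V j1 o1 o1) - red (W j1 o1 o1) - 1)) -two; ring.
Qed.
End Families.

(** * Counting with difference sets *)

Definition perfect_difference (J : Type) (Z : zmodType) (d : J -> Z) : Prop :=
  [/\ injective d,
      forall r, r != 0 -> exists j k, d j - d k = r &
      forall j k j' k', j <> k -> d j - d k = d j' - d k' -> j = j' /\ k = k'].

Section Weights.
Variables (Z : finComNzRingType) (J : finType) (d : J -> Z) (H N : {set Z}).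
Hypotheses (H0 : 0 \in H) (HB : forall a b, a \in H -> b \in H -> a - b \in H)
  (NH : forall a h, a \in N -> h \in H -> a + h \in N)
  (dN : forall j, d j \in N) (pd : perfect_difference d)
  (plane : forall a b r, r \notin H -> a \in N -> a + r \in N -> b \in N -> b + r \in N ->
     a - b \in H).

Let HN a : a \in H -> - a \in H.
Proof. by move=> Ha; rewrite -[- a]sub0r HB. Qed.
Let HD a b : a \in H -> b \in H -> a + b \in H.
Proof. by move=> Ha Hb; rewrite -[b]opprK HB // HN. Qed.

Let W a := [set j | d j - a \in H].

(** In the application, H is the set of exponents of the powers of a generator that fix a point, and N of
those that send this point to a given line. Each h in H gives the nonzero difference a - b + h, which
is d j - d k for exactly one pair; the hypothesis on lines then forces d j in a + H and d k in b + H. *)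
Lemma fibre_card a b : a \in N -> b \in N -> a - b \notin H -> (#|W a| * #|W b| = #|H|)%N.
Proof.
move=> aN bN ab; have [dI dE dU] := pd; rewrite -cardsX.
have abH r : r - (a - b) \in H -> r \notin H.
  by move=> rH; apply: contra ab => Hr; rewrite -(subKr r (a - b)) HB.
pose f (u : J * J) := (d u.1 - d u.2) - (a - b).
have fE u : f u = (d u.1 - a) - (d u.2 - b) by rewrite /f; ring.
have <- : f @: finset.setX (W a) (W b) = H.
  apply/setP => h; apply/imsetP/idP => [[u] |Hh].
    by rewrite !inE => /andP[ua ub] ->; rewrite fE HB.
  have rH : h + (a - b) \notin H by apply: abH; rewrite addrK.
  have [|j [k jk]] := dE (h + (a - b)); first by apply: contraNneq rH => ->.
  have kb : d k - b \in H.
    apply: (plane rH) => //; first by rewrite -jk addrC subrK dN.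
    by rewrite (_ : b + _ = a + h) ?NH //; ring.
  exists (j, k); last by rewrite /f jk addrK.
  rewrite !inE kb andbT /= (_ : d j - a = h + (d k - b)).
    exact: HD.
  have -> : d j = h + (a - b) + d k by rewrite -jk subrK.
  by ring.
rewrite card_in_imset // => -[j k] [j' k']; rewrite !inE /= => /andP[ja kb] _ e.
have e2 : d j - d k = d j' - d k' by apply: (addIr (- (a - b))).
have jk : j <> k.
  move=> jk; have : f (j, k) \in H by rewrite fE HB.
  by rewrite /f jk subrr => /abH; rewrite H0.
by have [-> ->] := dU _ _ _ _ jk e2.
Qed.

Hypothesis three : exists a b c, [/\ a \in N, b \in N & c \in N] /\
  [/\ a - b \notin H, b - c \notin H & a - c \notin H].

(** By fibre_card the fibres W over three points of the line that are inequivalent modulo H all have the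
same size w with w^2 = #|H|. The differences inside two of these fibres are distinct nonzero elements
of H, so that 2 (w^2 - w) <= w^2 - 1 and w = 1. *)
Lemma stab_trivial : H = [set 0].
Proof.
have [dI dE dU] := pd.
have [a [b [c [[aN bN cN] [ab bc ac]]]]] := three.
have Hpos : (0 < #|H|)%N by apply/card_gt0P; exists 0.
have eab := fibre_card aN bN ab; have ebc := fibre_card bN cN bc.
have eac := fibre_card aN cN ac.
have wa : (0 < #|W a|)%N by move: Hpos; rewrite -eab muln_gt0 => /andP[].
have wb : (0 < #|W b|)%N by move: Hpos; rewrite -eab muln_gt0 => /andP[].
have wab : #|W a| = #|W b|.
  by apply/eqP; rewrite -(eqn_pmul2r (m := #|W c|)) ?eac ?ebc //; move: Hpos; rewrite -eac muln_gt0 => /andP[].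
pose T x := finset.setX (W x) (W x) :\: [set u | u.1 == u.2].
have cardT x : (#|T x| = #|W x| * #|W x| - #|W x|)%N.
  rewrite cardsD cardsX; congr (_ - _)%N.
  rewrite -(card_in_imset (f := fun j : J => (j, j)) (D := W x)); last by move=> ? ? _ _ [].
  apply: eq_card => -[j k]; rewrite !inE /=; apply/andP/imsetP => [[/andP[jW kW] /eqP e]|[i iW [-> ->]]].
    by exists j; rewrite ?inE -?e.
  by rewrite inE in iW; rewrite iW eqxx.
have TH x u : u \in T x -> d u.1 - d u.2 \in H :\ 0.
  rewrite !inE => /andP[n /andP[u1 u2]]; rewrite subr_eq0 (inj_eq dI) n /=.
  have -> : d u.1 - d u.2 = (d u.1 - x) - (d u.2 - x) by ring.
  exact: HB.
have disj : [disjoint T a & T b].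
  apply/pred0P => u /=; apply: negbTE; rewrite !inE -andbA; apply/negP => /and5P[_ /andP[u1 _] _ u2 _].
  by move/negP: ab; apply; have -> : a - b = (d u.1 - b) - (d u.1 - a); [by ring | exact: HB].
have : (#|T a :|: T b| <= #|H :\ 0%R|)%N.
  rewrite -(card_in_imset (f := fun u => d u.1 - d u.2) (D := T a :|: T b)).
    apply: subset_leq_card; apply/fintype.subsetP => _ /imsetP [u uT ->].
    by move: uT; rewrite finset.in_setU => /orP[]; exact: TH.
  move=> [j k] [j' k'] uT _ /= e; have jk : j <> k.
    by move=> jk; move: uT; rewrite !inE /= jk eqxx.
  by have [-> ->] := dU _ _ _ _ jk e.
rewrite cardsU disjoint_setI0 // cards0 subn0 !cardT -wab.
have := cardsD1 0 H; rewrite H0 => eH; have eq := eab; rewrite -wab eH in eq.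
move=> le; have h0 : #|H :\ 0| = 0%N.
  by move: wa eq le; move: #|W a| #|H :\ 0| => w h; nia.
apply/setP => x; rewrite inE; apply/idP/eqP => [xH|-> //]; apply/eqP; apply: contraT => x0.
by have /eqP := h0; rewrite cards_eq0 => /eqP/setP/(_ x); rewrite !inE x0 xH.
Qed.

Lemma difference_set_full a : a \in N -> exists j, d j = a.
Proof.
move=> aN; have H1 := stab_trivial.
have [b [bN ab]] : exists b, b \in N /\ a - b \notin H.
  have [b [c [_ [[bN cN _] [bc _ _]]]]] := three.
  have [e|] := boolP (a - b \in H); last by exists b.
  exists c; split=> //; apply: contra bc => e'.
  by have -> : b - c = (a - c) - (a - b); [ring | exact: HB].
have := fibre_card aN bN ab; rewrite [X in _ = #|pred_of_set X|]H1 cards1 => /eqP; rewrite muln_eq1 => /andP[/eqP w1 _].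
have /card_gt0P [j] : (0 < #|W a|)%N by rewrite w1.
by rewrite inE H1 inE subr_eq0 => /eqP <-; exists j.
Qed.
End Weights.

(** * The link of a vertex *)

Section Link.
Variables (p : nat) (R : dvr p).
Local Notation K := (dvr_field R).
Local Notation pi := (p%:R : R).
Local Notation red := (@dvr_red p R).
Local Notation fr := (@dvr_frac p R).
Local Notation io := (map_mx fr).
Implicit Types (o l X B : 'M[K]_3) (v w : 'rV[R]_3) (k : 'M[R]_3).

Lemma sub_Ln v k : k \in unitmx -> sub v (Ln k) <-> red ((v *m invmx k) ord0 o0) = 0.
Proof.
move=> uk; split=> [[b ->]|/redP [y ey]].
  rewrite /Ln mulmxA mulmxK // vmul3 !mxE /= !mulr0 !addr0 rmorphM /= red_pi mulr0 //.
exists (\row_j nth 0 [:: y; (v *m invmx k) ord0 o1; (v *m invmx k) ord0 o2] j).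
rewrite -[LHS](mulmxKV uk) /Ln mulmxA; congr (_ *m _).
by apply: matrix3P => i; rewrite (ord1 i) vmul3 ?ey !mxE /=; ring.
Qed.

Lemma index_p_span E a : dv 1 E -> ~ sub a E -> forall w, exists c, sub (w - c *: a) E.
Proof.
move=> vE na w.
have [|M [k [uk eE]]] := @sing_factor _ _ E.
  by case: vE => u uu ->; rewrite rmorphM rmorphXn /= red_pi expr1 mul0r.
have uM : M \in unitmx.
  by apply/dv0; apply: (@dv_sub _ _ 0 1 M (Ln k)); rewrite -?eE //; exact: dv_Ln.
have LE (y : 'rV[R]_3) : sub y (Ln k) -> sub y E.
  by move=> [b ->]; exists (b *m invmx M); rewrite eE mulmxA mulmxKV.
have ua : (a *m invmx k) ord0 o0 \is a GRing.unit.
  rewrite dvr_unit; apply/eqP => a0; apply: na; apply: LE; exact/sub_Ln.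
exists ((w *m invmx k) ord0 o0 / (a *m invmx k) ord0 o0); apply: LE; apply/sub_Ln => //.
rewrite mulmxBl -scalemxAl; move: (w *m invmx k) (a *m invmx k) ua => y z uz.
by rewrite !mxE divrK // subrr rmorph0.
Qed.

Lemma index_p_join m M N L v : dv m N -> dv m.+1 M -> sub M N -> sub v N -> ~ sub v M ->
  sub M L -> sub v L -> sub N L.
Proof.
move=> vN vM MN [a ea] nv ML vL; have [d e [E vE eM]] := sub_dv MN vM vN.
have d1 : d = 1%N by move/eqP: e; rewrite -addn1 addnC eqn_add2r eq_sym => /eqP.
rewrite d1 in vE; have na : ~ sub a E.
  by move=> [b eb]; apply: nv; exists b; rewrite eM mulmxA -eb.
apply: sub_rows => i; have [c [b eb]] := index_p_span vE na (e_ R i).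
rewrite rowE -[delta_mx _ _](subrK (c *: a)) mulmxDl; apply: sub_add.
  by rewrite eb -mulmxA -eM; exact: sub_mul.
by rewrite -scalemxAl -ea; exact: sub_scale.
Qed.

Lemma Pt_is_point o v : prim v -> Q 1 (io (Pt 1 v) *m o) o.
Proof.
move=> pv; have [N eN] : sub (pi ^+ 1)%:M (Pt 1 v) := Pt_pn1 1 pv.
have vN : dv 1 N.
  by apply: (@dv_sub _ _ 1 2 N (Pt 1 v)); rewrite -?eN; [exact: (@pi_dv _ _ 1) | exact: (dv_Pt 1)].
apply: (@Q_comp _ _ 1 0) (Q_io _ vN) _; rewrite mulmxA -map_mxM -eN map_scalar_mx mul_scalar_mx.
by apply: Q_sym; apply: Q_scale; rewrite fr_eq0 piX_neq0.
Qed.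

Lemma Ln_is_line o k : k \in unitmx -> Q 1 o (io (Ln k) *m o).
Proof. by move=> uk; apply: Q_io; exact: dv_Ln. Qed.

Lemma point_form o X : o \in unitmx -> X \in unitmx -> Q 1 X o ->
  exists2 v, prim v & Q 0 X (io (Pt 1 v) *m o).
Proof.
move=> uo uX [c [N [c0 vN e]]].
have [M [eM eM' vM]] : exists M, [/\ pi%:M = M *m N, pi%:M = N *m M & dv 2 M].
  have [u uu dN] := vN; exists (u^-1 *: \adj N).
  have eM : (u^-1 *: \adj N) *m N = pi%:M.
    by rewrite -scalemxAl mul_adj_mx dN expr1 scale_scalar_mx mulrCA mulVr // mulr1.
  split=> //.
    by rewrite -scalemxAr mul_mx_adj dN expr1 scale_scalar_mx mulrCA mulVr // mulr1.
  apply: (@dv_sub _ _ 2 1 _ N) => //.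
  by rewrite eM; have := @pi_dv p R 1; rewrite expr1.
have qX : Q 0 X (io M *m o).
  exists (c / fr pi), 1%:M; split.
  - by rewrite mulf_neq0 ?invr_eq0 // fr_eq0 pi_neq0.
  - by apply/dv0; rewrite unitmx1.
  - rewrite map_mx1 mul1mx mulrC -scalerA scalemxAr e mulmxA -map_mxM -eM map_scalar_mx.
    by rewrite mul_scalar_mx scalerA mulVf ?scale1r // fr_eq0 pi_neq0.
have [||v pv q] := @Pt_char _ _ 1 M vM.
- by exists N; rewrite expr1.
- move=> sM; have vp : dv 3 (pi%:M : 'M[R]_3) by have := @pi_dv p R 1; rewrite expr1.
  by have [d] := sub_dv sM vM vp; rewrite addnS addn2.
- exists v => //; apply: Q0_trans qX _.
  by apply: Q_mulr; exact: Q_sym.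
Qed.

Lemma line_form o l : Q 1 o l -> exists2 k, k \in unitmx & Q 0 l (io (Ln k) *m o).
Proof.
move=> [c [N [c0 vN e]]].
have [|M [k [uk eN]]] := @sing_factor _ _ N.
  by case: vN => u uu ->; rewrite rmorphM rmorphXn /= red_pi expr1 mul0r.
exists k => //; apply: Q0_trans (Q_scale l c0) _; rewrite e eN map_mxM -mulmxA.
apply: Q_sym; apply: Q_io; apply: (@dv_sub _ _ 0 1 M (Ln k)); rewrite -?eN //; exact: dv_Ln.
Qed.

Lemma incident_form o k v : o \in unitmx -> k \in unitmx -> prim v ->
  Q 1 (io (Ln k) *m o) (io (Pt 1 v) *m o) <-> sub v (Ln k).
Proof.
move=> uo uk pv; rewrite Q_mulrE //; split=> [q|vk].
  have [N eN] := Q_exact (dv_Ln uk) (dv_Pt 1 pv) q.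
  by apply: sub_trans (Pt_v 1 v) _; exists N.
have s : sub (Pt 1 v) (Ln k).
  by apply: Pt_sub vk _; rewrite -scalemx1; apply: pX_sub (dv_Ln uk) _.
have [d e [M vM ->]] := sub_dv s (dv_Pt 1 pv) (dv_Ln uk).
rewrite map_mxM; apply: Q_io; have -> : 1%N = d by apply/eqP; rewrite -(eqn_add2r 1) e.
by [].
Qed.

(** In the link of o, a lattice X with Q 1 X o is a point and a lattice l with Q 1 o l is a line; this is
the projective plane over F_p. *)
Lemma two_points_one_line o l l' X X' : o \in unitmx -> X \in unitmx -> X' \in unitmx ->
  Q 1 o l -> Q 1 o l' -> Q 1 X o -> Q 1 X' o ->
  Q 1 l X -> Q 1 l X' -> Q 1 l' X -> Q 1 l' X' -> Q 0 l l' \/ Q 0 X X'.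
Proof.
move=> uo uX uX' /line_form [k uk ql] /line_form [k' uk' ql'].
move=> /(point_form uo uX) [v pv qX] /(point_form uo uX') [w pw qX'].
rewrite !(Q0_l _ _ ql) !(Q0_l _ _ ql') !(Q0_r _ _ qX) !(Q0_r _ _ qX').
rewrite !incident_form // => vk wk vk' wk'.
have [wv|nwv] := pselect (sub w (Pt 1 v)).
  right; apply: Q0_trans qX _; apply: Q_sym.
  by apply: Q_mulr; exact: Pt_eq.
left; have pk h : h \in unitmx -> sub v (Ln h) -> sub (Pt 1 v) (Ln h).
  by move=> uh vh; apply: Pt_sub vh _; rewrite -scalemx1; apply: pX_sub (dv_Ln uh) _.
have s : sub (Ln k) (Ln k').
  exact: (index_p_join (dv_Ln uk) (dv_Pt 1 pv) (pk _ uk vk) wk nwv (pk _ uk' vk') wk').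
apply: Q_sym; apply: Q0_trans ql' _.
by apply: Q_mulr; apply: Q_sym; exact: sub_eqQ s (dv_Ln uk) (dv_Ln uk').
Qed.

Lemma Pt1_neq o v w k : o \in unitmx -> k \in unitmx -> prim v -> prim w ->
  (forall a, ~ forall i, red (w ord0 i) = a * red (v ord0 i)) ->
  ~ Q 0 (io (Pt 1 v) *m o) (io (Pt 1 w) *m o).
Proof.
move=> uo uk pv pw H; rewrite Q_mulrE // => q.
have [|N eN] := Q_exact (dv_Pt 1 pv) _ q; first by rewrite addn0; exact: dv_Pt.
have [|a [y e]] := @sub_Pt _ _ 1 v w pv.
  by apply: sub_trans (Pt_v 1 w) _; exists N.
apply: (H (red a)) => i; rewrite e !mxE rmorphD !rmorphM /= rmorphXn /= red_pi.
by rewrite expr1 mul0r addr0.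
Qed.

Lemma not_prop v w i j : red (v ord0 i) != 0 -> red (w ord0 i) = 0 -> red (w ord0 j) != 0 ->
  forall a, ~ forall i, red (w ord0 i) = a * red (v ord0 i).
Proof.
move=> vi wi wj a H; have /esym/eqP := H i; rewrite wi mulf_eq0 (negPf vi) orbF => /eqP a0.
by have := H j; rewrite a0 mul0r => /eqP; rewrite (negPf wj).
Qed.

Lemma three_points o l : o \in unitmx -> Q 1 o l -> exists X Y Z,
  [/\ [/\ X \in unitmx, Y \in unitmx & Z \in unitmx],
      [/\ Q 1 X o, Q 1 Y o & Q 1 Z o], [/\ Q 1 l X, Q 1 l Y & Q 1 l Z] &
      [/\ ~ Q 0 X Y, ~ Q 0 Y Z & ~ Q 0 X Z]].
Proof.
move=> uo /line_form [k uk ql].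
pose o' := io k *m o; have uo' : o' \in unitmx.
  by rewrite unitmx_mul uo andbT; apply: (dv_io (m := 0)); exact/dv0.
have qo : Q 0 o o' by apply: Q_io; exact/dv0.
have ql' : Q 0 l (io (Ln 1%:M) *m o') by rewrite /o' mulmxA -map_mxM /Ln mulmx1.
have p1 := prim_e R o1; have p2 := prim_e R o2.
have p3 : prim (e_ R o1 + e_ R o2) by exists o1; rewrite !mxE /= addr0 unitr1.
have u1 := unitmx1 R 3.
exists (io (Pt 1 (e_ R o1)) *m o'), (io (Pt 1 (e_ R o2)) *m o'), (io (Pt 1 (e_ R o1 + e_ R o2)) *m o').
have uP v : prim v -> io (Pt 1 v) *m o' \in unitmx.
  by move=> pv; rewrite unitmx_mul uo' andbT; exact: dv_io (dv_Pt 1 pv).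
split; first by split; exact: uP.
- by split; apply: (Q0_r _ _ qo).2; exact: Pt_is_point.
- by split; apply: (Q0_l _ _ ql').2; rewrite incident_form // sub_Ln //;
    rewrite invmx1 mulmx1 !mxE /= ?addr0 rmorph0.
- split; apply: (Pt1_neq uo' u1) => //.
  + by apply: (@not_prop _ _ o1 o2); rewrite !mxE /= ?rmorph0 ?rmorph1 ?oner_neq0.
  + move=> a H; have := H o1; rewrite !mxE /= addr0 rmorph0 rmorph1 mulr0 => /eqP.
    by rewrite oner_eq0.
  + move=> a H; have := H o2; rewrite !mxE /= add0r rmorph0 rmorph1 mulr0 => /eqP.
    by rewrite oner_eq0.
Qed.

Lemma Ln_neq k k' o v : o \in unitmx -> k \in unitmx -> k' \in unitmx -> sub v (Ln k) -> ~ sub v (Ln k') ->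
  ~ Q 0 (io (Ln k) *m o) (io (Ln k') *m o).
Proof.
move=> uo uk uk' vk nv; rewrite Q_mulrE // => /Q_sym q; apply: nv; apply: sub_trans vk _.
have [|N eN] := Q_exact (dv_Ln uk') _ q; first by rewrite addn0; exact: dv_Ln.
by exists N.
Qed.

Lemma two_lines o X : o \in unitmx -> X \in unitmx -> Q 1 X o -> exists l l',
  [/\ l \in unitmx /\ l' \in unitmx, Q 1 o l /\ Q 1 o l', Q 1 l X /\ Q 1 l' X & ~ Q 0 l l'].
Proof.
move=> uo uX /(point_form uo uX) [v pv qX].
pose h := ext v; have uh : h \in unitmx := ext_unit pv.
pose P1 : 'M[R]_3 := rows3 (e_ R o1) (e_ R o0) (e_ R o2).
pose P2 : 'M[R]_3 := rows3 (e_ R o2) (e_ R o0) (e_ R o1).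
have simp := (mulr0, mul0r, mulr1, mul1r, subr0, addr0, add0r, sub0r, oppr0).
have uP1 : P1 \in unitmx by rewrite unitmxE det3 !mxE /= ?simp unitrN1.
have uP2 : P2 \in unitmx by rewrite unitmxE det3 !mxE /= ?simp unitr1.
have uk1 : P1 *m h \in unitmx by rewrite unitmx_mul uP1.
have uk2 : P2 *m h \in unitmx by rewrite unitmx_mul uP2.
have inL (P : 'M[R]_3) i (y : 'rV[R]_3) : P \in unitmx -> y *m P = e_ R i ->
    sub (row i h) (Ln (P *m h)) <-> red (y ord0 o0) = 0.
  move=> uP ey; rewrite sub_Ln ?unitmx_mul ?uP //.
  rewrite (_ : row i h = (y *m P) *m h); last by rewrite ey -rowE.
  by rewrite -[y *m P *m h]mulmxA mulmxK // unitmx_mul uP.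
have ev : row o0 h = v by exact: row_ext.
exists (io (Ln (P1 *m h)) *m o), (io (Ln (P2 *m h)) *m o); split.
- by rewrite !unitmx_mul uo !andbT !(dv_io (dv_Ln _)).
- by split; exact: Ln_is_line.
- split; apply: (Q0_r _ _ qX).2; rewrite incident_form // -ev.
    by rewrite (inL P1 _ (e_ R o1)) ?mxE /= ?rmorph0 // -rowE row_rows1.
  by rewrite (inL P2 _ (e_ R o1)) ?mxE /= ?rmorph0 // -rowE row_rows1.
- apply: (Ln_neq (v := row o2 h)) => //.
    by rewrite (inL P1 _ (e_ R o2)) ?mxE /= ?rmorph0 // -rowE row_rows2.
  rewrite (inL P2 _ (e_ R o0)) ?mxE /= ?rmorph1 //.
  by rewrite -rowE row_rows0.
Qed.

(** Two lines are the kernels of two linear forms on F_p^3, which have a common zero. *)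
Lemma lines_meet o l l' : o \in unitmx -> Q 1 o l -> Q 1 o l' ->
  exists X, [/\ X \in unitmx, Q 1 l X, Q 1 l' X & Q 1 X o].
Proof.
move=> uo /line_form [k uk ql] /line_form [k' uk' ql'].
pose M : 'M['F_p]_3 := \matrix_(i, j) nth 0 [:: red (invmx k i o0); red (invmx k' i o0); 0] j.
have /eqP/det0P [v v0 vM] : \det M = 0 by rewrite det3 !mxE /=; ring.
have [c cv] := red_lift R v.
have pc : prim c.
  have [i vi] : exists i, v ord0 i != 0.
    apply: contrapT => H; case/eqP: v0; apply/rowP => i; rewrite mxE.
    by apply: contrapT => /eqP vi; apply: H; exists i.
  by exists i; rewrite dvr_unit; move: vi; rewrite -cv mxE.
have E0 := congr1 (fun w : 'rV_3 => w ord0 o0) vM.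
have E1 := congr1 (fun w : 'rV_3 => w ord0 o1) vM.
rewrite vmul3 -cv !mxE /= in E0; rewrite vmul3 -cv !mxE /= in E1.
exists (io (Pt 1 c) *m o); split.
- by rewrite unitmx_mul uo andbT; exact: dv_io (dv_Pt 1 pc).
- by rewrite (Q0_l _ _ ql) incident_form // sub_Ln // vmul3 !rmorphD !rmorphM.
- by rewrite (Q0_l _ _ ql') incident_form // sub_Ln // vmul3 !rmorphD !rmorphM.
- exact: Pt_is_point.
Qed.
End Link.

(** * A cyclic group acting on the link of a vertex *)

Section Action.
Variables (p : nat) (R : dvr p) (G : groupType).
Local Notation K := (dvr_field R).
Local Notation fr := (@dvr_frac p R).
Variable F : G -> 'M[K]_3 -> 'M[K]_3.

Definition lattice_action : Prop :=
  [/\ forall g, qmap (F g),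
      forall g h B, B \in unitmx -> Q 0 (F (g * h)%g B) (F g (F h B)) &
      forall B, B \in unitmx -> Q 0 (F 1%g B) B].

(** The powers of r fix the vertex o, and permute transitively the lines and the points of its link. The
base point x is sent to points of the base line l by the exponents d j, which form a perfect
difference set containing 0. *)
Record corner (J : Type) n (o l x : 'M[K]_3) (r : G) (d : J -> nat) (jb : J) : Prop := Corner {
  corner_unit : [/\ o \in unitmx, l \in unitmx & x \in unitmx];
  corner_flag : [/\ Q 1 o l, Q 1 l x & Q 1 x o];
  corner_fix : Q 0 (F r o) o;
  corner_order : (r ^+ n)%g = 1%g;
  corner_lines : forall B, B \in unitmx -> Q 1 o B -> exists k, Q 0 (F (r ^+ k)%g l) B;
  corner_points : forall B, B \in unitmx -> Q 1 B o -> exists k, Q 0 (F (r ^+ k)%g x) B;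
  corner_diff : perfect_difference (fun j => (d j)%:R : 'Z_n);
  corner_base : (d jb)%:R = 0 :> 'Z_n;
  corner_inc : forall j, Q 1 l (F (r ^+ d j)%g x) }.

Hypothesis actF : lattice_action.

Lemma act_unit g B : B \in unitmx -> F g B \in unitmx.
Proof. by case: actF => H _ _; case: (H g) => H' _ _; exact: H'. Qed.

Lemma act_Q m g A B : A \in unitmx -> B \in unitmx -> Q m A B -> Q m (F g A) (F g B).
Proof. by case: actF => H _ _; case: (H g) => _ H' _ uA uB /(H' _ _ _ uA uB). Qed.

Lemma act_mul g h B : B \in unitmx -> Q 0 (F (g * h)%g B) (F g (F h B)).
Proof. by case: actF => _ H _; exact: H. Qed.

Lemma act_one B : B \in unitmx -> Q 0 (F 1%g B) B.
Proof. by case: actF => _ _ H; exact: H. Qed.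

Lemma act_eq0 g A B : A \in unitmx -> B \in unitmx -> Q 0 A B -> Q 0 (F g A) (F g B).
Proof. exact: act_Q. Qed.

Lemma act_fixX g B k : B \in unitmx -> Q 0 (F g B) B -> Q 0 (F (g ^+ k)%g B) B.
Proof.
move=> uB gB; elim: k => [|k IHk]; first by rewrite expg0; exact: act_one.
rewrite expgS; apply: Q0_trans (act_mul _ _ uB) _.
by apply: Q0_trans gB; apply: act_eq0 => //; exact: act_unit.
Qed.

Lemma act_commute g h B : B \in unitmx -> (g * h = h * g)%g -> Q 0 (F g (F h B)) (F h (F g B)).
Proof.
move=> uB e; apply: Q0_trans (Q_sym (act_mul _ _ uB)) _; rewrite e; exact: act_mul.
Qed.

Lemma expg_period (g : G) n i j : (g ^+ n = 1)%g -> (i = j %[mod n])%N -> (g ^+ i = g ^+ j)%g.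
Proof.
move=> gn e; rewrite (divn_eq i n) (divn_eq j n) e !expgnDr ![(_ * n)%N]mulnC !expgnA gn.
by rewrite !expg1n.
Qed.

Section Regular.
Variables (J : finType) (n : nat) (o l x : 'M[K]_3) (r : G) (d : J -> nat) (jb : J).
Hypotheses (n1 : (1 < n)%N) (cor : corner n o l x r d jb).

Let uo : o \in unitmx. Proof. by case: (corner_unit cor). Qed.
Let ul : l \in unitmx. Proof. by case: (corner_unit cor). Qed.
Let ux : x \in unitmx. Proof. by case: (corner_unit cor). Qed.
Let ol : Q 1 o l. Proof. by case: (corner_flag cor). Qed.
Let lx : Q 1 l x. Proof. by case: (corner_flag cor). Qed.
Let xo : Q 1 x o. Proof. by case: (corner_flag cor). Qed.

Lemma pow_fix k : Q 0 (F (r ^+ k)%g o) o.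
Proof. exact: act_fixX uo (corner_fix cor). Qed.

Lemma pow_add a b B : B \in unitmx -> Q 0 (F (r ^+ (a + b))%g B) (F (r ^+ a)%g (F (r ^+ b)%g B)).
Proof. by move=> uB; rewrite expgnDr; exact: act_mul. Qed.

Lemma pow_mod a b : (a%:R = b%:R :> 'Z_n) -> (r ^+ a = r ^+ b)%g.
Proof.
move=> /(congr1 val) e; apply: expg_period (corner_order cor) _.
by rewrite /= !val_Zp_nat in e.
Qed.

Lemma pow_point a : Q 1 (F (r ^+ a)%g x) o.
Proof. by rewrite -(Q0_r _ _ (pow_fix a)); exact: act_Q. Qed.

(** An element that fixes one line fixes all of them, since the group is commutative and transitive on
lines; and a point is the intersection of two lines. *)
Lemma fix_line_point m : Q 0 (F (r ^+ m)%g l) l -> Q 0 (F (r ^+ m)%g x) x.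
Proof.
move=> fl; have fB B : B \in unitmx -> Q 1 o B -> Q 0 (F (r ^+ m)%g B) B.
  move=> uB oB; have [k qk] := corner_lines cor uB oB.
  apply: Q0_trans (act_eq0 _ uB (act_unit _ ul) (Q_sym qk)) _.
  apply: Q0_trans qk; apply: Q0_trans (act_commute ul _) _.
    by rewrite -!expgnDr addnC.
  by apply: act_eq0 => //; exact: act_unit.
have [l1 [l2 [[u1 u2] [o1 o2] [x1 x2] n12]]] := two_lines uo ux xo.
have xm := pow_point m.
have on B : B \in unitmx -> Q 1 o B -> Q 1 B x -> Q 1 B (F (r ^+ m)%g x).
  by move=> uB oB Bx; apply: (Q0_l _ _ (fB B uB oB)).1; exact: act_Q.
have [//|q] := two_points_one_line uo ux (act_unit _ ux) o1 o2 xo xm x1 (on _ u1 o1 x1) x2 (on _ u2 o2 x2).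
exact: Q_sym.
Qed.

Let H : {set 'Z_n} := [set k : 'Z_n | `[< Q 0 (F (r ^+ k)%g x) x >]]%SET.
Let N : {set 'Z_n} := [set k : 'Z_n | `[< Q 1 l (F (r ^+ k)%g x) >]]%SET.

Lemma in_H (k : nat) : (k%:R : 'Z_n) \in H <-> Q 0 (F (r ^+ k)%g x) x.
Proof.
rewrite inE (_ : (r ^+ (k%:R : 'Z_n) = r ^+ k)%g).
  by split=> [/asboolP|q]; last exact/asboolP.
by apply: pow_mod; rewrite natr_Zp.
Qed.
Lemma in_N (k : nat) : (k%:R : 'Z_n) \in N <-> Q 1 l (F (r ^+ k)%g x).
Proof.
rewrite inE (_ : (r ^+ (k%:R : 'Z_n) = r ^+ k)%g).
  by split=> [/asboolP|q]; last exact/asboolP.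
by apply: pow_mod; rewrite natr_Zp.
Qed.

Lemma ZnP (a : 'Z_n) : exists k : nat, a = k%:R.
Proof. by exists a; rewrite natr_Zp. Qed.

Lemma pow_cancel a b : Q 0 (F (r ^+ (a + b))%g x) (F (r ^+ b)%g x) -> Q 0 (F (r ^+ a)%g x) x.
Proof.
(* n * b - b is a natural number that represents - b *)
move=> q; have e : (r ^+ (n * b - b + (a + b)) = r ^+ a)%g.
  apply: expg_period (corner_order cor) _.
  by rewrite addnCA subnK ?leq_pmull ?(ltnW n1) // mulnC addnC modnMDl.
have e' : (r ^+ (n * b - b + b) = 1)%g.
  by rewrite subnK ?leq_pmull ?(ltnW n1) // expgnA (corner_order cor) expg1n.
rewrite -e; apply: Q0_trans (pow_add _ _ ux) _.
apply: Q0_trans (act_eq0 _ (act_unit _ ux) (act_unit _ ux) q) _.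
apply: Q0_trans (Q_sym (pow_add _ _ ux)) _; rewrite e'; exact: act_one.
Qed.

(** The powers of r act regularly on the points, and the exponents d j are all those that send x to l. A
priori the stabiliser could be large; the difference set excludes this by counting. *)
Lemma reg_sets : H = [set 0]%SET /\ forall a, a \in N -> exists j, (d j)%:R = a.
Proof.
have H0 : 0 \in H by rewrite -[0]/(0%:R) in_H expg0; exact: act_one.
have HD a b : a \in H -> b \in H -> a + b \in H.
  have [a' ->] := ZnP a; have [b' ->] := ZnP b; rewrite -natrD !in_H => qa qb.
  apply: Q0_trans (pow_add _ _ ux) _; apply: Q0_trans qa.
  by apply: act_eq0 => //; exact: act_unit.
have HB a b : a \in H -> b \in H -> a - b \in H.
  move=> Ha Hb; have -> : - b = b *+ n.-1.
    by apply/eqP; rewrite eq_sym -addr_eq0 -mulrSr prednK ?(ltnW n1) // -mulr_natr pchar_Zp // mulr0.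
  elim: n.-1 => [|m IHm]; first by rewrite mulr0n addr0.
  by rewrite mulrSr addrA HD.
have NH a h : a \in N -> h \in H -> a + h \in N.
  have [a' ->] := ZnP a; have [h' ->] := ZnP h; rewrite -natrD in_N in_H in_N => qa qh.
  apply: (Q0_r _ _ (pow_add _ _ ux)).2.
  by apply: (Q0_r _ _ (act_eq0 _ (act_unit _ ux) ux qh)).2.
have dN j : (d j)%:R \in N by rewrite in_N; exact: (corner_inc cor).
have plane a b t : t \notin H -> a \in N -> a + t \in N -> b \in N -> b + t \in N -> a - b \in H.
  have [a' ->] := ZnP a; have [b' ->] := ZnP b; have [t' ->] := ZnP t.
  rewrite -!natrD !in_N => nt qa qat qb qbt.
  have ub k := act_unit (r ^+ k)%g ux; have unl k := act_unit (r ^+ k)%g ul.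
  have onl k : Q 1 l (F (r ^+ (k + t'))%g x) -> Q 1 (F (r ^+ (n * t' - t'))%g l) (F (r ^+ k)%g x).
    move=> qk; have := act_Q (r ^+ (n * t' - t'))%g ul (ub _) qk.
    move/(Q0_r _ _ (Q_sym (pow_add _ _ ux))).
    rewrite (_ : (r ^+ (n * t' - t' + (k + t')) = r ^+ k)%g) //.
    apply: expg_period (corner_order cor) _.
    by rewrite addnCA subnK ?leq_pmull ?(ltnW n1) // mulnC addnC modnMDl.
  have ol' : Q 1 o (F (r ^+ (n * t' - t'))%g l).
    by apply: (Q0_l _ _ (pow_fix (n * t' - t'))).1; exact: act_Q.
  have [q|q] := two_points_one_line uo (ub a') (ub b') ol ol' (pow_point a') (pow_point b')
    qa qb (onl _ qat) (onl _ qbt).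
    case/negP: nt; apply/in_H; apply: fix_line_point.
    apply: Q0_trans (act_eq0 _ ul (unl _) q) _.
    apply: Q0_trans (Q_sym (pow_add _ _ ul)) _.
    rewrite addnC subnK ?leq_pmull ?(ltnW n1) // expgnA (corner_order cor) expg1n.
    exact: act_one.
  have -> : a'%:R - b'%:R = (a' + (n - 1) * b')%:R :> 'Z_n.
    rewrite natrD natrM natrB ?(ltnW n1) // pchar_Zp // sub0r mulN1r //.
  apply/in_H; apply: (@pow_cancel _ b').
  rewrite -addnA -mulSnr subn1 prednK ?(ltnW n1) // (_ : (r ^+ (a' + n * b') = r ^+ a')%g) //.
  by rewrite expgnDr expgnA (corner_order cor) expg1n mulg1.
have three : exists a b c, [/\ a \in N, b \in N & c \in N] /\
  [/\ a - b \notin H, b - c \notin H & a - c \notin H].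
  have [X [Y [Z [[uX uY uZ] [Xo Yo Zo] [lX lY lZ] [nXY nYZ nXZ]]]]] := three_points uo ol.
  have [a qa] := corner_points cor uX Xo; have [b qb] := corner_points cor uY Yo.
  have [c qc] := corner_points cor uZ Zo.
  exists a%:R, b%:R, c%:R; split; first by split; apply/in_N; rewrite (Q0_r _ _ qa, Q0_r _ _ qb, Q0_r _ _ qc).
  have D (u v : nat) U V : Q 0 (F (r ^+ u)%g x) U -> Q 0 (F (r ^+ v)%g x) V -> ~ Q 0 U V ->
      u%:R - v%:R \notin H.
    move=> qu qv nUV; apply/negP => Huv; apply: nUV.
    have [w ew] := ZnP (u%:R - v%:R); rewrite ew in Huv; move/in_H: Huv => Huv.
    apply: Q0_trans (Q_sym qu) _; apply: Q0_trans qv.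
    have -> : (r ^+ u = r ^+ (v + w))%g by apply: pow_mod; rewrite natrD -ew addrC subrK.
    apply: Q0_trans (pow_add _ _ ux) _.
    by apply: act_eq0 => //; exact: act_unit.
  split; [exact: D qa qb nXY | exact: D qb qc nYZ | exact: D qa qc nXZ].
have pd := corner_diff cor.
split; first exact: (stab_trivial H0 HB NH dN pd plane three).
by move=> a aN; exact: (difference_set_full H0 HB NH dN pd plane three aN).
Qed.

Lemma reg_point k : Q 0 (F (r ^+ k)%g x) x -> k%:R = 0 :> 'Z_n.
Proof. by move=> /in_H; case: reg_sets => -> _; rewrite inE => /eqP. Qed.

Lemma reg_inj a b : Q 0 (F (r ^+ a)%g x) (F (r ^+ b)%g x) -> a%:R = b%:R :> 'Z_n.
Proof.
move=> q; have /reg_point : Q 0 (F (r ^+ (a + (n - 1) * b))%g x) x.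
  apply: (@pow_cancel _ b); rewrite -addnA -mulSnr subn1 prednK ?(ltnW n1) //.
  by rewrite (_ : (r ^+ (a + n * b) = r ^+ a)%g) // expgnDr expgnA (corner_order cor) expg1n mulg1.
rewrite natrD natrM natrB ?(ltnW n1) // pchar_Zp // sub0r mulN1r => /eqP.
by rewrite subr_eq0 => /eqP.
Qed.

Lemma reg_inc k : Q 1 l (F (r ^+ k)%g x) -> exists j, (d j)%:R = k%:R :> 'Z_n.
Proof. by move/in_N; case: reg_sets => _; exact. Qed.

Lemma reg_line k : Q 0 (F (r ^+ k)%g l) l -> k%:R = 0 :> 'Z_n.
Proof. by move/fix_line_point; exact: reg_point. Qed.

Lemma reg_surj B : B \in unitmx -> Q 1 l B -> Q 1 B o -> exists j, Q 0 (F (r ^+ d j)%g x) B.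
Proof.
move=> uB lB Bo; have [k qk] := corner_points cor uB Bo.
have [_ sur] := reg_sets; have [|j ej] := sur k%:R.
  by apply/in_N; rewrite (Q0_r _ _ qk).
by exists j; rewrite (pow_mod ej).
Qed.

End Regular.
End Action.

(** * The rotation of the coordinate flag *)

Section Rot.
Variables (p : nat) (R : dvr p).
Local Notation pi := (p%:R : R).
Local Notation red := (@dvr_red p R).
Local Notation fr := (@dvr_frac p R).
Local Notation io := (map_mx fr).
Local Notation rotm2 := (rotm2 R).

Definition rotm : 'M[R]_3 := mx3 0 1 0 0 0 1 pi 0 0.

Lemma dv_rot : dv 1 rotm.
Proof. by exists 1; rewrite ?unitr1 // det3 !mxE /=; ring. Qed.
Lemma dv_rot2 : dv 2 rotm2.
Proof. by exists 1; rewrite ?unitr1 // det3 !mxE /=; ring. Qed.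
Lemma rotm_rotm2 : rotm *m rotm2 = pi%:M.
Proof. by apply: matrix3P; apply: (@all3 _); rewrite mulmx3 !mxE /=; ring. Qed.
Lemma rotm2_rotm : rotm2 *m rotm = pi%:M.
Proof. by apply: matrix3P; apply: (@all3 _); rewrite mulmx3 !mxE /=; ring. Qed.
Lemma rotm_rotm : rotm *m rotm = rotm2.
Proof. by apply: matrix3P; apply: (@all3 _); rewrite mulmx3 !mxE /=; ring. Qed.

Lemma rotm_mul (V : 'M[R]_3) j : [/\ (rotm *m V) o0 j = V o1 j, (rotm *m V) o1 j = V o2 j &
  (rotm *m V) o2 j = pi * V o0 j].
Proof. by split; rewrite mulmx3 !mxE /=; ring. Qed.
Lemma rotm2_mul (V : 'M[R]_3) j : [/\ (rotm2 *m V) o0 j = V o2 j, (rotm2 *m V) o1 j = pi * V o0 j &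
  (rotm2 *m V) o2 j = pi * V o1 j].
Proof. by split; rewrite mulmx3 !mxE /=; ring. Qed.

Lemma rot2_sub_rot (V : 'M[R]_3) : sub (rotm2 *m V) rotm <-> red (V o2 o0) = 0.
Proof.
split=> [[N /matrixP/(_ o0 o0)]|/redP [y ey]].
  have [-> _ _] := rotm2_mul V o0; rewrite mulmx3 !mxE /= => ->.
  by apply/redP; exists (N o0 o2); ring.
exists (mx3 (V o2 o1) (V o2 o2) y (pi * V o0 o1) (pi * V o0 o2) (V o0 o0)
            (pi * V o1 o1) (pi * V o1 o2) (V o1 o0)).
by apply: matrix3P; apply: (@all3 _); rewrite !mulmx3 !mxE /= ?ey; ring.
Qed.

Lemma rot_sub_rot (V : 'M[R]_3) : red (V o1 o0) = 0 -> red (V o2 o0) = 0 -> sub (rotm *m V) rotm.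
Proof.
move=> /redP [y ey] /redP [z ez].
exists (mx3 (V o1 o1) (V o1 o2) y (V o2 o1) (V o2 o2) z (pi * V o0 o1) (pi * V o0 o2) (V o0 o0)).
by apply: matrix3P; apply: (@all3 _); rewrite !mulmx3 !mxE /= ?ey ?ez; ring.
Qed.

Lemma rot2_sub_rot2 (V : 'M[R]_3) : red (V o2 o0) = 0 -> red (V o2 o1) = 0 -> sub (rotm2 *m V) rotm2.
Proof.
move=> /redP [y ey] /redP [z ez].
exists (mx3 (V o2 o2) y z (pi * V o0 o2) (V o0 o0) (V o0 o1) (pi * V o1 o2) (V o1 o0) (V o1 o1)).
by apply: matrix3P; apply: (@all3 _); rewrite !mulmx3 !mxE /= ?ey ?ez; ring.
Qed.

Lemma rot2_sub_rot2_self (V : 'M[R]_3) : sub (rotm2 *m V) rotm2 -> red (V o2 o1) = 0.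
Proof.
move=> [N /matrixP/(_ o0 o1)]; have [-> _ _] := rotm2_mul V o1; rewrite mulmx3 !mxE /= => ->.
by apply/redP; exists (N o0 o2); ring.
Qed.

Lemma pi_sub_rot k (w : 'M[R]_(k, 3)) : sub (pi *: w) rotm.
Proof. by exists (w *m rotm2); rewrite -mulmxA rotm2_rotm mul_mx_scalar. Qed.
Lemma pi_sub_rot2 k (w : 'M[R]_(k, 3)) : sub (pi *: w) rotm2.
Proof. by exists (w *m rotm); rewrite -mulmxA rotm_rotm2 mul_mx_scalar. Qed.

Lemma ball_mul n (N U : 'M[R]_3) : U \in unitmx -> sub (pi ^+ n)%:M N -> sub (pi ^+ n)%:M (N *m U).
Proof.
move=> uU [X eX]; exists (invmx U *m X); rewrite mulmxA -[_ *m X *m N]mulmxA -eX.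
by rewrite mul_mx_scalar -scalemxAl mulVmx // scalemx1.
Qed.

Lemma dv_mul_unit m (N U : 'M[R]_3) : U \in unitmx -> dv m N -> dv m (N *m U).
Proof. by move=> uU vN; rewrite -[m]addn0; apply: dv_mul => //; exact/dv0. Qed.

Lemma unit_expr (U : 'M[R]_3) k : U \in unitmx -> U ^+ k \in unitmx.
Proof. by move=> uU; have := @unitrX _ U k; rewrite -[_ \is a _]/(_ \in unitmx) => ->. Qed.

(** Comparing determinants, the power of p that is hidden in the factor c has exponent s. *)
Lemma scalar_descend s n c a (h E : 'M[R]_3) : (0 < n)%N -> dv (s * 3) h -> c != 0 ->
  a \is a GRing.unit -> c *: io h = io (a%:M + pi ^+ n *: E) ->
  exists b E', b \is a GRing.unit /\ h = pi ^+ s *: (b%:M + pi ^+ n *: E').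
Proof.
move=> n0 vh c0 ua e; have [k [l [u [uu eu]]]] := valP_K c0.
have e1 : io (pi ^+ l * u *: h) = io (pi ^+ k *: (a%:M + pi ^+ n *: E)).
  by rewrite map_mxZ -eu mulrC -scalerA e -map_mxZ.
have {}e1 := io_inj e1; have := congr1 determinant e1.
have vA : dv 0 (a%:M + pi ^+ n *: E).
  apply/dv0; rewrite unitmxE dvr_unit -det_map_mx (_ : map_mx red _ = (red a)%:M).
    by rewrite det_scalar expf_neq0 // -dvr_unit.
  apply/matrixP => i j; rewrite !mxE rmorphD rmorphM rmorphXn /= red_pi expr0n gtn_eqF // mul0r addr0.
  by rewrite rmorphMn.
have [v uv ev] := vh; have [w uw ew] := vA; rewrite !detZ ev ew => e2.
have : pi ^+ (l * 3 + s * 3) * (u ^+ 3 * v) = pi ^+ (k * 3) * w.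
  by rewrite exprD !exprM -exprM; move: e2; rewrite expr0 mul1r -!exprM exprMn -!exprM => <-; ring.
have uuv : u ^+ 3 * v \is a GRing.unit by rewrite unitrM unitrX.
move/(unit_pX uuv uw); rewrite -mulnDl => /eqP; rewrite eqn_mul2r /= => /eqP kE.
exists (a / u), (u^-1 *: E); split; first by rewrite unitrM ua unitrV.
have e3 : u *: h = pi ^+ s *: (a%:M + pi ^+ n *: E).
  apply/matrixP => i j; have /matrixP/(_ i j) := e1.
  by rewrite -kE exprD -!scalerA mxE [in RHS]mxE => /(mulfI (piX_neq0 R l)) ->.
have -> : h = u^-1 *: (u *: h) by rewrite scalerA mulVr // scale1r.
rewrite e3 scalerA mulrC -scalerA; congr (_ *: _).
by rewrite scalerDr scale_scalar_mx !scalerA [a / u]mulrC [pi ^+ n / u]mulrC.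
Qed.
End Rot.

(** * Matrices of one cyclic group *)

Section CornerLinear.
Variables (p : nat) (R : dvr p) (G : groupType).
Local Notation K := (dvr_field R).
Local Notation pi := (p%:R : R).
Local Notation red := (@dvr_red p R).
Local Notation fr := (@dvr_frac p R).
Local Notation io := (map_mx fr).
Local Notation rotm := (rotm R).
Local Notation rotm2 := (rotm2 R).
Variable F : G -> 'M[K]_3 -> 'M[K]_3.
Hypothesis actF : lattice_action F.

(** In the coordinates given by the rows of g, the map f is multiplication by U on the lattices between
that of g and its multiple by p^3. *)
Definition linear_at (g : 'M[K]_3) (f : 'M[K]_3 -> 'M[K]_3) (U : 'M[R]_3) : Prop :=
  forall m N, dv m N -> sub (pi ^+ 3)%:M N -> Q 0 (f (io N *m g)) (io (N *m U) *m g).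

Lemma linear_exists g r : g \in unitmx -> Q 0 (F r g) g ->
  exists2 M, M \in unitmx & forall k, linear_at g (F (r ^+ k)%g) (M ^+ k).
Proof.
move=> ug rg; have [qF _ _] := actF; have uig : invmx g \in unitmx by rewrite unitmx_inv.
pose f B := F r (B *m g) *m invmx g.
have qf : qmap f by apply: qmap_mul.
have f1 : Q 0 1%:M (f 1%:M).
  by apply: Q_sym; rewrite /f mul1mx -(Q_mulrE _ _ _ ug) mulmxKV // mul1mx.
have [M uM HM] := @ball_linear _ _ f 3 qf f1 isT; exists M => // k.
have lin1 m N : dv m N -> sub (pi ^+ 3)%:M N -> Q 0 (F r (io N *m g)) (io (N *m M) *m g).
  by move=> vN pN; have := Q_mulr g (HM m N vN pN); rewrite mulmxKV.
elim: k => [|k IHk] m N vN pN.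
  rewrite expg0 expr0 mulmx1; apply: (act_one actF).
  by rewrite unitmx_mul ug (dv_io vN).
have uMk := unit_expr k uM.
have uN : io N *m g \in unitmx by rewrite unitmx_mul ug (dv_io vN).
have uNk : io (N *m M ^+ k) *m g \in unitmx.
  by rewrite unitmx_mul ug (dv_io (dv_mul_unit uMk vN)).
rewrite expgS exprSr; apply: Q0_trans (act_mul actF _ _ uN) _.
apply: Q0_trans (act_eq0 actF r (act_unit actF _ uN) uNk (IHk m N vN pN)) _.
rewrite -[M ^+ k * M]/(M ^+ k *m M) mulmxA.
by apply: (lin1 m); [exact: dv_mul_unit | exact: ball_mul].
Qed.

Lemma linear_one g U : g \in unitmx -> U \in unitmx -> linear_at g (F 1%g) U ->
  exists b, red b != 0 /\ cg 3 U b%:M.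
Proof.
move=> ug uU lU.
have [m N vN pN|c [a [E [c0 ua e]]]] := @ball_scalar _ _ 3 (io U) isT.
  have uN : io N *m g \in unitmx by rewrite unitmx_mul ug (dv_io vN).
  have := Q0_trans (Q_sym (lU m N vN pN)) (act_one actF uN).
  by rewrite map_mxM Q_mulrE.
have [|b [E' [ub eU]]] := @scalar_descend _ _ 0 3 c a U E isT _ c0 ua e; first exact/dv0.
by exists b; split; [rewrite -dvr_unit | exists E'; rewrite eU scale1r].
Qed.

Section Corner.
Variables (J : finType) (n : nat) (o l x g : 'M[K]_3) (r : G) (d : J -> nat) (jb : J).
Hypotheses (n1 : (1 < n)%N) (cor : corner F n o l x r d jb) (ug : g \in unitmx)
  (og : Q 0 o g) (lg : Q 0 l (io rotm *m g)) (xg : Q 0 x (io rotm2 *m g)).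
Variable M : 'M[R]_3.
Hypotheses (uM : M \in unitmx) (linM : forall k, linear_at g (F (r ^+ k)%g) (M ^+ k)).

Let ux : x \in unitmx. Proof. by case: (corner_unit cor). Qed.
Let ul : l \in unitmx. Proof. by case: (corner_unit cor). Qed.
Let uo : o \in unitmx. Proof. by case: (corner_unit cor). Qed.
Let uMk k : M ^+ k \in unitmx := unit_expr k uM.

Lemma p3_rot : sub (pi ^+ 3)%:M rotm.
Proof. by rewrite -scalemx1 exprS -scalerA; exact: pi_sub_rot. Qed.
Lemma p3_rot2 : sub (pi ^+ 3)%:M rotm2.
Proof. by rewrite -scalemx1 exprS -scalerA; exact: pi_sub_rot2. Qed.

Lemma lin_x k : Q 0 (F (r ^+ k)%g x) (io (rotm2 *m M ^+ k) *m g).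
Proof.
have uI : io rotm2 *m g \in unitmx by rewrite unitmx_mul ug (dv_io (dv_rot2 R)).
exact: Q0_trans (act_eq0 actF _ ux uI xg) (linM k (dv_rot2 R) p3_rot2).
Qed.

Lemma lin_l k : Q 0 (F (r ^+ k)%g l) (io (rotm *m M ^+ k) *m g).
Proof.
have uI : io rotm *m g \in unitmx by rewrite unitmx_mul ug (dv_io (dv_rot R)).
exact: Q0_trans (act_eq0 actF _ ul uI lg) (linM k (dv_rot R) p3_rot).
Qed.

Lemma dv_rot2M k : dv 2 (rotm2 *m M ^+ k).
Proof. exact: dv_mul_unit (uMk k) (dv_rot2 R). Qed.
Lemma dv_rotM k : dv 1 (rotm *m M ^+ k).
Proof. exact: dv_mul_unit (uMk k) (dv_rot R). Qed.

Lemma lin_inc k : Q 1 l (F (r ^+ k)%g x) <-> red ((M ^+ k) o2 o0) = 0.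
Proof.
rewrite (Q0_l _ _ lg) (Q0_r _ _ (lin_x k)) Q_mulrE // -rot2_sub_rot; split=> [q|s].
  have [N eN] := Q_exact (dv_rot R) (dv_rot2M k) q.
  by exists N.
have [e de [N vN ->]] := sub_dv s (dv_rot2M k) (dv_rot R).
by rewrite map_mxM; apply: Q_io; rewrite (_ : 1%N = e) //; apply/eqP; rewrite -(eqn_add2r 1) -de.
Qed.

Lemma lin_fix_x k : red ((M ^+ k) o2 o0) = 0 -> red ((M ^+ k) o2 o1) = 0 ->
  Q 0 (F (r ^+ k)%g x) x.
Proof.
move=> h0 h1; apply: Q0_trans (lin_x k) _; apply: Q_sym; apply: Q0_trans xg _.
rewrite Q_mulrE //; apply: Q_sym; apply: sub_eqQ (dv_rot2M k) (dv_rot2 R).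
exact: rot2_sub_rot2.
Qed.

Lemma lin_fix_l k : red ((M ^+ k) o1 o0) = 0 -> red ((M ^+ k) o2 o0) = 0 ->
  Q 0 (F (r ^+ k)%g l) l.
Proof.
move=> h0 h1; apply: Q0_trans (lin_l k) _; apply: Q_sym; apply: Q0_trans lg _.
rewrite Q_mulrE //; apply: Q_sym; apply: sub_eqQ (dv_rotM k) (dv_rot R).
exact: rot_sub_rot.
Qed.

Definition fam j : 'M[R]_3 := M ^+ d j.

Lemma fam_deg j : red (fam j o2 o0) = 0.
Proof. by apply/lin_inc; exact: (corner_inc cor). Qed.

Lemma fam_comm j k : GRing.comm (fam j) (fam k).
Proof. by apply: commrX; apply/commr_sym/commrX. Qed.

Lemma fam_root j : exists2 mu, red mu != 0 & cg 2 (fam j ^+ n) mu%:M.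
Proof.
have : linear_at g (F 1%g) (M ^+ n) by have := linM n; rewrite (corner_order cor).
move=> /(linear_one ug (uMk n)) [b [b0 cb]]; exists (b ^+ d j).
  by rewrite rmorphXn /= expf_neq0.
rewrite /fam -exprM mulnC exprM (rmorphXn (@scalar_mx R 3)).
exact: (@cg_weak _ _ 3) (cg_exp _ cb).
Qed.

Lemma base_neq j : j != jb -> (d j)%:R != 0 :> 'Z_n.
Proof.
have [inj _ _] := corner_diff cor; move=> jjb; apply: contraNneq jjb => e.
by apply/eqP/inj; rewrite e (corner_base cor).
Qed.

Lemma fam_nz j : j != jb -> red (fam j o1 o0) != 0 /\ red (fam j o2 o1) != 0.
Proof.
move=> /base_neq dj; split; apply/eqP => h; case/eqP: dj.
  by apply: (reg_line actF n1 cor); apply: lin_fix_l => //; exact: fam_deg.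
by apply: (reg_point actF n1 cor); apply: lin_fix_x => //; exact: fam_deg.
Qed.

Lemma fam_base : red (fam jb o2 o1) = 0.
Proof.
have e : (r ^+ d jb)%g = 1%g.
  by rewrite (pow_mod n1 cor (b := 0)) ?expg0 // (corner_base cor).
have q := Q0_trans (Q_sym (lin_x (d jb))) _; rewrite e in q.
have {q} := q _ (Q0_trans (act_one actF ux) xg); rewrite Q_mulrE // => /Q_sym q.
have [|N eN] := Q_exact (dv_rot2 R) _ q; first by rewrite addn0; exact: dv_rot2M.
by apply: rot2_sub_rot2_self; exists N.
Qed.

Lemma fam_surj : opsurj jb fam.
Proof.
move=> j1 j1b t; have [_ a21] := fam_nz j1b.
have [t' et] := red_nat_surj R t; rewrite rmorph_nat in et.
pose v := row o2 (fam j1) + t'%:R *: e_ R o2.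
have v0 : red (v ord0 o0) = 0.
  by rewrite !mxE /= mulr0 addr0; exact: fam_deg.
have v1 : v ord0 o1 = fam j1 o2 o1 by rewrite !mxE /= mulr0 addr0.
have v2 : v ord0 o2 = fam j1 o2 o2 + t'%:R by rewrite !mxE /= mulr1.
have pv : prim v by exists o1; rewrite dvr_unit v1.
have vr : sub v rotm.
  have /redP [y ey] := v0; exists (\row_j nth 0 [:: v ord0 o1; v ord0 o2; y] j).
  by apply: matrix3P => i; rewrite (ord1 i) vmul3 ?ey !mxE /=; ring.
have Pr : sub (Pt 1 v) rotm.
  by apply: Pt_sub vr _; rewrite -scalemx1 expr1; exact: pi_sub_rot.
have uB : io (Pt 1 v) *m g \in unitmx by rewrite unitmx_mul ug (dv_io (dv_Pt 1 pv)).
have lB : Q 1 l (io (Pt 1 v) *m g).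
  rewrite (Q0_l _ _ lg) Q_mulrE //.
  have [e de [N vN ->]] := sub_dv Pr (dv_Pt 1 pv) (dv_rot R).
  by rewrite map_mxM; apply: Q_io; rewrite (_ : 1%N = e) //; apply/eqP; rewrite -(eqn_add2r 1) -de.
have Bo : Q 1 (io (Pt 1 v) *m g) o by rewrite (Q0_r _ _ og); exact: Pt_is_point.
have [j qj] := reg_surj actF n1 cor uB lB Bo.
have := Q0_trans (Q_sym qj) (lin_x (d j)); rewrite Q_mulrE // => q.
have [|N eN] := Q_exact (dv_Pt 1 pv) _ q; first by rewrite addn0; exact: dv_rot2M.
have [|a [y ey]] := @sub_Pt _ _ 1 v (row o2 (fam j)) pv.
  have -> : row o2 (fam j) = row o0 (rotm2 *m fam j).
    by apply/rowP => k; rewrite [LHS]mxE [RHS]mxE; have [-> _ _] := rotm2_mul (fam j) k.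
  by rewrite /fam eN; apply: sub_row; exists N.
have E k : red (fam j o2 k) = red a * red (v ord0 k).
  have /rowP/(_ k) := ey; rewrite mxE => ->.
  by rewrite !mxE rmorphD !rmorphM /= rmorphXn /= red_pi expr1 mul0r addr0.
exists j.
  apply/negP => /eqP jE; have := fam_base; rewrite -jE E v1 => /eqP.
  rewrite mulf_eq0 (negPf a21) orbF => /eqP a0.
  have [k] := prim_row o2 (uMk (d j)); rewrite mxE dvr_unit.
  by rewrite -/(fam j) E a0 mul0r eqxx.
by rewrite !E v1 v2 rmorphD /= rmorph_nat et; ring.
Qed.

(** The parameter of the image of the base point is a bijection from the indices other than jb to F_p.
Therefore the order of the plane underlying the difference set is p. *)
Lemma fam_card : (#|J| = p.+1)%N.
Proof.
have [j1 j1b] : exists j1, j1 != jb.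
  have [_ H _] := corner_diff cor.
  have [|j [k e]] := H 1; first exact: oner_neq0.
  have [jE|?] := eqVneq j jb; last by exists j.
  exists k; apply/eqP => kE; move: e; rewrite jE kE subrr => /esym/eqP.
  by rewrite oner_eq0.
have [_ a21] := fam_nz j1b.
pose f j : 'F_p := red (fam j o2 o2) * red (fam j1 o2 o1) / red (fam j o2 o1) - red (fam j1 o2 o2).
have fI : {in predC1 jb &, injective f}.
  move=> j k; rewrite !inE => jjb kjb e.
  have [_ j21] := fam_nz jjb; have [_ k21] := fam_nz kjb.
  have [inj _ _] := corner_diff cor; apply: inj; apply: (reg_inj actF n1 cor).
  apply: Q0_trans (lin_x (d j)) _; apply: Q_sym; apply: Q0_trans (lin_x (d k)) _.
  rewrite Q_mulrE //; apply: Q_sym; apply: sub_eqQ (dv_rot2M _) (dv_rot2M _).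
  have jk2 : red (fam j o2 o2) * red (fam k o2 o1) = red (fam k o2 o2) * red (fam j o2 o1).
    have {}e := addIr _ e; move/(congr1 (fun z => z * (red (fam j o2 o1) * red (fam k o2 o1)))): e.
    rewrite mulrA divfK // [red (fam j o2 o1) * _]mulrC mulrA divfK // => e.
    apply: (mulfI a21); transitivity (red (fam j o2 o2) * red (fam j1 o2 o1) * red (fam k o2 o1)).
      by ring.
    by rewrite e; ring.
  pose s := fam j o2 o1 / fam k o2 o1.
  have uk : fam k o2 o1 \is a GRing.unit by rewrite dvr_unit.
  have [z ez] : exists z, row o2 (fam j) - s *: row o2 (fam k) = pi *: z.
    have [z0 e0] : exists z, (row o2 (fam j) - s *: row o2 (fam k)) ord0 o0 = pi * z.
      by apply/redP; rewrite !mxE rmorphB rmorphM /= !fam_deg mulr0 subr0.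
    have [z2 e2] : exists z, (row o2 (fam j) - s *: row o2 (fam k)) ord0 o2 = pi * z.
      apply/redP; apply: (mulIf k21); rewrite mul0r -rmorphM !mxE mulrBl mulrAC divrK //.
      by rewrite rmorphB !rmorphM /= jk2 mulrC subrr.
    exists (\row_i nth 0 [:: z0; 0; z2] i); apply: matrix3P => i; rewrite (ord1 i).
    - by rewrite e0 !mxE.
    - by rewrite !mxE /= divrK // subrr mulr0.
    - by rewrite e2 !mxE.
  have pk (w : 'rV[R]_3) : sub (pi *: w) (rotm2 *m fam k).
    exists (w *m invmx (fam k) *m rotm); rewrite mulmxA -[_ *m rotm *m rotm2]mulmxA rotm_rotm2.
    by rewrite mul_mx_scalar -scalemxAl mulmxKV // uMk.
  apply: sub_rows; apply: (@all3 (fun i => sub (row i (rotm2 *m fam j)) (rotm2 *m fam k))).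
  - have R0 h : row o0 (rotm2 *m fam h) = row o2 (fam h).
      by apply/rowP => i; rewrite [LHS]mxE [RHS]mxE; have [-> _ _] := rotm2_mul (fam h) i.
    rewrite R0 -[row o2 (fam j)](subrK (s *: row o2 (fam k))) ez; apply: sub_add => //.
    by apply: sub_scale; rewrite -R0; apply: sub_row; exact: sub_self.
  - rewrite (_ : row _ _ = pi *: row o0 (fam j)) //.
    by apply/rowP => i; rewrite [LHS]mxE [RHS]mxE [X in _ = _ * X]mxE; have [_ -> _] := rotm2_mul (fam j) i.
  - rewrite (_ : row _ _ = pi *: row o1 (fam j)) //.
    by apply/rowP => i; rewrite [LHS]mxE [RHS]mxE [X in _ = _ * X]mxE; have [_ _ ->] := rotm2_mul (fam j) i.
have := card_in_imset fI; rewrite (_ : f @: predC1 jb = [set: 'F_p]%SET).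
  by rewrite finset.cardsT card_Fp ?(dvr_prime R) // cardC1 => ->; rewrite prednK //; apply/card_gt0P; exists jb.
apply/setP => t; rewrite inE; apply/imsetP.
have [j jjb ej] := fam_surj j1b t; exists j; first by rewrite inE.
have [_ j21] := fam_nz jjb.
by rewrite /f ej mulrAC divff // mul1r addrC addKr.
Qed.

Lemma fam_mult j : (map_mx red (fam j) ^+ (p ^ 2)) o2 o0 = 0 ->
  exists k, (d k)%:R = (p ^ 2 * d j)%:R :> 'Z_n.
Proof.
move=> e; have : Q 1 l (F (r ^+ (p ^ 2 * d j))%g x).
  apply/lin_inc; rewrite mulnC exprM -/(fam j).
  by move: e; rewrite -rmorphXn mxE.
exact: (reg_inc actF n1 cor).
Qed.

Lemma fam_opfam : n = (p ^ 2 + p + 1)%N -> opfam jb fam.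
Proof.
move=> en; split; [exact: fam_deg | exact: fam_comm | | exact: fam_nz].
by rewrite -en; exact: fam_root.
Qed.
End Corner.
End CornerLinear.

(** * Matrices of three cyclic groups *)

Section Triangle.
Variables (p : nat) (R : dvr p) (G : groupType).
Local Notation K := (dvr_field R).
Local Notation pi := (p%:R : R).
Local Notation red := (@dvr_red p R).
Local Notation fr := (@dvr_frac p R).
Local Notation io := (map_mx fr).
Local Notation rotm := (rotm R).
Local Notation rotm2 := (rotm2 R).
Variable F : G -> 'M[K]_3 -> 'M[K]_3.
Hypothesis actF : lattice_action F.

Definition coords (g x1 x2 x3 : 'M[K]_3) :=
  [/\ g \in unitmx, Q 0 x1 g, Q 0 x2 (io rotm *m g) & Q 0 x3 (io rotm2 *m g)].

Lemma Q_pi g : Q 0 g (io pi%:M *m g).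
Proof.
by rewrite map_scalar_mx mul_scalar_mx; apply: Q_scale; rewrite fr_eq0 pi_neq0.
Qed.

Lemma coords_rot g x1 x2 x3 : coords g x1 x2 x3 -> coords (io rotm *m g) x2 x3 x1.
Proof.
move=> [ug q1 q2 q3]; split=> //; first by rewrite unitmx_mul ug (dv_io (dv_rot R)).
  by rewrite mulmxA -map_mxM rotm_rotm.
by rewrite mulmxA -map_mxM rotm2_rotm; apply: Q0_trans q1 (Q_pi g).
Qed.

(** A basis adapted to a flag: the lattice of x2 is a line and that of x3 a point of the link of x1. *)
Lemma coords_exist x1 x2 x3 : x1 \in unitmx -> x2 \in unitmx -> x3 \in unitmx ->
  Q 1 x1 x2 -> Q 1 x2 x3 -> Q 1 x3 x1 -> exists g, coords g x1 x2 x3.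
Proof.
move=> u1 u2 u3 q12 q23 q31.
have [k uk ql] := line_form q12; have [v pv qx] := point_form u1 u3 q31.
have vk : sub v (Ln k).
  by apply/(incident_form u1 uk pv)/(Q0_l _ _ ql).1/(Q0_r _ _ qx).1.
have [c ec] := vk.
have {ec} ev : v = (pi * c ord0 o0) *: row o0 k + c ord0 o1 *: row o1 k + c ord0 o2 *: row o2 k.
  by rewrite ec /Ln mulmxA; apply: matrix3P => i; rewrite (ord1 i) !vmul3 !mxE /=; ring.
have kL i : sub (row i k) (Ln k) \/ i = o0.
  move: i; apply: (@all3 (fun i => sub (row i k) (Ln k) \/ i = o0)); [by right | left | left].
    by rewrite sub_Ln // -row_mul mulmxV // !mxE /= rmorph0.
  by rewrite sub_Ln // -row_mul mulmxV // !mxE /= rmorph0.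
have pL (w : 'rV[R]_3) : sub (pi *: w) (Ln k) by rewrite -[pi]expr1; apply: pX_sub (dv_Ln uk) _.
have pP (w : 'rV[R]_3) : sub (pi *: w) (Pt 1 v) by rewrite -[pi]expr1; apply: Pt_pn.
(* a basis adapted to the flag *)
have [b [w [ub bv wL]]] : exists b w, [/\ b \in unitmx, b = rows3 (row o0 k) w v & sub w (Ln k)].
  have D (w : 'rV[R]_3) : \det (rows3 (row o0 k) w v) \is a GRing.unit -> rows3 (row o0 k) w v \in unitmx.
    by rewrite unitmxE.
  have [c2|c2] := boolP (c ord0 o2 \is a GRing.unit).
    exists (rows3 (row o0 k) (row o1 k) v), (row o1 k); split=> //; last by case: (kL o1).
    apply: D; rewrite (_ : \det _ = c ord0 o2 * \det k); first by rewrite unitrM c2 -unitmxE.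
    by rewrite {1}ev !det3 !mxE /=; ring.
  have [c1|c1] := boolP (c ord0 o1 \is a GRing.unit).
    exists (rows3 (row o0 k) (row o2 k) v), (row o2 k); split=> //; last by case: (kL o2).
    apply: D; rewrite (_ : \det _ = - (c ord0 o1 * \det k)); first by rewrite unitrN unitrM c1 -unitmxE.
    by rewrite {1}ev !det3 !mxE /=; ring.
  have [i] := pv; rewrite dvr_unit ev !mxE !rmorphD !rmorphM /= red_pi !mul0r.
  move: c1 c2; rewrite !dvr_unit !negbK => /eqP -> /eqP ->.
  by rewrite !mul0r !addr0 eqxx.
have ubK : io b \in unitmx by apply: (dv_io (m := 0)); exact/dv0.
have rw i : row i b = nth v [:: row o0 k; w; v] i.
  by rewrite bv; move: i; apply: (@all3 _); rewrite (row_rows0, row_rows1, row_rows2).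
have be i j : b i j = (nth v [:: row o0 k; w; v] i) ord0 j by rewrite -rw mxE.
exists (io b *m x1); split.
- by rewrite unitmx_mul ubK.
- by apply: Q_io; exact/dv0.
- apply: Q0_trans ql _; rewrite mulmxA -map_mxM; apply: Q_mulr; apply: Q_sym.
  apply: sub_eqQ _ (dv_mul_unit ub (dv_rot R)) (dv_Ln uk).
  apply: sub_rows; apply: (@all3 (fun i => sub (row i (rotm *m b)) (Ln k))).
  + rewrite (_ : row _ _ = w) //; apply/rowP => j.
    by rewrite [LHS]mxE; have [-> _ _] := rotm_mul b j; rewrite be.
  + rewrite (_ : row _ _ = v) //; apply/rowP => j.
    by rewrite [LHS]mxE; have [_ -> _] := rotm_mul b j; rewrite be.
  + rewrite (_ : row _ _ = pi *: row o0 b) //; apply/rowP => j.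
    by rewrite [LHS]mxE [RHS]mxE [X in _ = _ * X]mxE; have [_ _ ->] := rotm_mul b j.
- apply: Q0_trans qx _; rewrite mulmxA -map_mxM; apply: Q_mulr; apply: Q_sym.
  apply: sub_eqQ _ (dv_mul_unit ub (dv_rot2 R)) (dv_Pt 1 pv).
  apply: sub_rows; apply: (@all3 (fun i => sub (row i (rotm2 *m b)) (Pt 1 v))).
  + rewrite (_ : row _ _ = v); first exact: Pt_v.
    apply/rowP => j.
    by rewrite [LHS]mxE; have [-> _ _] := rotm2_mul b j; rewrite be.
  + rewrite (_ : row _ _ = pi *: row o0 b) //; apply/rowP => j.
    by rewrite [LHS]mxE [RHS]mxE [X in _ = _ * X]mxE; have [_ -> _] := rotm2_mul b j.
  + rewrite (_ : row _ _ = pi *: row o1 b) //; apply/rowP => j.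
    by rewrite [LHS]mxE [RHS]mxE [X in _ = _ * X]mxE; have [_ _ ->] := rotm2_mul b j.
Qed.

(** Testing the product on the lattices N with p R^3 in N suffices by ball_scalar. Each change of
coordinates moves the lattice away from the base vertex by one step, which explains the radius 3 in
linear_at. The product carries a factor p^2, hence it is scalar modulo p^3. *)
Lemma linear_prod g ha hb hc (Ua Ub Uc : 'M[R]_3) : g \in unitmx ->
  Ua \in unitmx -> Ub \in unitmx -> Uc \in unitmx -> (hc * hb * ha = 1)%g ->
  linear_at g (F ha) Ua -> linear_at (io rotm *m g) (F hb) Ub ->
  linear_at (io rotm2 *m g) (F hc) Uc -> scalar3 (rotprod Ua Ub Uc).
Proof.
move=> ug ua ub uc h1 la lb lc.
have uio m (N : 'M[R]_3) : dv m N -> io N *m g \in unitmx.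
  by move=> vN; rewrite unitmx_mul ug (dv_io vN).
have rotK m N U : dv m N -> U \in unitmx -> dv (m + 2) (N *m U *m rotm2).
  by move=> vN uU; apply: dv_mul (dv_rot2 R); exact: dv_mul_unit.
have ballK n N U : U \in unitmx -> sub (pi ^+ n)%:M N -> sub (pi ^+ n.+1)%:M (N *m U *m rotm2).
  move=> uU /(ball_mul uU) [X eX]; exists (rotm *m X).
  by rewrite -[rotm *m X *m _]mulmxA [X *m _]mulmxA -eX mul_scalar_mx -scalemxAr rotm_rotm2
    scale_scalar_mx exprSr.
have ball3 n (N : 'M[R]_3) : (n <= 3)%N -> sub (pi ^+ n)%:M N -> sub (pi ^+ 3)%:M N.
  move=> n3 [X eX]; exists (pi ^+ (3 - n) *: X).
  by rewrite -scalemxAl -eX scale_scalar_mx -exprD subnK.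
have step (N U : 'M[R]_3) : Q 0 (io (N *m U) *m g) (io (N *m U *m rotm2) *m (io rotm *m g)).
  rewrite mulmxA -map_mxM -[N *m U *m rotm2 *m rotm]mulmxA rotm2_rotm mul_mx_scalar map_mxZ -scalemxAl.
  by apply: Q_scale; rewrite fr_eq0 pi_neq0.
have H m N : dv m N -> sub (pi ^+ 1)%:M N -> Q 0 (io N *m io (rotprod Ua Ub Uc)) (io N).
  move=> vN pN; rewrite -(Q_mulrE _ _ _ ug).
  have uN := uio _ _ vN.
  set N1 := N *m Ua *m rotm2; have vN1 : dv (m + 2) N1 := rotK _ _ _ vN ua.
  have pN1 : sub (pi ^+ 2)%:M N1 := ballK _ _ _ ua pN.
  set N2 := N1 *m Ub *m rotm2; have vN2 : dv (m + 2 + 2) N2 := rotK _ _ _ vN1 ub.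
  have pN2 : sub (pi ^+ 3)%:M N2 := ballK _ _ _ ub pN1.
  have u1 : io N1 *m (io rotm *m g) \in unitmx.
    by rewrite !unitmx_mul ug (dv_io vN1) (dv_io (dv_rot R)).
  have u1' : io (N1 *m Ub) *m (io rotm *m g) \in unitmx.
    by rewrite !unitmx_mul ug (dv_io (dv_mul_unit ub vN1)) (dv_io (dv_rot R)).
  have u2 : io N2 *m (io rotm2 *m g) \in unitmx.
    by rewrite !unitmx_mul ug (dv_io vN2) (dv_io (dv_rot2 R)).
  have qa : Q 0 (F ha (io N *m g)) (io N1 *m (io rotm *m g)).
    by apply: Q0_trans (la _ _ vN (ball3 _ _ _ pN)) _ => //; exact: step.
  have e2 : Q 0 (io (N1 *m Ub) *m (io rotm *m g)) (io N2 *m (io rotm2 *m g)).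
    have r22 : rotm2 *m rotm2 = pi *: rotm by rewrite -{2}rotm_rotm mulmxA rotm2_rotm mul_scalar_mx.
    rewrite /N2 !mulmxA -!map_mxM -!mulmxA r22 -!scalemxAr map_mxZ -scalemxAl.
    by apply: Q_scale; rewrite fr_eq0 pi_neq0.
  have qb : Q 0 (F hb (io N1 *m (io rotm *m g))) (io N2 *m (io rotm2 *m g)).
    by apply: Q0_trans (lb _ _ vN1 (ball3 _ _ _ pN1)) e2.
  have qc := lc _ _ vN2 pN2.
  have e3 : io (N2 *m Uc) *m (io rotm2 *m g) = io N *m io (rotprod Ua Ub Uc) *m g.
    by rewrite /N2 /N1 /rotprod mulmxA -!map_mxM !mulmxA.
  rewrite -e3; apply: Q0_trans (Q_sym qc) _.
  apply: Q0_trans _ (act_one actF uN); rewrite -h1.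
  apply: Q_sym; apply: Q0_trans (act_mul actF _ _ uN) _.
  apply: Q0_trans (act_mul actF _ _ (act_unit actF _ uN)) _.
  have uha := act_unit actF ha uN.
  apply: (act_eq0 actF) => //; first exact: act_unit.
  by apply: Q0_trans _ qb; apply: (act_eq0 actF).
have [c [a [E [c0 unA e]]]] := @ball_scalar _ _ 1 (io (rotprod Ua Ub Uc)) isT H.
have vP : dv (2 * 3) (rotprod Ua Ub Uc).
  by apply: (@dv_mul _ _ 4 2); [apply: (@dv_mul _ _ 2 2)|]; apply: (@dv_mul _ _ 0 2);
    rewrite ?dv0 //; exact: dv_rot2.
have [|b [E' [ub' ->]]] := scalar_descend _ vP c0 unA e; first by [].
exists (pi ^+ 2 * b), E'.
by rewrite scalerDr scale_scalar_mx scalerA -exprD.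
Qed.
Record triangle (J : finType) n (x1 x2 x3 : 'M[K]_3) (r1 r2 r3 : G) (d1 d2 d3 : J -> nat) (jb : J)
  : Prop := Triangle {
  tri1 : corner F n x1 x2 x3 r1 d1 jb;
  tri2 : corner F n x2 x3 x1 r2 d2 jb;
  tri3 : corner F n x3 x1 x2 r3 d3 jb;
  tri_rel : forall j, (r3 ^+ d3 j * r2 ^+ d2 j * r1 ^+ d1 j = 1)%g }.

(** The integer n is the number of points of a plane whose lines have #|J| points, and #|J| = p + 1. *)
Lemma corner_linear (J : finType) n (o l x g : 'M[K]_3) r (d : J -> nat) jb :
  (1 < n)%N -> n = (#|J|.-1 ^ 2 + #|J|.-1 + 1)%N -> corner F n o l x r d jb ->
  g \in unitmx -> Q 0 o g -> Q 0 l (io rotm *m g) -> Q 0 x (io rotm2 *m g) ->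
  n = (p ^ 2 + p + 1)%N /\ exists U : J -> 'M[R]_3,
    [/\ forall j, U j \in unitmx, forall j, linear_at g (F (r ^+ d j)%g) (U j), opfam jb U, opsurj jb U &
      forall j, (map_mx red (U j) ^+ (p ^ 2)) o2 o0 = 0 ->
        exists k, (d k)%:R = (p ^ 2 * d j)%:R :> 'Z_n].
Proof.
move=> n1 nJ cor ug og lg xg; have [uo ul ux] := corner_unit cor.
have fg : Q 0 (F r g) g.
  apply: (Q0_trans _ og); apply: Q0_trans (corner_fix cor).
  by apply: (act_eq0 actF) => //; exact: Q_sym og.
have [M uM linM] := linear_exists actF ug fg.
have cJ := fam_card actF n1 cor ug og lg xg uM linM.
have en : n = (p ^ 2 + p + 1)%N by rewrite nJ cJ /=.
split=> //; exists (fam d M); split.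
- by move=> j; exact: unit_expr.
- by move=> j; exact: linM.
- exact: (fam_opfam actF n1 cor ug lg xg uM linM en).
- exact: (fam_surj actF n1 cor ug og lg xg uM linM).
- by move=> j; exact: (fam_mult actF n1 cor ug lg xg uM linM).
Qed.

Lemma linear_at_eq (g g' : 'M[K]_3) f (U : 'M[R]_3) : (forall A B, A \in unitmx -> B \in unitmx -> Q 0 A B -> Q 0 (f A) (f B)) ->
  g \in unitmx -> (exists2 c, c != 0 & g' = c *: g) -> U \in unitmx -> linear_at g f U -> linear_at g' f U.
Proof.
move=> hf ug [c c0 ->] uU H m N vN pN; rewrite -!scalemxAr.
have uN : io N *m g \in unitmx by rewrite unitmx_mul ug (dv_io vN).
apply: Q0_trans (Q0_trans (H m N vN pN) (Q_scale _ c0)).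
by apply: hf => //; [rewrite unitmxZ // unitfE | exact: Q_sym (Q_scale _ c0)].
Qed.

Section TriangleLinear.
Variables (J : finType) (n : nat) (x1 x2 x3 : 'M[K]_3) (r1 r2 r3 : G) (d1 d2 d3 : J -> nat) (jb : J).
Hypotheses (n1 : (1 < n)%N) (nJ : n = (#|J|.-1 ^ 2 + #|J|.-1 + 1)%N)
  (tri : triangle n x1 x2 x3 r1 r2 r3 d1 d2 d3 jb).

Definition multiplier (d : J -> nat) j := exists k, (d k)%:R = (p ^ 2 * d j)%:R :> 'Z_n.

Lemma triangle_linear : n = (p ^ 2 + p + 1)%N /\ exists U V W : J -> 'M[R]_3,
  [/\ [/\ opfam jb U, opfam jb V & opfam jb W], [/\ opsurj jb U, opsurj jb V & opsurj jb W],
      rotfam U V W &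
      forall j, [/\ (map_mx red (U j) ^+ (p ^ 2)) o2 o0 = 0 -> multiplier d1 j,
                    (map_mx red (V j) ^+ (p ^ 2)) o2 o0 = 0 -> multiplier d2 j &
                    (map_mx red (W j) ^+ (p ^ 2)) o2 o0 = 0 -> multiplier d3 j]].
Proof.
have [c1 c2 c3 rel] := tri; have [u1 u2 u3] := corner_unit c1.
have [q12 q23 q31] := corner_flag c1.
have [g cg1] := coords_exist u1 u2 u3 q12 q23 q31.
have cg2 := coords_rot cg1; have cg3 := coords_rot cg2.
have [g1u g11 g12 g13] := cg1; have [g2u g21 g22 g23] := cg2; have [g3u g31 g32 g33] := cg3.
have [en [U [uU lU oU sU mU]]] := corner_linear n1 nJ c1 g1u g11 g12 g13.
have [_ [V [uV lV oV sV mV]]] := corner_linear n1 nJ c2 g2u g21 g22 g23.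
have [_ [W [uW lW oW sW mW]]] := corner_linear n1 nJ c3 g3u g31 g32 g33.
split=> //; exists U, V, W; split=> // j; last by split; [exact: mU | exact: mV | exact: mW].
have hf h A B : A \in unitmx -> B \in unitmx -> Q 0 A B -> Q 0 (F h A) (F h B).
  by move=> *; apply: (act_eq0 actF).
have pg (B : 'M[K]_3) : io rotm *m (io rotm2 *m B) = fr pi *: B.
  by rewrite mulmxA -map_mxM rotm_rotm2 map_scalar_mx mul_scalar_mx.
have pg2 (B : 'M[K]_3) : io rotm2 *m (io rotm *m B) = fr pi *: B.
  by rewrite mulmxA -map_mxM rotm2_rotm map_scalar_mx mul_scalar_mx.
have rr (B : 'M[K]_3) : io rotm *m (io rotm *m B) = io rotm2 *m B.
  by rewrite mulmxA -map_mxM rotm_rotm.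
have fpi : fr pi != 0 by rewrite fr_eq0 pi_neq0.
rewrite rr in lW.
have cyc (a b c : G) : (c * b * a = 1)%g -> (a * c * b = 1)%g.
  move=> e; have -> : (a * c * b = a * (c * b * a) * a^-1)%g by rewrite !mulgA mulgK.
  by rewrite e mulg1 mulgV.
split.
- exact: (linear_prod g1u (uU j) (uV j) (uW j) (rel j) (lU j) (lV j) (lW j)).
- apply: (linear_prod g2u (uV j) (uW j) (uU j) (cyc _ _ _ (rel j)) (lV j)).
    by rewrite rr; exact: lW.
  apply: linear_at_eq (hf _) g1u _ (uU j) (lU j).
  by exists (fr pi).
- have e := cyc _ _ _ (cyc _ _ _ (rel j)).
  apply: (linear_prod _ (uW j) (uU j) (uV j) e (lW j)).
  + by rewrite -rr.
  + apply: linear_at_eq (hf _) g1u _ (uU j) (lU j).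
    by exists (fr pi).
  + apply: linear_at_eq (hf _) g2u _ (uV j) (lV j).
    exists (fr pi) => //.
    by rewrite -[io rotm2 *m g]rr pg2.
Qed.
End TriangleLinear.
End Triangle.

(** * Multipliers of the difference set *)

Section Rebase.
Variables (p : nat) (R : dvr p) (G : groupType).
Local Notation K := (dvr_field R).
Variable F : G -> 'M[K]_3 -> 'M[K]_3.
Hypothesis actF : lattice_action F.
Variables (J : finType) (n : nat).
Hypothesis n1 : (1 < n)%N.

(** Subtraction of d j0 modulo n. *)
Definition shift (d : J -> nat) j0 j := (d j + (n - 1) * d j0)%N.

Lemma shiftE d j0 j : (shift d j0 j)%:R = (d j)%:R - (d j0)%:R :> 'Z_n.
Proof. by rewrite natrD natrM natrB ?(ltnW n1) // pchar_Zp // sub0r mulN1r. Qed.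

Lemma shift_diff d j0 : perfect_difference (fun j => (d j)%:R : 'Z_n) ->
  perfect_difference (fun j => (shift d j0 j)%:R : 'Z_n).
Proof.
have E j k : (shift d j0 j)%:R - (shift d j0 k)%:R = (d j)%:R - (d k)%:R :> 'Z_n.
  by rewrite !shiftE opprB addrA subrK.
move=> [dI dE dU]; split=> [j k e|r /dE [j [k <-]]|j k j' k' jk].
- by apply: dI; apply/eqP; rewrite -subr_eq0 -E e subrr.
- by exists j, k.
- by rewrite !E; exact: dU.
Qed.

Section Corner.
Variables (o l x : 'M[K]_3) (r : G) (d : J -> nat) (jb j0 : J).
Hypothesis cor : corner F n o l x r d jb.

Lemma pow_shift j : (r ^+ shift d j0 j = r ^+ d j * r ^+ ((n - 1) * d j0))%g.
Proof. by rewrite expgnDr. Qed.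

Lemma pow_inv (k : nat) : (r ^+ ((n - 1) * k) * r ^+ k = 1)%g.
Proof.
rewrite -expgnDr (pow_mod n1 cor (b := 0)) ?expg0 //.
by rewrite natrD natrM natrB ?(ltnW n1) // pchar_Zp // sub0r mulN1r addNr.
Qed.

Lemma corner_rebase_x : corner F n o l (F (r ^+ d j0)%g x) r (shift d j0) j0.
Proof.
case: (cor) => [[uo ul ux] [ol lx xo] fo rn cl cp cd cb ci]; split=> //.
- by split=> //; exact: (act_unit actF).
- by split=> //; exact: (pow_point actF cor).
- move=> B uB Bo; have [k qk] := cp B uB Bo; exists (k + (n - 1) * d j0)%N.
  apply: Q0_trans qk; apply: Q0_trans (Q_sym (pow_add actF _ _ _ ux)) _.
  by rewrite -addnA !expgnDr -expgnDr expgnDr pow_inv mulg1; apply: Q_refl.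
- exact: shift_diff.
- by rewrite shiftE subrr.
- move=> j; apply: (Q0_r _ _ (pow_add actF _ _ _ ux)).1.
  by rewrite expgnDr pow_shift -mulgA pow_inv mulg1.
Qed.

Lemma corner_rebase_l : corner F n o (F (r ^+ ((n - 1) * d j0))%g l) x r (shift d j0) j0.
Proof.
case: (cor) => [[uo ul ux] [ol lx xo] fo rn cl cp cd cb ci].
have uI := act_unit actF (r ^+ ((n - 1) * d j0))%g.
have inc j : Q 1 (F (r ^+ ((n - 1) * d j0))%g l) (F (r ^+ shift d j0 j)%g x).
  rewrite /shift addnC (Q0_r _ _ (pow_add actF _ _ _ ux)).
  by apply: (act_Q actF) => //; exact: (act_unit actF).
have b0 : (shift d j0 j0)%:R = 0 :> 'Z_n by rewrite shiftE subrr.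
split=> //.
- by split=> //; exact: uI.
- split=> //.
    by rewrite -(Q0_l _ _ (pow_fix actF cor ((n - 1) * d j0))); exact: (act_Q actF).
  have := inc j0; rewrite (pow_mod n1 cor (a := shift d j0 j0) (b := 0)) // expg0.
  by move/(Q0_r _ _ (act_one actF ux)).
- move=> B uB oB; have [k qk] := cl B uB oB; exists (k + d j0)%N.
  apply: Q0_trans qk; apply: Q0_trans (Q_sym (pow_add actF _ _ _ ul)) _.
  rewrite (pow_mod n1 cor (b := k)); first exact: Q_refl.
  rewrite !natrD natrM natrB ?(ltnW n1) // pchar_Zp // sub0r mulN1r.
  by rewrite addrK.
- exact: shift_diff.
Qed.

Lemma corner_conj s : corner F n (F s o) (F s l) (F s x) (s * r * s^-1)%g d jb.
Proof.
case: (cor) => [[uo ul ux] [ol lx xo] fo rn cl cp cd cb ci].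
have us B : B \in unitmx -> F s B \in unitmx := @act_unit _ _ _ _ actF s B.
have cX k : ((s * r * s^-1) ^+ k = s * r ^+ k * s^-1)%g.
  elim: k => [|k IHk]; first by rewrite !expg0 mulg1 mulgV.
  by rewrite !expgS IHk !mulgA mulgVK.
have cF k B : B \in unitmx -> Q 0 (F ((s * r * s^-1) ^+ k)%g (F s B)) (F s (F (r ^+ k)%g B)).
  move=> uB; apply: Q0_trans (Q_sym (act_mul actF _ _ uB)) _.
  by rewrite cX mulgVK; exact: act_mul.
have sV B : B \in unitmx -> Q 0 (F s (F (s^-1)%g B)) B.
  move=> uB; apply: Q0_trans (Q_sym (act_mul actF _ _ uB)) _; rewrite mulgV; exact: act_one.
have Vs B : B \in unitmx -> Q 0 (F (s^-1)%g (F s B)) B.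
  move=> uB; apply: Q0_trans (Q_sym (act_mul actF _ _ uB)) _; rewrite mulVg; exact: act_one.
have uV B : B \in unitmx -> F (s^-1)%g B \in unitmx := @act_unit _ _ _ _ actF s^-1%g B.
split=> //.
- by split; exact: us.
- by split; apply: (act_Q actF).
- by have := cF 1%N o uo; rewrite !expg1 => q; apply: Q0_trans q _; apply: (act_eq0 actF) => //; exact: (act_unit actF).
- by rewrite cX rn mulg1 mulgV.
- move=> B uB oB; have [k qk] := cl _ (uV _ uB) ((Q0_l _ _ (Vs _ uo)).1 (act_Q actF s^-1%g (us _ uo) uB oB)).
  exists k; apply: Q0_trans (cF _ _ ul) _; apply: Q0_trans (sV _ uB).
  by apply: (act_eq0 actF) => //; [exact: (act_unit actF) | exact: uV].
- move=> B uB oB; have [k qk] := cp _ (uV _ uB) ((Q0_r _ _ (Vs _ uo)).1 (act_Q actF s^-1%g uB (us _ uo) oB)).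
  exists k; apply: Q0_trans (cF _ _ ux) _; apply: Q0_trans (sV _ uB).
  by apply: (act_eq0 actF) => //; [exact: (act_unit actF) | exact: uV].
- move=> j; apply: (Q0_r _ _ (cF _ _ ux)).2.
  by apply: (act_Q actF) => //; exact: (act_unit actF).
Qed.

Lemma corner_eq o' l' x' : [/\ o' \in unitmx, l' \in unitmx & x' \in unitmx] ->
  Q 0 o o' -> Q 0 l l' -> Q 0 x x' -> corner F n o' l' x' r d jb.
Proof.
case: (cor) => [[uo ul ux] [ol lx xo] fo rn cl cp cd cb ci] [uo' ul' ux'] qo ql qx; split=> //.
- split; apply: (Q0_l _ _ _).1; [exact: qo|exact: (Q0_r _ _ ql).1|exact: ql|exact: (Q0_r _ _ qx).1|
    exact: qx|exact: (Q0_r _ _ qo).1].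
- by apply: (Q0_trans _ qo); apply: Q0_trans fo; apply: (act_eq0 actF) => //; exact: Q_sym qo.
- move=> B uB oB; have [k qk] := cl B uB ((Q0_l _ _ qo).2 oB); exists k.
  by apply: Q0_trans qk; apply: (act_eq0 actF) => //; exact: Q_sym ql.
- move=> B uB oB; have [k qk] := cp B uB ((Q0_r _ _ qo).2 oB); exists k.
  by apply: Q0_trans qk; apply: (act_eq0 actF) => //; exact: Q_sym qx.
- move=> j; apply: (Q0_l _ _ ql).1; apply: (Q0_r _ _ _).1 (ci j).
  exact: (act_eq0 actF).
Qed.
End Corner.

(** Any index can serve as the base. The third vertex is moved by r1^(d1 j0) and r3 is conjugated by this
element. By the relation for j0, the moved vertex is also the image of x3 under the inverse of
r2^(d2 j0), so that the exponents shift in the same way at the three vertices. *)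
Lemma triangle_rebase x1 x2 x3 r1 r2 r3 d1 d2 d3 jb j0 :
  triangle F n x1 x2 x3 r1 r2 r3 d1 d2 d3 jb ->
  exists x3' r3', triangle F n x1 x2 x3' r1 r2 r3' (shift d1 j0) (shift d2 j0) (shift d3 j0) j0.
Proof.
case=> [c1 c2 c3 rel]; have [u1 u2 u3] := corner_unit c1.
set b1 := (r1 ^+ d1 j0)%g; set b2 := (r2 ^+ d2 j0)%g; set b3 := (r3 ^+ d3 j0)%g.
have b321 : (b3 * b2 * b1 = 1)%g := rel j0.
have V1 := pow_inv c1 (d1 j0); have V2 := pow_inv c2 (d2 j0); have V3 := pow_inv c3 (d3 j0).
rewrite -/b1 -/b2 -/b3 in V1 V2 V3.
set v1 := (r1 ^+ ((n - 1) * d1 j0))%g in V1.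
set v2 := (r2 ^+ ((n - 1) * d2 j0))%g in V2.
set v3 := (r3 ^+ ((n - 1) * d3 j0))%g in V3.
have e1 : v1 = (b1^-1)%g by rewrite -[v1](mulgK b1) V1 mul1g.
have e2 : v2 = (b2^-1)%g by rewrite -[v2](mulgK b2) V2 mul1g.
have e3 : v3 = (b3^-1)%g by rewrite -[v3](mulgK b3) V3 mul1g.
have b13 : (b1 * b3 = b2^-1)%g.
  have -> : (b1 * b3 = b1 * (b3 * b2 * b1) * b1^-1 * b2^-1)%g by rewrite !mulgA !mulgK.
  by rewrite b321 mulg1 mulgV mul1g.
have q3 : Q 0 (F v2 x3) (F b1 x3).
  rewrite e2 -b13; apply: Q0_trans (act_mul actF _ _ u3) _.
  by apply: (act_eq0 actF) => //; [exact: (act_unit actF) | exact: (pow_fix actF c3)].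
exists (F b1 x3), (b1 * r3 * b1^-1)%g; split.
- exact: (corner_rebase_x j0 c1).
- refine (corner_eq (corner_rebase_l j0 c2) _ _ q3 _); [|exact: Q_refl|exact: Q_refl].
  by split=> //; exact: (act_unit actF).
- refine (corner_eq (corner_conj (corner_rebase_x j0 c3) b1) _ _ _ _).
  + by split=> //; exact: (act_unit actF).
  + exact: Q_refl.
  + exact: (pow_fix actF c1).
  + rewrite -/b3; apply: Q0_trans (Q_sym (act_mul actF _ _ u2)) _; rewrite b13 -e2.
    exact: (pow_fix actF c2).
- move=> j.
  have cX k : ((b1 * r3 * b1^-1) ^+ k = b1 * r3 ^+ k * b1^-1)%g.
    elim: k => [|k IHk]; first by rewrite !expg0 mulg1 mulgV.
    by rewrite !expgS IHk !mulgA mulgVK.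
  rewrite cX !expgnDr -/v1 -/v3 -/v2.
  have -> : (r2 ^+ d2 j * v2 = v2 * r2 ^+ d2 j)%g by rewrite -!expgnDr addnC.
  have -> : (b1 * (r3 ^+ d3 j * v3) * b1^-1 * (v2 * r2 ^+ d2 j) * (r1 ^+ d1 j * v1) =
     b1 * r3 ^+ d3 j * (v3 * b1^-1 * v2) * r2 ^+ d2 j * r1 ^+ d1 j * v1)%g by rewrite !mulgA.
  have -> : (v3 * b1^-1 * v2 = 1)%g by rewrite e2 -b13 e3 !mulgA mulgVK mulVg.
  rewrite mulg1 e1.
  have := rel j => /(congr1 (fun z => b1 * z * b1^-1)%g); rewrite mulg1 mulgV => <-.
  by rewrite !mulgA.
Qed.

(** For p > 2, multiplication by p^2 maps the difference set to itself and, by triangle_rebase, so do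
its conjugates by the translations which bring an element d to 0. As p^2 (d' - d) is a difference in
only one way, p^2 d = d for every d. Together with n = p^2 + p + 1 this gives 3 d = 0, hence 3 = 0 since 1 is
a difference. For p = 2 and n = 7, if d and 4 d both belong to the difference set, then d - 4 d = 4 d - 0
is a repeated difference. *)
Lemma triangle_false x1 x2 x3 r1 r2 r3 (d1 d2 d3 : J -> nat) jb :
  n = (#|J|.-1 ^ 2 + #|J|.-1 + 1)%N -> triangle F n x1 x2 x3 r1 r2 r3 d1 d2 d3 jb -> False.
Proof.
move=> nJ tri; have [en _] := triangle_linear actF n1 nJ tri.
have pp := dvr_prime R; have p1 := prime_gt1 pp.
have pd := corner_diff (tri1 tri); have [dI dE dU] := pd.
have [j1 j1b] : exists j1, j1 != jb.
  have [|j [k e]] := dE 1; first exact: oner_neq0.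
  have [jE|?] := eqVneq j jb; last by exists j.
  exists k; apply/eqP => kE; move: e; rewrite jE kE subrr => /esym/eqP.
  by rewrite oner_eq0.
have [p2|p2] := ltnP 2 p; last first.
  have {p1 p2} pE : p = 2 by apply/eqP; rewrite eqn_leq p2 p1.
  have [_ [U [V [W [[oU oV oW] [sU sV sW] rot H]]]]] := triangle_linear actF n1 nJ tri.
  have absurd r o l x (d : J -> nat) : corner F n o l x r d jb -> multiplier p n d j1 -> False.
    move=> c [k]; have [cI _ cU] := corner_diff c; have cb := corner_base c.
    rewrite pE natrM => e.
    have n0 : 7%:R = 0 :> 'Z_n by rewrite -(pchar_Zp n1) en pE.
    have e' : (d j1)%:R - (d k)%:R = (d k)%:R - (d jb)%:R :> 'Z_n.
      rewrite cb subr0 e.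
      rewrite -[LHS]addr0 -[X in _ + X](mul0r (d j1)%:R) -n0; ring.
    have jk : j1 <> k.
      move=> jk; move: e; rewrite -jk => e.
      have : (d j1)%:R = (d jb)%:R :> 'Z_n; last by move/cI => /eqP; rewrite (negPf j1b).
      rewrite cb; transitivity (7%:R * (d j1)%:R - 2%:R * ((2 ^ 2)%:R * (d j1)%:R - (d j1)%:R) : 'Z_n).
        by ring.
      by rewrite n0 -e subrr mulr0 mul0r subr0.
    by have [j1k _] := cU _ _ _ _ jk e'; exact: jk.
  have [HU HV HW] := H j1.
  apply: (carry_even pE oU oV oW rot sU sV sW j1b); apply/eqP.
  - by move/HU; exact: absurd (tri1 tri).
  - by move/HV; exact: absurd (tri2 tri).
  - by move/HW; exact: absurd (tri3 tri).
have mul y1 y2 y3 s1 s2 s3 (f1 f2 f3 : J -> nat) jc : triangle F n y1 y2 y3 s1 s2 s3 f1 f2 f3 jc ->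
    forall j, multiplier p n f1 j.
  move=> t j; have [_ [U [V [W [[oU oV oW] [sU sV sW] rot H]]]]] := triangle_linear actF n1 nJ t.
  have [HU _ _] := H j; have [->|jc'] := eqVneq j jc.
    by exists jc; rewrite natrM (corner_base (tri1 t)) mulr0.
  by apply: HU; exact: (carry_vanishes p2 oU oV oW rot sU jc').
have n0 : p%:R ^+ 2 + p%:R + 1 = 0 :> 'Z_n.
  have <- : n%:R = p%:R ^+ 2 + p%:R + 1 :> 'Z_n by rewrite -natrX -natrD -(natrD _ _ 1) -en.
  exact: pchar_Zp.
(* p is a cube root of unity modulo n, so p^2 is invertible *)
have p3 : p%:R * (p ^ 2)%:R = 1 :> 'Z_n.
  by rewrite natrX; transitivity ((p%:R - 1) * (p%:R ^+ 2 + p%:R + 1) + 1 : 'Z_n); [ring | rewrite n0 mulr0 add0r].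
have fixd j0 : (p ^ 2)%:R * (d1 j0)%:R = (d1 j0)%:R :> 'Z_n.
  have [j jj0] : exists j, j != j0.
    by have [->|] := eqVneq j0 jb; [exists j1 | exists jb; rewrite eq_sym].
  have [y3 [s3 t0]] := triangle_rebase j0 tri.
  have [k ek] := mul _ _ _ _ _ _ _ _ _ _ t0 j.
  have [k0 e0] := mul _ _ _ _ _ _ _ _ _ _ tri j0.
  have [k1 e1] := mul _ _ _ _ _ _ _ _ _ _ tri j.
  move: ek; rewrite natrM !shiftE mulrBr -!natrM -e0 -e1 => ek.
  have kk : k1 <> k0.
    move=> kk; case/eqP: jj0; apply: dI.
    have : (p ^ 2 * d1 j)%:R = (p ^ 2 * d1 j0)%:R :> 'Z_n by rewrite -e0 -e1 kk.
    rewrite natrM [in RHS]natrM => h.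
    have := erefl (p%:R * ((p ^ 2)%:R * (d1 j)%:R) : 'Z_n); rewrite {2}h.
    by rewrite !mulrA p3 !mul1r.
  by have [_ <-] := dU _ _ _ _ kk (esym ek); rewrite e0 natrM.
(* (p^2 - 1) (p - 1) = (p^2 + p + 1) (p - 2) + 3 *)
have three : 3%:R = 0 :> 'Z_n.
  have [|j [k e]] := dE 1; first exact: oner_neq0.
  have H i : 3%:R * (d1 i)%:R = 0 :> 'Z_n.
    have := fixd i; rewrite natrX => e1.
    transitivity (((p%:R ^+ 2 * (d1 i)%:R) - (d1 i)%:R) * (p%:R - 1)
       - (p%:R ^+ 2 + p%:R + 1) * (d1 i)%:R * (p%:R - 2%:R) : 'Z_n); first by ring.
    by rewrite n0 e1 subrr !mul0r subr0.
  transitivity (3%:R * ((d1 j)%:R - (d1 k)%:R) : 'Z_n); first by rewrite e mulr1.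
  by rewrite mulrBr !H subrr.
have := val_Zp_nat n1 3; rewrite three modn_small // en.
by move: p2; case: (p) => [|[|[|q]]] // _; rewrite !expnS; lia.
Qed.
End Rebase.

(** * Lattice classes labelled by cosets *)

Section Types.
Variables (p : nat) (R : dvr p).
Local Notation K := (dvr_field R).
Local Notation pi := (p%:R : R).
Local Notation fr := (@dvr_frac p R).
Local Notation io := (map_mx fr).

(** The valuation of the determinant modulo 3 is an invariant of homothety classes, the type of a vertex. *)
Lemma Q_mod3 m k (A B : 'M[K]_3) : A \in unitmx -> B \in unitmx ->
  Q m A B -> Q k A B -> (m = k %[mod 3])%N.
Proof.
move=> uA uB [c [N [c0 [u uu Nu] e]]] [d [N' [d0 [v uv Nv] e']]].
have D (x : K) (M : 'M[R]_3) : x *: B = io M *m A -> x ^+ 3 * \det B = fr (\det M) * \det A.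
  by move=> h; rewrite -detZ h det_mulmx det_map_mx.
have {e}e := D _ _ e; have {e'}e' := D _ _ e'.
have A0 : \det A != 0 by rewrite -unitfE -unitmxE.
have B0 : \det B != 0 by rewrite -unitfE -unitmxE.
have {e'}e : c ^+ 3 * fr (\det N') = d ^+ 3 * fr (\det N).
  apply: (mulIf (mulf_neq0 A0 B0)).
  transitivity (c ^+ 3 * \det B * (fr (\det N') * \det A)); first by ring.
  by rewrite -e' e; ring.
have [k1 [l1 [x [ux cx]]]] := valP_K c0; have [k2 [l2 [y [uy dy]]]] := valP_K d0.
have : fr ((pi ^+ l1 * x * pi ^+ k2) ^+ 3 * \det N') = fr ((pi ^+ l2 * y * pi ^+ k1) ^+ 3 * \det N).
  rewrite rmorphM [RHS]rmorphM !rmorphXn /= rmorphM [in RHS]rmorphM /= -cx -dy.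
  transitivity ((fr (pi ^+ k1) * fr (pi ^+ k2)) ^+ 3 * (c ^+ 3 * fr (\det N'))); first by ring.
  by rewrite e; ring.
move=> /(@dvr_frac_inj p R); rewrite Nu Nv => {}e.
have : pi ^+ ((l1 + k2) * 3 + k) * (x ^+ 3 * v) = pi ^+ ((l2 + k1) * 3 + m) * (y ^+ 3 * u).
  rewrite !exprD !exprM !exprD; transitivity ((pi ^+ l1 * x * pi ^+ k2) ^+ 3 * (pi ^+ k * v)); first by ring.
  by rewrite e; ring.
have uxv : x ^+ 3 * v \is a GRing.unit by rewrite unitrM uv unitrX.
have uyu : y ^+ 3 * u \is a GRing.unit by rewrite unitrM uu unitrX.
by move=> /(unit_pX uxv uyu) /(congr1 (modn^~ 3)); rewrite !modnMDl => ->.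
Qed.
End Types.

Section Labelling.
Variables (p : nat) (R : dvr p) (G : groupType) (s : 'I_3 -> G).
Local Notation K := (dvr_field R).
Variable mv : G -> 'I_3 -> 'M[K]_3.

(** The matrix mv g a represents the vertex labelled by the coset of g modulo the powers of s a. *)
Record labelling : Prop := Labelling {
  lab_unit : forall g a, mv g a \in unitmx;
  lab_coset : forall g a, Q 0 (mv (g * s a)%g a) (mv g a);
  lab_inj : forall g h a b, Q 0 (mv g a) (mv h b) -> a = b /\ exists i, (h = g * s a ^+ i)%g;
  lab_surj : forall B, B \in unitmx -> exists g a, Q 0 (mv g a) B;
  lab_adj : forall g a b, a != b -> Q 1 (mv g a) (mv g b) \/ Q 1 (mv g b) (mv g a);
  lab_chamber : forall g h a b, Q 1 (mv g a) (mv h b) ->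
    a != b /\ exists k, Q 0 (mv g a) (mv k a) /\ Q 0 (mv h b) (mv k b) }.

Hypothesis lab : labelling.
Let um := lab_unit lab.

Lemma lab_pow g a i : Q 0 (mv (g * s a ^+ i)%g a) (mv g a).
Proof.
elim: i => [|i IHi]; first by rewrite expg0 mulg1; exact: Q_refl.
by rewrite expgSr mulgA; apply: Q0_trans IHi; exact: lab_coset.
Qed.

Lemma no_loop (A B : 'M[K]_3) : A \in unitmx -> B \in unitmx -> Q 1 A B -> Q 1 B A -> False.
Proof.
move=> uA uB qAB qBA.
by have := Q_mod3 uA uA (Q_comp qAB qBA) (Q_refl A).
Qed.

Lemma no_chord (A B C : 'M[K]_3) : A \in unitmx -> C \in unitmx ->
  Q 1 A B -> Q 1 B C -> Q 1 A C -> False.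
Proof. by move=> uA uC qAB qBC qAC; have := Q_mod3 uA uC (Q_comp qAB qBC) qAC. Qed.

Definition oriented (nx : 'I_3 -> 'I_3) g := forall a, Q 1 (mv g a) (mv g (nx a)).

Let suc (a : 'I_3) : 'I_3 := a + 1.
Let pre (a : 'I_3) : 'I_3 := a - 1.

(** In a triangle the directions of the edges form a cycle, by Q_mod3. *)
Lemma orient3 (A B C : 'M[K]_3) : A \in unitmx -> B \in unitmx -> C \in unitmx ->
  Q 1 A B -> Q 1 B C \/ Q 1 C B -> Q 1 A C \/ Q 1 C A -> Q 1 B C /\ Q 1 C A.
Proof.
move=> uA uB uC AB [BC|CB] [AC|CA]; [|by []| |].
- by case: (no_chord uA uC AB BC AC).
- by case: (no_chord uA uB AC CB AB).
- by case: (no_chord uC uB CA AB CB).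
Qed.

Lemma oriented_dec g : oriented suc g \/ oriented pre g.
Proof.
have adj a b := @lab_adj lab g a b.
have adjC a b : a != b -> Q 1 (mv g b) (mv g a) \/ Q 1 (mv g a) (mv g b).
  by move/adj; case; [right | left].
have H nx a : nx a != a -> nx (nx a) != nx a -> nx (nx a) != a -> Q 1 (mv g a) (mv g (nx a)) ->
    Q 1 (mv g (nx a)) (mv g (nx (nx a))) /\ Q 1 (mv g (nx (nx a))) (mv g a).
  by move=> h1 h2 h3 q; apply: (orient3 (um _ _) (um _ _) (um _ _) q); apply: adjC.
have [s0 s1 s2] : [/\ suc o0 = o1, suc o1 = o2 & suc o2 = o0] by split; apply/val_inj.
have [p0 p1 p2] : [/\ pre o0 = o2, pre o1 = o0 & pre o2 = o1] by split; apply/val_inj.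
have [] := @adj o0 o1 isT => q; [left | right].
  have [] := @H suc o0; rewrite ?s0 ?s1 // => q1 q2.
  by apply: (@all3 (fun a => Q 1 (mv g a) (mv g (suc a)))); rewrite ?s0 ?s1 ?s2.
have [] := @H pre o1; rewrite ?p1 ?p0 // => q1 q2.
by apply: (@all3 (fun a => Q 1 (mv g a) (mv g (pre a)))); rewrite ?p0 ?p1 ?p2.
Qed.

Lemma step_cycle nx : nx = suc \/ nx = pre ->
  forall a, [/\ nx a != a, nx (nx a) != a, nx (nx (nx a)) = a &
    forall b, [\/ b = a, b = nx a | b = nx (nx a)]].
Proof.
case=> -> a; split; try by case: a => [[|[|[|//]]] ?]; rewrite -?val_eqE //; apply: val_inj.
- by move=> b; case: a b => [[|[|[|//]]] ?] [[|[|[|//]]] ?];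
    do [by constructor 1; exact: val_inj | by constructor 2; exact: val_inj | by constructor 3; exact: val_inj].
- by move=> b; case: a b => [[|[|[|//]]] ?] [[|[|[|//]]] ?];
    do [by constructor 1; exact: val_inj | by constructor 2; exact: val_inj | by constructor 3; exact: val_inj].
Qed.

(** Two lines of a link meet in a point. If the lines had the types suc a and pre a, this point would
have a fourth type. *)
Lemma no_flip a (o : 'M[K]_3) g h : Q 0 o (mv g a) -> o \in unitmx ->
  Q 1 o (mv g (suc a)) -> Q 1 o (mv h (pre a)) -> False.
Proof.
move=> qo uo q1 q2; have [X [uX lX l'X Xo]] := lines_meet uo q1 q2.
have [k [c qc]] := lab_surj lab uX.
have [c1 _] := lab_chamber lab ((Q0_r _ _ qc).2 lX).
have [c2 _] := lab_chamber lab ((Q0_r _ _ qc).2 l'X).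
have [c3 _] := lab_chamber lab ((Q0_r _ _ qo).1 ((Q0_l _ _ qc).2 Xo)).
move: c1 c2 c3; clear; rewrite -!val_eqE.
by case: a c => [[|[|[|//]]] ?] [[|[|[|//]]] ?].
Qed.

Lemma oriented_suc_step g a : oriented suc g -> oriented suc (g * s a)%g.
Proof.
move=> og; have [//|og'] := oriented_dec (g * s a)%g.
have q2 := (Q0_l _ _ (lab_coset lab g a)).1 (og' a).
by case: (no_flip (Q_refl _) (um g a) (og a) q2).
Qed.

Lemma oriented_pre_step g a : oriented pre g -> oriented pre (g * s a)%g.
Proof.
move=> og; have [og'|//] := oriented_dec (g * s a)%g.
have q1 := (Q0_l _ _ (lab_coset lab g a)).1 (og' a).
by case: (no_flip (Q_sym (lab_coset lab g a)) (um g a) q1 (og a)).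
Qed.

Hypothesis gen : forall P : G -> Prop, P 1%g -> (forall g a, P g -> P (g * s a)%g) -> forall g, P g.

(** The direction of the edges of the base chamber propagates to all chambers, which are connected
through panels. *)
Lemma coherent : exists2 nx, nx = suc \/ nx = pre & forall g, oriented nx g.
Proof.
have [o|o] := oriented_dec 1%g; [exists suc; first by left | exists pre; first by right].
  by apply: gen => // g a; exact: oriented_suc_step.
by apply: gen => // g a; exact: oriented_pre_step.
Qed.

Section Oriented.
Variable nx : 'I_3 -> 'I_3.
Hypotheses (nx_cycle : nx = suc \/ nx = pre) (ori : forall g, oriented nx g).

Definition coord (B : 'M[K]_3) : G * 'I_3 :=
  xget (1%g, o0) [set ga : G * 'I_3 | Q 0 (mv ga.1 ga.2) B]%classic.
(** The action of g on lattice classes, transported from left multiplication on cosets. *)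
Definition mv_act (g : G) (B : 'M[K]_3) := mv (g * (coord B).1)%g (coord B).2.
Local Notation F := mv_act.

Lemma coordP B : B \in unitmx -> Q 0 (mv (coord B).1 (coord B).2) B.
Proof.
move=> uB; rewrite /coord; case: xgetP => [ga _ //|no].
by have [g [a q]] := lab_surj lab uB; case: (no (g, a)).
Qed.

Lemma mv_act_coset g h k a b : Q 0 (mv h a) (mv k b) -> Q 0 (mv (g * h)%g a) (mv (g * k)%g b).
Proof.
move=> /(lab_inj lab) [<- [i ->]]; rewrite mulgA; apply: Q_sym; exact: lab_pow.
Qed.

Lemma mv_act_eq g h a B : B \in unitmx -> Q 0 (mv h a) B -> Q 0 (F g B) (mv (g * h)%g a).
Proof.
by move=> uB q; apply: mv_act_coset; apply: Q0_trans (coordP uB) (Q_sym q).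
Qed.

Lemma mv_actE g h a : Q 0 (F g (mv h a)) (mv (g * h)%g a).
Proof. by apply: mv_act_eq; [exact: um | exact: Q_refl]. Qed.

(** Adjacent vertices lie in a common chamber, whose orientation tells their types apart. *)
Lemma next_tag g h a b : Q 1 (mv g a) (mv h b) -> b = nx a /\
  exists k, Q 0 (mv g a) (mv k a) /\ Q 0 (mv h b) (mv k b).
Proof.
move=> q; have [ab [k [qa qb]]] := lab_chamber lab q; split; last by exists k.
have [n1 n2 n3 bE] := step_cycle nx_cycle a.
case: (bE b) => // bA; first by rewrite bA eqxx in ab.
have qk : Q 1 (mv k a) (mv k b) by apply/(Q0_l _ _ qa)/(Q0_r _ _ qb).
have := ori k b; rewrite {2}bA n3 => q'.
by case: (no_loop (um k a) (um k b) qk q').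
Qed.

Lemma mv_act_Q1 g A B : A \in unitmx -> B \in unitmx -> Q 1 A B -> Q 1 (F g A) (F g B).
Proof.
move=> uA uB; have qA := coordP uA; have qB := coordP uB.
move=> /(Q0_l _ _ qA).2/(Q0_r _ _ qB).2; case: (coord A) (coord B) qA qB => [h a] [h' b] /= qA qB.
move=> /next_tag [bE [k [ka kb]]].
apply/(Q0_l _ _ (mv_act_eq g uA qA))/(Q0_l _ _ (mv_act_coset g ka)).
apply/(Q0_r _ _ (mv_act_eq g uB qB))/(Q0_r _ _ (mv_act_coset g kb)).
by rewrite bE; exact: ori.
Qed.

Lemma mv_act_unit g B : F g B \in unitmx. Proof. exact: um. Qed.

Lemma mv_act_Q0 g A B : A \in unitmx -> B \in unitmx -> Q 0 A B -> Q 0 (F g A) (F g B).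
Proof.
by move=> uA uB q; apply: mv_act_eq => //; apply: Q0_trans (coordP uB) (Q_sym q).
Qed.

Lemma mv_act_Q g m A B : A \in unitmx -> B \in unitmx -> Q m A B -> Q m (F g A) (F g B).
Proof.
move=> uA uB; elim: m A uA => [|m IHm] A uA; first exact: mv_act_Q0.
move=> /(Q_split uA) [C [uC qAC qCB]].
by apply: (Q_comp (m := 1) (mv_act_Q1 g uA uC qAC)); exact: IHm.
Qed.

Lemma mv_act_mul g h B : B \in unitmx -> Q 0 (F (g * h)%g B) (F g (F h B)).
Proof.
move=> uB; apply: Q_sym; apply: Q0_trans (mv_actE _ _ _) _.
by rewrite mulgA; exact: Q_refl.
Qed.

Lemma mv_act_one B : B \in unitmx -> Q 0 (F 1%g B) B.
Proof. by move=> uB; rewrite /F mul1g; exact: coordP. Qed.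

Lemma mv_action : lattice_action F.
Proof.
split; [|exact: mv_act_mul|exact: mv_act_one] => g.
have inv A : A \in unitmx -> Q 0 (F g^-1%g (F g A)) A.
  move=> uA; apply: Q0_trans (Q_sym (mv_act_mul _ _ uA)) _; rewrite mulVg; exact: mv_act_one.
have inv' A : A \in unitmx -> Q 0 (F g (F g^-1%g A)) A.
  move=> uA; apply: Q0_trans (Q_sym (mv_act_mul _ _ uA)) _; rewrite mulgV; exact: mv_act_one.
split=> [B _|m A B uA uB|B uB]; first exact: um.
  split; first exact: mv_act_Q.
  move=> /(mv_act_Q g^-1%g (mv_act_unit _ _) (mv_act_unit _ _)).
  by move=> /(Q0_l _ _ (inv _ uA))/(Q0_r _ _ (inv _ uB)).
by exists (F g^-1%g B); [exact: um | exact: inv'].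
Qed.

Lemma mv_corner (J : Type) n a r (d : J -> nat) jb : let b := nx a in let c := nx b in
  (forall i, exists k, s a ^+ i = r ^+ k)%g -> (exists k, r = s a ^+ k)%g -> (r ^+ n = 1)%g ->
  perfect_difference (fun j => (d j)%:R : 'Z_n) -> (d jb)%:R = 0 :> 'Z_n ->
  (forall j, exists i i', r ^+ d j = s b ^+ i * s c ^+ i')%g ->
  corner F n (mv 1%g a) (mv 1%g b) (mv 1%g c) r d jb.
Proof.
move=> b c rs [k0 rE] rn pd db inc; have [n1 n2 n3 bE] := step_cycle nx_cycle a.
have ca : nx c = a by rewrite /c /b n3.
have uF := mv_act_unit.
have F1 h e : Q 0 (F h (mv 1%g e)) (mv h e) by have := mv_actE h 1%g e; rewrite mulg1.
have ok i : Q 0 (mv (s a ^+ i)%g a) (mv 1%g a) by have := lab_pow 1%g a i; rewrite mul1g.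
have cosets h e : Q 0 (mv 1%g e) (mv h e) -> exists i, (h = s e ^+ i)%g.
  by move=> /(lab_inj lab) [_ [i ->]]; exists i; rewrite mul1g.
split=> //; try by split; exact: um.
- by split; [exact: ori | exact: ori | rewrite -[X in Q 1 _ (mv _ X)]ca; exact: ori].
- by apply: Q0_trans (F1 _ _) _; rewrite rE.
- move=> B uB; have [h [e q]] := lab_surj lab uB => /(Q0_r _ _ q)/next_tag [eE [k [/cosets [i ki] qk]]].
  have [k' E] := rs i; exists k'; rewrite -E -ki.
  by apply: Q0_trans (F1 _ _) _; rewrite /b -eE; apply: Q0_trans (Q_sym qk) q.
- move=> B uB; have [h [e q]] := lab_surj lab uB => /(Q0_l _ _ q)/next_tag [ae [k [qk /cosets [i ki]]]].
  have [k' E] := rs i; exists k'; rewrite -E -ki.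
  apply: Q0_trans (F1 _ _) _; apply: (Q0_trans _ q); apply: Q_sym.
  case: (bE e) => eE; last by rewrite /c /b -eE.
    by case/eqP: n1; rewrite -{1}eE -ae.
  by case/eqP: n2; rewrite -eE -ae.
- move=> j; have [i [i' e]] := inc j; apply/(Q0_r _ _ (F1 _ _)); rewrite e.
  have := lab_pow (s b ^+ i)%g c i' => q; apply/(Q0_r _ _ q).
  have := lab_pow 1%g b i; rewrite mul1g => q'; apply/(Q0_l _ _ q'); exact: ori.
Qed.
End Oriented.

Variables (J : finType) (n : nat) (d : 'I_3 -> J -> nat) (jb : J).
Hypotheses (n1 : (1 < n)%N) (nJ : n = (#|J|.-1 ^ 2 + #|J|.-1 + 1)%N)
  (sn : forall a, (s a ^+ n = 1)%g) (d0 : forall a, d a jb = 0%N)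
  (dd : forall a, perfect_difference (fun j => (d a j)%:R : 'Z_n))
  (rel : forall j, (s o0 ^+ d o0 j * s o1 ^+ d o1 j * s o2 ^+ d o2 j = 1)%g).

Lemma lab_invX a k : ((s a ^+ k)^-1 = s a ^+ (n.-1 * k))%g.
Proof.
apply: (mulgI (s a ^+ k)%g); rewrite mulgV -expgnDr -mulSn prednK ?(ltnW n1) //.
by rewrite expgnA sn expg1n.
Qed.

(** The two orientations lead to triangles that differ by the order of the vertices and by the choice of
the generators s a or of their inverses. *)
Theorem labelling_false : False.
Proof.
have [nx nxE ori] := coherent.
have base a : (d a jb)%:R = 0 :> 'Z_n by rewrite d0.
have rel1 j : (s o1 ^+ d o1 j * s o2 ^+ d o2 j * s o0 ^+ d o0 j = 1)%g.
  by apply: (mulgI (s o0 ^+ d o0 j)%g); rewrite !mulgA rel mul1g mulg1.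
have rel2 j : (s o2 ^+ d o2 j * s o0 ^+ d o0 j * s o1 ^+ d o1 j = 1)%g.
  by apply: (mulgI (s o1 ^+ d o1 j)%g); rewrite !mulgA rel1 mul1g mulg1.
have relV (x y z : G) : (x * y * z = 1)%g -> (x^-1 = y * z)%g.
  by move=> e; apply: (mulgI x); rewrite mulgV mulgA e.
have relW (x y z : G) : (x * y * z = 1)%g -> (z = y^-1 * x^-1)%g.
  by move=> e; rewrite -invgM; apply: (mulgI (x * y)%g); rewrite mulgV.
case: (nxE) => E.
- have [s0 s1 s2] : [/\ nx o0 = o1, nx o1 = o2 & nx o2 = o0] by rewrite E; split; apply/val_inj.
  have cor a : (forall j, exists i i', (s a)^-1 ^+ d a j = s (nx a) ^+ i * s (nx (nx a)) ^+ i')%g ->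
      corner mv_act n (mv 1%g a) (mv 1%g (nx a)) (mv 1%g (nx (nx a))) (s a)^-1%g (d a) jb.
    move=> inc; apply: (mv_corner nxE ori) => // [i| |].
    + by exists (n.-1 * i)%N; rewrite expVgn -lab_invX invgK.
    + by exists (n.-1 * 1)%N; rewrite -lab_invX expg1.
    + by rewrite expVgn sn invg1.
  have c0 := cor o0; have c1 := cor o1; have c2 := cor o2.
  rewrite ?s0 ?s1 ?s2 ?s0 in c0 c1 c2.
  apply: (@triangle_false _ _ _ _ (mv_action nxE ori) J n n1 _ _ _ _ _ _ _ _ _ jb nJ).
  split; [apply: c0 | apply: c1 | apply: c2 |] => j; rewrite ?expVgn.
  + by exists (d o1 j), (d o2 j); exact: relV.
  + by exists (d o2 j), (d o0 j); exact: relV.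
  + by exists (d o0 j), (d o1 j); exact: relV.
  + by rewrite -!invgM !mulgA rel invg1.
- have [s0 s1 s2] : [/\ nx o0 = o2, nx o1 = o0 & nx o2 = o1] by rewrite E; split; apply/val_inj.
  have cor a : (forall j, exists i i', s a ^+ d a j = s (nx a) ^+ i * s (nx (nx a)) ^+ i')%g ->
      corner mv_act n (mv 1%g a) (mv 1%g (nx a)) (mv 1%g (nx (nx a))) (s a) (d a) jb.
    move=> inc; apply: (mv_corner nxE ori) => // [i|].
    + by exists i.
    + by exists 1%N; rewrite expg1.
  have c0 := cor o0; have c1 := cor o1; have c2 := cor o2.
  rewrite ?s0 ?s2 ?s1 ?s0 in c0 c1 c2.
  apply: (@triangle_false _ _ _ _ (mv_action nxE ori) J n n1 _ _ _ _ _ _ _ _ _ jb nJ).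
  split; [apply: c2 | apply: c1 | apply: c0 | by []] => j.
  + by exists (n.-1 * d o1 j)%N, (n.-1 * d o0 j)%N; rewrite -!lab_invX; exact: relW.
  + by exists (n.-1 * d o0 j)%N, (n.-1 * d o2 j)%N; rewrite -!lab_invX; exact: relW.
  + by exists (n.-1 * d o2 j)%N, (n.-1 * d o1 j)%N; rewrite -!lab_invX; exact: relW.
Qed.
End Labelling.

(** * Classical difference sets *)

Section RegularCycle.
Variables (T : Type) (n : nat) (f : T -> T).
Hypotheses (n0 : (0 < n)%N) (reg : regular_cycle n f).

Lemma cycle_mod k x : iter (k %% n) f x = iter k f x.
Proof.
have [per _] := reg; rewrite {2}(divn_eq k n) addnC iterD; congr iter.
by elim: (k %/ n)%N => [|m IHm] //; rewrite mulSn iterD -IHm per.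
Qed.

Lemma cycle_inj i j x : iter i f x = iter j f x -> (i = j %[mod n])%N.
Proof.
have [_ /(_ x (iter i f x)) [k [_ uk]]] := reg => e.
have ki := uk (Ordinal (ltn_pmod i n0)) (cycle_mod _ _).
have kj := uk (Ordinal (ltn_pmod j n0)) (etrans (cycle_mod _ _) (esym e)).
by have /(congr1 val) := etrans (esym ki) kj.
Qed.

Lemma cycle_trans x y : exists i, iter i f x = y.
Proof. by have [_ /(_ x y) [k [e _]]] := reg; exists k. Qed.
End RegularCycle.

Section Plane.
Variable F : finFieldType.

(** Planes of a three-dimensional space intersect in dimension one. *)
Lemma lines_meet1 (l l' : pg_line F) : l <> l' ->
  exists2 y, incident y l /\ incident y l' & forall z, incident z l -> incident z l' -> z = y.
Proof.
case: l l' => [U dU] [W dW] ne; have [/eqP eU /eqP eW] := (dU, dW).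
have dim1 : \dim (U :&: W) = 1%N.
  have := dimv_sum_cap U W; rewrite eU eW => e.
  have := dimvS (subvf (U + W)); rewrite dimvf /dim /= => le3.
  have le2 : (\dim (U :&: W) <= 2)%N by have := dimvS (capvSl U W); rewrite eU.
  have ne2 : \dim (U :&: W) <> 2%N.
    move=> e2; apply: ne; apply: val_inj => /=.
    have eUW : (U :&: W)%VS = U by apply/eqP; rewrite eqEdim capvSl eU e2.
    by apply/eqP; rewrite eqEdim eU eW leqnn andbT -eUW capvSr.
  move: e le3 le2 ne2; rewrite mul1n; lia.
have yP : \dim (U :&: W) == 1%N by rewrite dim1.
exists (exist _ (U :&: W)%VS yP); first by split; rewrite /incident /= (capvSl, capvSr).
case=> Z dZ; rewrite /incident /= => ZU ZW; apply: val_inj => /=.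
by apply/eqP; rewrite eqEdim subv_cap ZU ZW dim1 (eqP dZ).
Qed.

Variables (n : nat) (f : pg_point F -> pg_point F) (h : pg_line F -> pg_line F).
Variables (x : pg_point F) (l : pg_line F).
Hypotheses (n1 : (1 < n)%N) (aut : pg_automorphism f h) (rf : regular_cycle n f) (rh : regular_cycle n h).
Let n0 := ltnW n1.
Let D k := incident x (iter k h l).

Lemma incident_iter k y m : incident y m <-> incident (iter k f y) (iter k h m).
Proof. by have [_ _ inc] := aut; elim: k => [|k IHk] //=; rewrite -inc. Qed.

(** The common point of the lines l and h^r l is an image of x, which is brought back to x. *)
Lemma singer_exists r : (r %% n)%N <> 0%N -> exists a, D (r + a) /\ D a.
Proof.
move=> r0; have [|y [y0 yr] _] := @lines_meet1 l (iter r h l).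
  by move=> e; apply: r0; rewrite (cycle_inj n0 rh (i := r) (j := 0) (x := l)) ?mod0n.
have [i iE] := cycle_trans rf x y; exists ((n - 1) * i)%N; rewrite /D.
have xE : x = iter ((n - 1) * i) f y.
  rewrite -iE -iterD -mulSnr subn1 prednK //.
  by rewrite -(cycle_mod rf) modnMr.
by split; rewrite xE; [rewrite addnC iterD|]; apply: (incident_iter _ _ _).1.
Qed.

(** The point x and its image under the power c - a lie both on the lines of exponents c and e, which are
distinct. *)
Lemma singer_unique a b c e : D a -> D b -> D c -> D e -> (a + e = c + b %[mod n])%N ->
  ~ (a = b %[mod n])%N -> (a = c %[mod n])%N.
Proof.
move=> Da Db Dc De E ab; pose m := (c + (n - 1) * a)%N.
have am : (m + a = c %[mod n])%N.
  by rewrite /m -addnA -mulSnr subn1 prednK // mulnC addnC modnMDl.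
have em : (m + b = e %[mod n])%N.
  apply/eqP; rewrite -(eqn_modDr a) addnAC -modnDml am modnDml; apply/eqP.
  by rewrite [(e + a)%N]addnC.
have I1 : incident (iter m f x) (iter c h l).
  by rewrite -(cycle_mod rh) -am (cycle_mod rh) iterD; apply: (incident_iter _ _ _).1.
have I2 : incident (iter m f x) (iter e h l).
  by rewrite -(cycle_mod rh) -em (cycle_mod rh) iterD; apply: (incident_iter _ _ _).1.
have [ce|y _ yU] := @lines_meet1 (iter c h l) (iter e h l).
  apply: ab; apply/eqP; rewrite -(eqn_modDr e) E; apply/eqP.
  by rewrite addnC -[in RHS]modnDmr -(cycle_inj n0 rh ce) modnDmr.
have mx : iter m f x = iter 0 f x by rewrite (yU _ I1 I2) (yU x Dc De).
have m0 := cycle_inj n0 rf mx.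
by rewrite -am -modnDml m0 mod0n add0n.
Qed.
End Plane.

Lemma classical_perfect q (D : {set 'Z_(q ^ 2 + q + 1)}) (J : Type) (delta : J -> {d | d \in D}) :
  (0 < q)%N -> classical_difference_set D -> bijective delta ->
  perfect_difference (fun j => (val (val (delta j)))%:R : 'Z_(q ^ 2 + q + 1)).
Proof.
move=> q0 [F [f [h [x [l [qF [aut]]]]]]]; rewrite qF; set n := (q ^ 2 + q + 1)%N => rf rh DP bij.
have n1 : (1 < n)%N by rewrite /n addn1 ltnS addn_gt0 q0 orbT.
have n0 := ltnW n1.
have nE (j : J) : (val (val (delta j)))%:R = val (delta j) :> 'Z_n by rewrite natr_Zp.
have vE k : val (k%:R : 'Z_n) = (k %% n)%N := val_Zp_nat n1 k.
have DN k : (k%:R : 'Z_n) \in D <-> incident x (iter k h l).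
  by rewrite DP vE (cycle_mod rh).
have DZ (a : 'Z_n) : a \in D -> incident x (iter (val a) h l) by move/DP.
have modE a b : (a%:R = b%:R :> 'Z_n) -> (a = b %[mod n])%N.
  by move/(congr1 val); rewrite !vE.
split=> [j k|r r0|j k j' k' jk]; rewrite ?nE.
- by move/val_inj; exact: (bij_inj bij).
- have [|a [D1 D2]] := @singer_exists F n f h x l n1 aut rf rh (val r).
    move=> r00; case/eqP: r0; rewrite -[r]natr_Zp; apply: val_inj.
    by rewrite vE r00.
  have [g _ gK] := bij.
  have P1 : ((val r + a)%:R : 'Z_n) \in D by apply/DN.
  have P2 : (a%:R : 'Z_n) \in D by apply/DN.
  exists (g (SigSub P1)), (g (SigSub P2)); rewrite !nE !gK /=.
  by rewrite natrD natr_Zp addrK.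
- move=> e; have M (i : J) := DZ _ (valP (delta i)).
  have H : (val (val (delta j)) = val (val (delta j')) %[mod n])%N.
    apply: (singer_unique n1 aut rf rh (M j) (M k) (M j') (M k')).
      apply: modE; rewrite !natrD !nE; apply/eqP; rewrite -subr_eq0.
      by move/eqP: e; rewrite -subr_eq0 => /eqP <-; apply/eqP; ring.
    move=> jk'; apply: jk; apply: (bij_inj bij); apply: val_inj.
    by rewrite -(nE j) -(nE k); apply: val_inj; rewrite !vE.
  have jj : j = j'.
    apply: (bij_inj bij); apply: val_inj.
    by rewrite -(nE j) -(nE j'); apply: val_inj; rewrite !vE.
  split=> //; apply: (bij_inj bij); apply: val_inj; rewrite -jj in e.
  by move: e => /addrI /oppr_inj.
Qed.

(** * Lattice classes as classes of matrices *)

Section Lattice.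
Local Open Scope classical_set_scope.
Local Open Scope ring_scope.
Variables (p : nat) (R : dvr p).
Local Notation K := (dvr_field R).
Local Notation pi := (p%:R : R).
Local Notation fr := (@dvr_frac p R).
Local Notation io := (map_mx fr).
Implicit Types (A B : 'M[K]_3) (L : set 'rV[K]_3).

(** The following four definitions are those of the Bruhat-Tits building, over any valuation ring. *)
Definition lat B : set 'rV[K]_3 := [set io a *m B | a in [set: 'rV[R]_3]].
Definition scl (c : K) L : set 'rV[K]_3 := [set c *: v | v in L].
Definition hcl L : set (set 'rV[K]_3) := [set scl c L | c in [set c : K | c != 0]].
Definition ladj (x y : set (set 'rV[K]_3)) : Prop :=
  exists L M : set 'rV[K]_3, [/\ x L, y M, scl p%:R L `<` M & M `<` L].

Lemma lat_scale c B : scl c (lat B) = lat (c *: B).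
Proof.
apply/seteqP; split=> v [w].
  by move=> [a _ <-] <-; exists a => //; rewrite scalemxAr.
by move=> _ <-; exists (io w *m B); [exists w | rewrite scalemxAr].
Qed.

Lemma lat_sub A B : lat A `<=` lat B <-> exists N : 'M[R]_3, A = io N *m B.
Proof.
split=> [AB|[N ->] v [a _ <-]]; last by exists (a *m N) => //; rewrite map_mxM mulmxA.
have row_in i : lat A (row i A).
  by exists (delta_mx ord0 i) => //; rewrite rowE map_delta_mx.
have /boolp.choice [w wP] : forall i, exists w : 'rV[R]_3, io w *m B = row i A.
  by move=> i; have [a _ e] := AB _ (row_in i); exists a.
exists (\matrix_i w i); apply/row_matrixP => i.
by rewrite row_mul -map_row rowK wP.
Qed.

Lemma io_cancel (N : 'M[R]_3) B : B \in unitmx -> io N *m B = B -> N = 1%:M.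
Proof.
move=> uB e; apply: (@io_inj _ R); rewrite map_mx1.
by rewrite -[LHS](mulmxK uB) e mulmxV.
Qed.

Lemma hcl_scale c L : c != 0 -> hcl (scl c L) = hcl L.
Proof.
move=> c0; have sc a b (M : set 'rV[K]_3) : scl a (scl b M) = scl (a * b) M.
  apply/seteqP; split=> v [w]; first by move=> [u Mu <-] <-; exists u => //; rewrite scalerA.
  by move=> Mw <-; exists (b *: w); [exists w | rewrite scalerA].
apply/seteqP; split=> M [a /= a0 <-].
  by exists (a * c); rewrite ?sc //= mulf_neq0.
by exists (a / c); rewrite ?sc ?divfK //= mulf_neq0 ?invr_eq0.
Qed.

Lemma hclP A B : A \in unitmx -> B \in unitmx -> hcl (lat A) = hcl (lat B) <-> Q 0 A B.
Proof.
move=> uA uB; split=> [e|[c [N [c0 /dv0 uN e]]]].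
  have : hcl (lat A) (lat A) by exists 1; [exact: oner_neq0 | rewrite lat_scale scale1r].
  rewrite e => -[c /= c0]; rewrite lat_scale => /esym eL.
  have [N eN] : exists N : 'M[R]_3, A = io N *m (c *: B) by apply/lat_sub; rewrite eL.
  have [N' eN'] : exists N : 'M[R]_3, c *: B = io N *m A by apply/lat_sub; rewrite eL.
  exists c, N'; split=> //; apply/dv0.
  have /io_cancel : io (N *m N') *m A = A by rewrite map_mxM -mulmxA -eN' -eN.
  by move=> /(_ uA) /mulmx1_unit [].
rewrite -[RHS](hcl_scale _ c0) lat_scale e; congr hcl; apply/seteqP; split; apply/lat_sub.
  by exists (invmx N); rewrite mulmxA -map_mxM mulVmx // map_mx1 mul1mx.
by exists N.
Qed.

(** If p L is contained in M and M in L, with matrices N' and N, then N' N = p has determinant p^3. As both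
inclusions are strict, N or N' has a determinant of valuation 1. *)
Lemma ladjP A B : A \in unitmx -> B \in unitmx ->
  ladj (hcl (lat A)) (hcl (lat B)) <-> Q 1 A B \/ Q 1 B A.
Proof.
move=> uA uB.
have fpi : (p%:R : K) != 0 by rewrite -(rmorph_nat fr) fr_eq0 pi_neq0.
have uZ c (C : 'M[K]_3) : c != 0 -> C \in unitmx -> c *: C \in unitmx.
  by move=> c0 uC; rewrite unitmxZ // unitfE.
have hc (c : K) C : c != 0 -> hcl (lat C) (lat (c *: C)) by exists c; rewrite // lat_scale.
have step (C C' : 'M[K]_3) c (N : 'M[R]_3) : C \in unitmx -> c != 0 -> dv 1 N -> c *: C' = io N *m C ->
    scl p%:R (lat C) `<` lat (c *: C') /\ lat (c *: C') `<` lat C.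
  move=> uC c0 vN e; have [u uu dN] := vN.
  have C'u : c *: C' \in unitmx by rewrite e unitmx_mul uC (dv_io vN).
  rewrite lat_scale /proper; split; split.
  - apply/lat_sub; exists (u^-1 *: \adj N).
    rewrite e mulmxA -map_mxM -scalemxAl mul_adj_mx dN scale_scalar_mx expr1 mulrC mulrK //.
    by rewrite map_scalar_mx /= rmorph_nat mul_scalar_mx.
  - move/lat_sub => [N' e'].
    have : io N *m C = io (pi *: N') *m C.
      by rewrite -e e' map_mxZ /= rmorph_nat -scalemxAl -scalemxAr.
    move/(congr1 (fun X => X *m invmx C)); rewrite !mulmxK // => /(@io_inj _ R) eN.
    have pN : \det N' != 0.
      by apply: contraTneq (dv_neq0 vN) => z; rewrite eN detZ z mulr0 eqxx.
    have [k [v uv dN']] := det0_dv pN.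
    have : dv (3 + k) N by exists v => //; rewrite eN detZ dN' exprD mulrA.
    by move/(dv_inj vN).
  - by apply/lat_sub; exists N.
  - move/lat_sub => [N']; rewrite e mulmxA -map_mxM => /esym /(io_cancel uC) /mulmx1_unit [_ /dv0 vN0].
    by have := dv_inj vN vN0.
split.
  move=> [L [M [[c /= c0 <-] [d /= d0 <-]]]]; rewrite !lat_scale => -[/lat_sub[N' e'] n'] [/lat_sub [N e] n].
  have NN : N' *m N = pi%:M.
    apply: (@io_inj _ R); rewrite map_mxM map_scalar_mx /= rmorph_nat.
    apply: (can_inj (mulmxK (uZ c A c0 uA))); rewrite -mulmxA -e -e' mul_scalar_mx //.
  have dNN : dv (1 * 3) (N' *m N) by rewrite NN -[pi]expr1; exact: pi_dv.
  have N0 : \det N != 0.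
    by apply: contraTneq (dv_neq0 dNN) => z; rewrite det_mulmx z mulr0 eqxx.
  have [m vN] := det0_dv N0.
  have N0' : \det N' != 0.
    by apply: contraTneq (dv_neq0 dNN) => z; rewrite det_mulmx z mul0r eqxx.
  have [k vN'] := det0_dv N0'.
  have mk : (k + m = 3)%N := dv_inj (dv_mul vN' vN) dNN.
  have m0 : m <> 0%N.
    move=> m0; rewrite m0 in vN; move/dv0: vN => uN; apply: n; apply/lat_sub.
    by exists (invmx N); rewrite e mulmxA -map_mxM mulVmx // map_mx1 mul1mx.
  have k0 : k <> 0%N.
    move=> k0; rewrite k0 in vN'; move/dv0: vN' => uN; apply: n'; apply/lat_sub.
    by exists (invmx N'); rewrite e' mulmxA -map_mxM mulVmx // map_mx1 mul1mx.
  have [m1|k1] : m = 1%N \/ k = 1%N by lia.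
    left; exists (d / c), N; split; rewrite ?mulf_neq0 ?invr_eq0 //; first by rewrite -m1.
    by rewrite mulrC -scalerA e -scalemxAr scalerA mulVf // scale1r.
  right; exists (p%:R * c / d), N'; split; rewrite ?mulf_neq0 ?invr_eq0 //; first by rewrite -k1.
  by rewrite mulrC -scalerA -[p%:R * c *: A]scalerA e' -scalemxAr scalerA mulVf // scale1r.
case=> -[c [N [c0 vN e]]].
  have [h1 h2] := step _ _ _ _ uA c0 vN e.
  exists (lat A), (lat (c *: B)); split=> //; last exact: hc.
  by have := hc 1 A; rewrite scale1r; apply; exact: oner_neq0.
have [h1 h2] := step _ _ _ _ uB c0 vN e.
exists (lat (c *: A)), (lat ((p%:R : K) *: B)); split; [exact: hc | exact: hc | |by rewrite -lat_scale].
move: h2; rewrite -lat_scale -[lat (_ *: B)]lat_scale => -[i1 i2]; split.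
  by move=> v [w /i1 Bw <-]; exists w.
move=> i3; apply: i2 => w Bw.
have [|w' Aw' /(scalerI fpi) <- //] := i3 (p%:R *: w).
by exists w.
Qed.
End Lattice.

(** * The labelling given by an isomorphism *)

Section FlagComplexes.
Local Open Scope classical_set_scope.

Lemma flag2 (V : Type) (adj : V -> V -> Prop) u v : u <> v ->
  flag adj [set u; v] <-> adj u v /\ adj v u.
Proof.
move=> uv; split=> [[_ _ H]|[auv avu]].
  by split; apply: H => //; [left | right | right | left | move/esym].
split; [exact: finite_set2 | by exists u; left |].
by move=> x y [->|->] [->|->].
Qed.

(** The edges of the graph are the simplices with two vertices. *)
Lemma flag_iso V W (aV : V -> V -> Prop) (aW : W -> W -> Prop) :
  complex_iso (flag_complex aV) (flag_complex aW) ->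
  exists2 f : V -> W, bijective f & forall u v, u <> v ->
    (aV u v /\ aV v u) <-> (aW (f u) (f v) /\ aW (f v) (f u)).
Proof.
move=> [f [bf H]]; exists f => // u v uv; have inj := bij_inj bf.
have := H [set u; v]; rewrite /= image_setU !image_set1 => {}H.
by rewrite -(flag2 aV uv) -flag2 //; move/inj.
Qed.

End FlagComplexes.

Section Label.
Local Open Scope classical_set_scope.
Local Open Scope ring_scope.
Variables (p : nat) (p_pr : prime p) (G : groupType) (s : 'I_3 -> G) (n : nat).
Local Notation R := (padic_dvr p_pr).
Local Notation K := (dvr_field R).
Hypotheses (n0 : (0 < n)%N) (sn : forall a, (s a ^+ n = 1)%g).
Local Notation S a := (cyclic_subgroup (s a)).
Local Notation CV := (coset_vertex (fun a => S a)).
Local Notation LV := (@lattice_classes p p_pr 3).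

Lemma class_rep (y : LV) : exists2 B : 'M[K]_3, B \in unitmx & hcl (lat B) = val y.
Proof. by case: y => y yP; have := set_mem yP => -[L [B uB eL] e]; exists B => //=; rewrite -e eL. Qed.

Lemma class_of (B : 'M[K]_3) : B \in unitmx -> exists y : LV, val y = hcl (lat B).
Proof.
move=> uB; have P : hcl (lat B) \in LV by apply/mem_set; exists (lat B) => //; exists B.
by exists (SigSub P).
Qed.

Lemma lattice_adjE (x y : LV) : lattice_adj x y <-> ladj (R := R) (val x) (val y).
Proof. by []. Qed.

Definition vtx g a : CV :=
  existT (fun a => left_cosets (S a)) a (SigSub (mem_set (imageT (fun g => left_coset g (S a)) g))).

Lemma vtx_surj (u : CV) : exists g a, u = vtx g a.
Proof.
case: u => a [c cP]; have [g _ e] := set_mem cP; exists g, a.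
by congr existT; apply: val_inj.
Qed.

Lemma vtx_eq g h a : left_coset g (S a) = left_coset h (S a) -> vtx g a = vtx h a.
Proof. by move=> e; congr existT; apply: val_inj. Qed.

Lemma cyc_pow a h : S a h -> exists i, h = (s a ^+ i)%g.
Proof.
move=> [k [->|->]]; first by exists k.
exists (n.-1 * k)%N; apply: (mulgI (s a ^+ k)%g).
by rewrite mulgV -expgnDr -mulSn prednK // expgnA sn expg1n.
Qed.

Lemma vtx_inj g h a b : vtx g a = vtx h b -> a = b /\ exists i, (h = g * s a ^+ i)%g.
Proof.
move=> e; have ab : a = b := congr1 (@tag _ _) e; split=> //; rewrite -ab in e.
have ec : left_coset g (S a) = left_coset h (S a) := congr1 (fun u : CV => val (tagged u)) e.
have : left_coset h (S a) h by exists 1%g; [exists 0%N; left | rewrite mulg1].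
by rewrite -ec => -[t /cyc_pow [i ->] <-]; exists i.
Qed.

Lemma coset_sym (u v : CV) : coset_adj u v -> coset_adj v u.
Proof. by move=> [uv [g [e1 e2]]]; split; [exact/nesym | exists g]. Qed.

Lemma exists_labelling :
  complex_iso (coset_complex (fun a => S a)) (SL_building p_pr 3) ->
  exists mv : G -> 'I_3 -> 'M[K]_3, labelling s mv.
Proof.
move=> /flag_iso [f bf adjE].
have /boolp.choice [m mP] : forall ga : G * 'I_3, exists B : 'M[K]_3,
    B \in unitmx /\ hcl (lat B) = val (f (vtx ga.1 ga.2)).
  by move=> ga; have [B uB e] := class_rep (f (vtx ga.1 ga.2)); exists B.
pose mv g a := m (g, a); exists mv.
have um g a : mv g a \in unitmx by case: (mP (g, a)).
have mvE g a : hcl (lat (mv g a)) = val (f (vtx g a)) by case: (mP (g, a)).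
have mv_eq g h a b : Q 0 (mv g a) (mv h b) <-> vtx g a = vtx h b.
  rewrite -(hclP (um _ _) (um _ _)) !mvE; split=> [e|-> //].
  by apply: (bij_inj bf); exact: val_inj.
have adjP g h a b : vtx g a <> vtx h b -> coset_adj (vtx g a) (vtx h b) <->
    Q 1 (mv g a) (mv h b) \/ Q 1 (mv h b) (mv g a).
  move=> ne; have E := adjE _ _ ne; rewrite !lattice_adjE -!mvE in E.
  split=> [A|q].
    by have [A1 _] := E.1 (conj A (coset_sym A)); apply/ladjP.
  have [|//] := E.2 _.
  by split; apply/ladjP => //; case: q; [right | left].
split=> //.
- move=> g a; apply/mv_eq/vtx_eq; apply/seteqP; split=> x [t /cyc_pow [i ->] <-].
    exists (s a ^+ i.+1)%g; first by exists i.+1; left.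
    by rewrite expgS mulgA.
  exists (s a ^+ (n.-1 + i))%g; first by exists (n.-1 + i)%N; left.
  by rewrite -mulgA -expgS -addSn prednK // expgnDr sn mul1g.
- by move=> g h a b /mv_eq /vtx_inj.
- move=> B uB; have [y ye] := class_of uB.
  have [f' _ fK'] := bf; have [g [a e]] := vtx_surj (f' y).
  exists g, a; apply/(hclP (um _ _) uB); rewrite mvE -e fK'; exact: ye.
- move=> g a b ab; apply/adjP.
    by move=> /vtx_inj [/eqP]; rewrite (negPf ab).
  split; first exact/eqP.
  by exists g.
- move=> g h a b q.
  have ne : vtx g a <> vtx h b.
    by move=> /mv_eq q0; have := Q_mod3 (um _ _) (um _ _) q q0.
  have [ab [k [ka kb]]] := (adjP _ _ _ _ ne).2 (or_introl q).
  split; first exact/eqP.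
  by exists k; split; apply/mv_eq/vtx_eq.
Qed.
End Label.

(** * Presented groups and the conclusion *)

Section Presented.
Variables (T : choiceType) (rels : set (word T)).
Local Notation G := (presented_group rels).

Lemma pres_class_cat u v : pres_class rels (u ++ v) = (pres_class rels u * pres_class rels v)%g.
Proof.
apply/pres_classP; apply: word_eq_cat; apply: word_eq_sym; exact: word_eq_repr.
Qed.

Lemma pres_class_pow x k : pres_class rels (word_pow x k) = (pres_gen rels x ^+ k)%g.
Proof.
elim: k => [//|k IHk]; rewrite expgS -IHk -pres_class_cat //.
Qed.

Lemma pres_class_rel w : rels w -> pres_class rels w = 1%g.
Proof. by move=> Rw; apply/pres_classP; exact: word_eq_relator. Qed.

(** When the generators have finite order, no inverse letter is needed. *)
Lemma pres_ind n (P : G -> Prop) : (0 < n)%N -> (forall x, pres_gen rels x ^+ n = 1)%g -> P 1%g ->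
  (forall g x, P g -> P (g * pres_gen rels x)%g) -> forall g, P g.
Proof.
move=> n0 gn P1 PM g; rewrite -[g]pres_classK; elim/last_ind: (repr g) => [|w [x b] IHw]; first exact: P1.
rewrite -cats1 pres_class_cat; case: b; last exact: PM.
have -> : pres_class rels [:: (x, true)] = (pres_gen rels x ^+ n.-1)%g.
  apply: (mulIg (pres_gen rels x)); rewrite -expgSr prednK // gn -pres_class_cat.
  by apply/pres_classP; exact: (word_eq_cancel _ x true).
elim: n.-1 => [|m IHm]; first by rewrite expg0 mulg1.
by rewrite expgSr mulgA; exact: PM.
Qed.
End Presented.

Theorem corollary10p3p18 (q : nat)
    (hq : exists r k : nat, [/\ prime r, (0 < k)%N & q = (r ^ k)%N])
    (D : {set 'Z_(q ^ 2 + q + 1)})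
    (hD : classical_difference_set D)
    (hD0 : 0 \in D)
    (delta : 'I_3 -> 'I_q.+1 -> {d | d \in D})
    (hbij : forall a : 'I_3, bijective (delta a))
    (hdelta0 : forall a : 'I_3, val (delta a ord0) = 0)
    (p : nat) (p_pr : prime p) :
  ~ complex_iso (panel_building delta) (SL_building p_pr 3).
Proof.
have q0 : (0 < q)%N by have [r [k [r_pr _ ->]]] := hq; rewrite expn_gt0 prime_gt0.
have n1 : (1 < q ^ 2 + q + 1)%N by rewrite addn1 ltnS addn_gt0 q0 orbT.
have n0 := ltnW n1.
have ord a : (panel_gen delta a ^+ (q ^ 2 + q + 1) = 1)%g.
  by rewrite -pres_class_pow; apply: pres_class_rel; left; exists a.
move=> /(exists_labelling n0 ord) [mv lab].
pose d (a : 'I_3) (j : 'I_q.+1) : nat := val (val (delta a j)).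
have d0 a : d a ord0 = 0%N by rewrite /d hdelta0.
have dd a : perfect_difference (fun j => (d a j)%:R : 'Z_(q ^ 2 + q + 1)).
  exact: classical_perfect.
have nJ : (q ^ 2 + q + 1 = #|'I_q.+1|.-1 ^ 2 + #|'I_q.+1|.-1 + 1)%N by rewrite card_ord.
have gen (P : panel_lattice delta -> Prop) : P 1%g ->
    (forall g a, P g -> P (g * panel_gen delta a)%g) -> forall g, P g.
  exact: (pres_ind n0 ord).
refine (labelling_false lab gen n1 nJ ord d0 dd _) => j.
pose w a := word_pow a (d a j).
rewrite -!pres_class_pow -mulgA -(pres_class_cat _ (w o1)) -(pres_class_cat _ (w o0)).
apply: pres_class_rel; right; exists j.
by have [-> -> ->] : [/\ o0 = 0, o1 = 1 & o2 = 2%:R] by split; apply/val_inj.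
Qed.
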